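(* Let $m\neq n$ be nonnegative integers. Let $\mathcal H=\mathcal{SL}_{m|n}[[y_{ij},z_{ij}]]$ be the Hopf superalgebra of $SL(m|n,\mathbb C)^{\mathbb R}$ with its graded $\bigstar$-structure, Hopf ideals $I,J$, Lie superalgebra $\mathfrak d$ with scalar product $(\cdot,\cdot)_{\mathfrak d}$ and operator $R_{\mathfrak d}$ (all defined in the context), equipped with the superbracket $$\{f,g\}=\frac12\sum_{a,b}(-1)^{|f||a|}\,(R_{\mathfrak d}(\hat h_a),\hat h_b)_{\mathfrak d}\,\bigl[\nabla^L_{h_a}f\;\nabla^L_{h_b}g-\nabla^R_{h_a}f\;\nabla^R_{h_b}g\bigr],$$ where $(h_a)$ is a homogeneous basis of $\mathfrak d$, $(\hat h_a)$ is its dual basis ($(h_a,\hat h_b)_{\mathfrak d}=\delta_{ab}$) and $|a|=|h_a|$. Then $\mathcal{SU}_{m|n}[[y_{ij},z_{ij}]]=\mathcal H/I$ and $s(\mathcal{AN})[[y_{ij},z_{ij}]]=\mathcal H/J$ are graded real Poisson-Lie sub-supergroups of $(\mathcal H,\{\cdot,\cdot\},\bigstar)$.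
   Context: Parities: $|i|=0$ for $1\le i\le m$ and $|i|=1$ for $m+1\le i\le m+n$; $|f|\in\mathbb Z/2$ is the parity of a homogeneous element $f$. Sweedler notation $\Delta(f)=f'\otimes f''$. Tensor products of formal power series superalgebras are completed. $\mathbb C[[x_{ij}]]$ ($1\le i,j\le m+n$) is the supercommutative superalgebra of formal power series in generators $x_{ij}$ of parity $|i|+|j|$, a Hopf superalgebra with $\Delta(x_{ij})=1\otimes x_{ij}+x_{ij}\otimes1+\sum_k x_{ik}\otimes x_{kj}$, $\varepsilon(x_{ij})=0$, $S(x_{ij})=-\delta_{ij}+((1+X)^{-1})_{ij}$, where $X=(x_{ij})$ and $\Delta,\varepsilon,S$ are superalgebra morphisms. $\mathcal{SL}_{m|n}[[x_{ij}]]$ is its quotient by the Hopf ideal generated by $\mathrm{sdet}(1+X)-1$, where $\mathrm{sdet}\begin{pmatrix}A&B\\C&D\end{pmatrix}=\det(A-BD^{-1}C)/\det D$ ($A$ of size $m\times m$, $D$ of size $n\times n$). $\mathcal H=\mathcal{SL}_{m|n}[[y_{ij},z_{ij}]]=\mathcal{SL}_{m|n}[[y_{ij}]]\otimes\mathcal{SL}_{m|n}[[z_{ij}]]$. The map $\bigstar:\mathcal H\to\mathcal H$ is the even, antilinear, multiplicative map ($(fg)^\bigstar=f^\bigstar g^\bigstar$) given on generators by $y_{ij}^\bigstar=(-1)^{(|i|+|j|)|j|}S(z_{ji})$, $z_{ij}^\bigstar=(-1)^{(|i|+|j|)|j|}S(y_{ji})$. $I\subset\mathcal H$ is the Hopf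 ideal generated by $y_{ij}-z_{ij}$ for all $i,j$. $J\subset\mathcal H$ is the Hopf ideal generated by $y_{ji}$ and $z_{ij}$ for all $i>j$ and by $S(y_{ii})-z_{ii}$ for all $i$. An $\varepsilon$-derivation of a Hopf superalgebra $H$ is a linear map $\delta:H\to\mathbb C$ with $\delta(fg)=\varepsilon(f)\delta(g)+\delta(f)\varepsilon(g)$; it is even if it vanishes on $H_1$ and odd if it vanishes on $H_0$. The $\varepsilon$-derivations form the Lie superalgebra of $H$, with bracket $[\delta_1,\delta_2](f)=\delta_1(f')\delta_2(f'')-(-1)^{|\delta_1||\delta_2|}\delta_2(f')\delta_1(f'')$. $sl(m|n,\mathbb C)$ is the Lie superalgebra of complex $(m+n)\times(m+n)$ supermatrices $M=\begin{pmatrix}P&Q\\R&T\end{pmatrix}$ with $\mathrm{Str}M=\mathrm{tr}P-\mathrm{tr}T=0$ (even: $Q=R=0$; odd: $P=T=0$). The Lie superalgebra $\mathfrak d$ of $\mathcal H$ consists of the $\varepsilon$-derivations $\delta_{(A,B)}$, $A,B\in sl(m|n,\mathbb C)$, with $\delta_{(A,B)}(y_{ij})=A_{ij}$, $\delta_{(A,B)}(z_{ij})=B_{ij}$; it is identified with $sl(m|n,\mathbb C)\oplus sl(m|n,\mathbb C)$. Its scalar product is $((A,B),(C,D))_{\mathfrak d}=-\tfrac i2\mathrm{Str}(AC)+\tfrac i2\mathrm{Str}(BD)$. $\mathfrak g=\{(A,A)\}\subset\mathfrak d$, and $\mathfrak b=\{(A,B): A \text{ lower triangular},\ B\text{ upper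 triangular},\ \text{the diagonal parts satisfy } A_0+B_0=0\}\subset\mathfrak d$. One has $\mathfrak d=\mathfrak g\dotplus\mathfrak b$; $P_{\mathfrak g},P_{\mathfrak b}$ are the corresponding projections, and $R_{\mathfrak d}=P_{\mathfrak b}-P_{\mathfrak g}$. For homogeneous $h\in\mathfrak d$, viewed as an $\varepsilon$-derivation $\delta_h$: $\nabla^R_h(f)=\delta_h(f')f''$ and $\nabla^L_h(f)=(-1)^{|h|(|f|+1)}f'\delta_h(f'')$. A graded $\bigstar$-structure on a Hopf superalgebra $H$ is an even antilinear map $\bigstar:H\to H$ with $(\Delta x)^{\bigstar\otimes\bigstar}=\Delta(x^\bigstar)$, $\varepsilon(x^\bigstar)=\overline{\varepsilon(x)}$, $(xy)^\bigstar=x^\bigstar y^\bigstar$, $S(x^\bigstar)=S(x)^\bigstar$, $(x^\bigstar)^\bigstar=(-1)^{|x|}x$. A graded real supergroup is a supercommutative complex Hopf superalgebra with a graded $\bigstar$-structure. A graded real Poisson-Lie supergroup $(H,\{\cdot,\cdot\},\bigstar)$ is a graded real supergroup $(H,\bigstar)$ with an even bilinear map $\{\cdot,\cdot\}:H\times H\to H$ such that for homogeneous $f,g,h$: $(-1)^{|f||h|}\{f,\{g,h\}\}+(-1)^{|h||g|}\{h,\{f,g\}\}+(-1)^{|g||f|}\{g,\{h,f\}\}=0$; $\{f,g\}=-(-1)^{|f||g|}\{g,f\}$; $\{f,gh\}=\{f,g\}h+(-1)^{|f||g|}g\{f,h\}$; $\Delta\{f,g\}=\{\Delta(f),\Delta(g)\}$,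 where $\{f_1\otimes f_2,g_1\otimes g_2\}=(-1)^{|g_1||f_2|}\{f_1,g_1\}\otimes f_2g_2+(-1)^{|g_1||f_2|}f_1g_1\otimes\{f_2,g_2\}$; and $\{f^\bigstar,g^\bigstar\}=\{f,g\}^\bigstar$. A Hopf ideal $K$ of $H$ satisfies $K H\subset K$, $\varepsilon(K)=0$, $\Delta(K)\subset K\otimes H+H\otimes K$, $S(K)\subset K$. A quotient $H/K$ is a (graded real) Poisson-Lie sub-supergroup of $(H,\{\cdot,\cdot\},\bigstar)$ if $K$ is a Hopf ideal, $K^\bigstar\subset K$ and $\{K,H\}\subset K$ (so that $H/K$ inherits the structures of $H$). *)

(* Defs.v *)
From HB Require Import structures.
From mathcomp Require Import all_boot all_order all_algebra.
From mathcomp Require Import boolp classical_sets reals.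
From mathcomp Require Import ring.
From mathcomp Require Import complex.

Set Implicit Arguments.
Unset Strict Implicit.
Unset Printing Implicit Defensive.

Import Order.TTheory GRing.Theory Num.Theory.

Local Open Scope ring_scope.
Local Open Scope classical_set_scope.
Local Open Scope quotient_scope.

(** A monomial in finitely many supercommuting variables stands for the product of the [g ^ sexp g] taken in the order of
    [enum G]; odd variables square to zero, hence have exponent at most 1. *)

Section Monomials.
Variables (G : finType) (p : pred G).

Record smono := SMono {
  sexp :> {ffun G -> nat};
  sexpP : [forall g, p g ==> (sexp g <= 1)%N] }.

HB.instance Definition _ := [isSub for sexp].
HB.instance Definition _ := [Choice of smono by <:].

Lemma sexp_le1 (A : smono) g : p g -> (A g <= 1)%N.
Proof. exact/implyP/(forallP (sexpP A)). Qed.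

Fact mono1_subproof : [forall g, p g ==> ([ffun _ : G => 0%N] g <= 1)%N].
Proof. by apply/forallP => g; rewrite ffunE implybT. Qed.

Definition mono1 : smono := SMono mono1_subproof.

Fact mvar_subproof x :
  [forall g, p g ==> ([ffun g : G => nat_of_bool (g == x)] g <= 1)%N].
Proof. by apply/forallP => g; rewrite ffunE; case: eqP; rewrite implybT. Qed.

Definition mvar (x : G) : smono := SMono (mvar_subproof x).

Fact msub_subproof (B A : smono) :
  [forall g, p g ==> ([ffun g => B g - A g]%N g <= 1)%N].
Proof.
apply/forallP => g; apply/implyP => pg; rewrite ffunE.
exact: leq_trans (leq_subr _ _) (sexp_le1 _ pg).
Qed.

Definition msub (B A : smono) : smono := SMono (msub_subproof B A).

Definition mdeg (A : smono) : nat := \sum_g A g.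

Definition mpar (A : smono) : bool := odd (\sum_(g | p g) A g).

Definition mle (A B : smono) : bool := [forall g, (A g <= B g)%N].

(* The number of transpositions of odd variables needed to sort the product
   of [A] by [B]. *)
Definition minversions (A B : smono) : nat :=
  \sum_(a | p a) \sum_(b | p b && (enum_rank b < enum_rank a)%N) A a * B b.

Definition mupto (d : nat) : seq smono :=
  [seq A <- pmap insub [seq [ffun g => nat_of_ord (k g)]
                          | k : {ffun G -> 'I_d.+1}]
     | (mdeg A <= d)%N].

Definition mdivs (M : smono) : seq smono := [seq A <- mupto (mdeg M) | mle A M].

Lemma smonoP (A B : smono) : (forall g, A g = B g) -> A = B.
Proof. by move=> AB; apply/val_inj/ffunP. Qed.

Lemma mem_mupto d A : (A \in mupto d) = (mdeg A <= d)%N.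
Proof.
rewrite mem_filter; case: leqP => //= Ad.
rewrite mem_pmap_sub /=; apply/mapP.
have Agd g : (A g < d.+1)%N.
  by rewrite ltnS; apply: leq_trans Ad; rewrite /mdeg (bigD1 g) //= leq_addr.
exists [ffun g => Ordinal (Agd g)]; first by rewrite mem_enum.
by apply/ffunP => g; rewrite !ffunE.
Qed.

Lemma mupto_uniq d : uniq (mupto d).
Proof.
apply/filter_uniq/pmap_sub_uniq; rewrite /image_mem map_inj_uniq ?enum_uniq //.
by move=> k l /ffunP kl; apply/ffunP => g; have := kl g; rewrite !ffunE => /val_inj.
Qed.

Lemma mle_deg A B : mle A B -> (mdeg A <= mdeg B)%N.
Proof. by move/forallP => AB; apply: leq_sum => g _. Qed.

Lemma mem_mdivs M A : (A \in mdivs M) = mle A M.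
Proof.
by rewrite mem_filter mem_mupto; case AM: (mle A M); rewrite //= mle_deg.
Qed.

Lemma mdivs_uniq M : uniq (mdivs M).
Proof. exact/filter_uniq/mupto_uniq. Qed.

End Monomials.

Section Series.
Variables (C : comNzRingType) (G : finType) (p : pred G).

(* [p] gives the parities of the variables. *)
Record sseries := SSeries { scoef :> smono p -> C }.

HB.instance Definition _ := gen_eqMixin sseries.
HB.instance Definition _ := gen_choiceMixin sseries.

Implicit Types f g h : sseries.

Lemma sseriesP f g : (forall M, f M = g M) -> f = g.
Proof. by case: f g => [f] [g] /= /funext ->. Qed.

Definition sadd f g := SSeries (fun M => f M + g M).
Definition sopp f := SSeries (fun M => - f M).
Definition szero := SSeries (fun=> 0).
Definition sone := SSeries (fun M => (M == mono1 p)%:R).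
Definition sscale (c : C) f := SSeries (fun M => c * f M).
Definition smul f g := SSeries (fun M =>
  \sum_(A <- mdivs M) (-1) ^+ minversions A (msub M A) * (f A * g (msub M A))).

Fact saddA : associative sadd.
Proof. by move=> f g h; apply: sseriesP => M; rewrite /= addrA. Qed.
Fact saddC : commutative sadd.
Proof. by move=> f g; apply: sseriesP => M; rewrite /= addrC. Qed.
Fact sadd0 : left_id szero sadd.
Proof. by move=> f; apply: sseriesP => M; rewrite /= add0r. Qed.
Fact saddN : left_inverse szero sopp sadd.
Proof. by move=> f; apply: sseriesP => M; rewrite /= addNr. Qed.

HB.instance Definition _ := GRing.isZmodule.Build sseries saddA saddC sadd0 saddN.

Fact smul1l : left_id sone smul.
Proof.
move=> f; apply: sseriesP => M /=.
have M1 : mono1 p \in mdivs M by rewrite mem_mdivs; apply/forallP => g; rewrite ffunE.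
rewrite (bigD1_seq _ M1 (mdivs_uniq M)) /= eqxx mul1r.
rewrite big1 ?addr0 => [|A /negPf ->]; last by rewrite mul0r mulr0.
have -> : msub M (mono1 p) = M by apply: smonoP => g; rewrite !ffunE subn0.
rewrite /minversions big1 ?mul1r // => a _.
by rewrite big1 // => b _; rewrite ffunE mul0n.
Qed.

Fact smul1r : right_id sone smul.
Proof.
move=> f; apply: sseriesP => M /=.
have MM : M \in mdivs M by rewrite mem_mdivs; apply/forallP.
rewrite (bigD1_seq _ MM (mdivs_uniq M)) /=.
have M0 : msub M M = mono1 p by apply: smonoP => g; rewrite !ffunE subnn.
rewrite M0 eqxx mulr1.
rewrite big_seq_cond big1 ?addr0 => [|A /andP[]].
  rewrite /minversions big1 ?mul1r // => a _.
  by rewrite big1 // => b _; rewrite ffunE muln0.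
rewrite mem_mdivs => /forallP AM AneM; case: eqP => [E|_]; last by rewrite !mulr0.
case/eqP: AneM; apply: smonoP => g; apply/eqP; rewrite eqn_leq AM /=.
by have /(congr1 (fun N : smono p => N g)) := E; rewrite !ffunE => /eqP; rewrite subn_eq0.
Qed.

Fact smulDl : left_distributive smul sadd.
Proof.
move=> f g h; apply: sseriesP => M /=; rewrite -big_split /=.
by apply: eq_bigr => A _; rewrite mulrDl mulrDr.
Qed.

Fact smulDr : right_distributive smul sadd.
Proof.
move=> f g h; apply: sseriesP => M /=; rewrite -big_split /=.
by apply: eq_bigr => A _; rewrite !mulrDr.
Qed.

Lemma minversionsDl (A B D E : smono p) : (forall x, A x = B x + D x)%N ->
  minversions A E = (minversions B E + minversions D E)%N.
Proof.
move=> AE; rewrite /minversions -big_split; apply: eq_bigr => a _ /=.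
by rewrite -big_split; apply: eq_bigr => b _; rewrite AE mulnDl.
Qed.

Lemma minversionsDr (A B D E : smono p) : (forall x, A x = B x + D x)%N ->
  minversions E A = (minversions E B + minversions E D)%N.
Proof.
move=> AE; rewrite /minversions -big_split; apply: eq_bigr => a _ /=.
by rewrite -big_split; apply: eq_bigr => b _; rewrite AE mulnDr.
Qed.

Fact smulA : associative smul.
Proof.
move=> f g h; apply: sseriesP => M; apply/esym => /=.
pose T (A B : smono p) :=
  (-1) ^+ minversions A (msub M A) * ((-1) ^+ minversions B (msub A B) *
    (f B * g (msub A B)) * h (msub M A)).
transitivity (\sum_(A <- mdivs M) \sum_(B <- mdivs M | mle B A) T A B).
  apply: eq_big_seq => A; rewrite mem_mdivs => /forallP AM.
  rewrite mulr_suml mulr_sumr -[RHS]big_filter; apply: perm_big.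
  apply: uniq_perm => [||B]; [exact: mdivs_uniq|exact/filter_uniq/mdivs_uniq|].
  rewrite mem_mdivs [RHS]mem_filter mem_mdivs; case BA: (mle B A) => //=; apply/esym/forallP => x.
  by apply: leq_trans (AM x); move/forallP: BA.
rewrite (exchange_big_dep predT) //=.
apply: eq_big_seq => B; rewrite mem_mdivs => /forallP BM.
have addP (D : smono p) : [forall x, p x ==>
   ([ffun x => minn (B x + D x) (M x)] x <= 1)%N].
  apply/forallP => x; apply/implyP => px; rewrite ffunE.
  exact: leq_trans (geq_minr _ _) (sexp_le1 _ px).
pose ad D : smono p := SMono (addP D).
have adE D : mle D (msub M B) -> forall x, ad D x = (B x + D x)%N.
  move=> /forallP DM x; rewrite /= ffunE; apply/minn_idPl.
  by have := DM x; rewrite ffunE leq_subRL // BM.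
rewrite !mulr_sumr -[LHS]big_filter.
rewrite (perm_big [seq ad D | D <- mdivs (msub M B)]) /=.
  rewrite big_map; apply: eq_big_seq => D; rewrite mem_mdivs => DM.
  rewrite /T.
  have -> : msub (ad D) B = D by apply: smonoP => x; rewrite [LHS]ffunE adE // addKn.
  have -> : msub M (ad D) = msub (msub M B) D.
    by apply: smonoP => x; rewrite [LHS]ffunE adE // !ffunE subnDA.
  rewrite (minversionsDl _ (adE D DM)).
  rewrite (@minversionsDr (msub M B) D (msub (msub M B) D)) => [|x]; last first.
    by rewrite [X in (_ + X)%N]ffunE subnKC //; move/forallP: DM => /(_ x).
  rewrite !exprD; ring.
apply: uniq_perm.
- exact/filter_uniq/mdivs_uniq.
- rewrite map_inj_in_uniq ?mdivs_uniq // => D E.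
  rewrite !mem_mdivs => /adE DM /adE EM DE; apply: smonoP => x.
  by apply: (@addnI (B x)); rewrite -DM -EM DE.
move=> A; rewrite mem_filter mem_mdivs; apply/andP/mapP => [[/forallP BA /forallP AM]|].
  have DM : mle (msub A B) (msub M B).
    by apply/forallP => x; rewrite !ffunE leq_sub2r.
  exists (msub A B); first by rewrite mem_mdivs.
  by apply: smonoP => x; rewrite adE // ffunE subnKC.
move=> [D]; rewrite mem_mdivs => DM ->; split; apply/forallP => x; rewrite ?adE ?leq_addr //.
by rewrite -adE // /= ffunE geq_minr.
Qed.

Fact sone_neq0 : sone != szero.
Proof.
apply/eqP => /(congr1 (fun f : sseries => f (mono1 p))) /=.
by rewrite eqxx => /eqP; rewrite oner_eq0.
Qed.

HB.instance Definition _ := GRing.Zmodule_isNzRing.Build sseries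
  smulA smul1l smul1r smulDl smulDr sone_neq0.

Fact sscaleA a b f : sscale a (sscale b f) = sscale (a * b) f.
Proof. by apply: sseriesP => M; rewrite /= mulrA. Qed.
Fact sscale1 : left_id 1 sscale.
Proof. by move=> f; apply: sseriesP => M; rewrite /= mul1r. Qed.
Fact sscaleDr : right_distributive sscale +%R.
Proof. by move=> a f g; apply: sseriesP => M; rewrite /= mulrDr. Qed.
Fact sscaleDl f : {morph sscale^~ f : a b / a + b}.
Proof. by move=> a b; apply: sseriesP => M; rewrite /= mulrDl. Qed.

HB.instance Definition _ := GRing.Zmodule_isLmodule.Build C sseries
  sscaleA sscale1 sscaleDr sscaleDl.

Fact sscaleAl (a : C) f g : a *: (f * g) = a *: f * g.
Proof.
apply: sseriesP => M /=; rewrite mulr_sumr; apply: eq_bigr => A _.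
by rewrite mulrCA !mulrA.
Qed.

HB.instance Definition _ := GRing.Lmodule_isLalgebra.Build C sseries sscaleAl.

Fact sscaleAr (a : C) f g : a *: (f * g) = f * (a *: g).
Proof.
apply: sseriesP => M /=; rewrite mulr_sumr; apply: eq_bigr => A _.
by rewrite mulrCA; congr (_ * _); rewrite mulrCA.
Qed.

HB.instance Definition _ := GRing.Lalgebra_isAlgebra.Build C sseries sscaleAr.

Definition svar (x : G) : sseries := SSeries (fun M => (M == mvar p x)%:R).

Definition spart (e : bool) f : sseries :=
  SSeries (fun M => if mpar M == e then f M else 0).

End Series.

Arguments svar C {G} p x.

(* The continuous superalgebra morphism sending the variable [x] to [u x];
   meaningful when [u x] has the parity of [x] and no constant term, in which
   case monomials of degree > mdeg M do not contribute to the coefficient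
   of [M]. *)
Definition ssubst (C : comNzRingType) (G G' : finType) (p : pred G) (q : pred G')
    (u : G -> sseries C q) (f : sseries C p) : sseries C q :=
  SSeries (fun M => \sum_(A <- mupto p (mdeg M))
    f A * (\prod_(x <- enum G) u x ^+ (A x)) M).

(** The completed tensor product of two superalgebras of power series is the
    superalgebra of power series in the disjoint union of the variables, the
    variables of the first factor coming first, so that
    x^A (x) x^B is the monomial [mpair A B]. *)

Section Tensor.
Variables (C : comNzRingType) (G G' : finType) (p : pred G) (q : pred G').

Definition psum : pred (G + G')%type :=
  fun x => match x with inl a => p a | inr b => q b end.

Fact mleft_subproof (M : smono psum) :
  [forall g, p g ==> ([ffun a => M (inl a)] g <= 1)%N].
Proof.
apply/forallP => a; apply/implyP => pa; rewrite ffunE.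
exact: (@sexp_le1 _ _ M (inl a)).
Qed.
Definition mleft (M : smono psum) : smono p := SMono (mleft_subproof M).

Fact mright_subproof (M : smono psum) :
  [forall g, q g ==> ([ffun b => M (inr b)] g <= 1)%N].
Proof.
apply/forallP => b; apply/implyP => qb; rewrite ffunE.
exact: (@sexp_le1 _ _ M (inr b)).
Qed.
Definition mright (M : smono psum) : smono q := SMono (mright_subproof M).

Definition mpair_exp (A : smono p) (B : smono q) : {ffun G + G' -> nat} :=
  [ffun x => match x with inl a => A a | inr b => B b end].

Fact mpair_subproof A B : [forall g, psum g ==> (mpair_exp A B g <= 1)%N].
Proof. by apply/forallP => -[a|b]; apply/implyP => ?; rewrite ffunE sexp_le1. Qed.
Definition mpair A B : smono psum := SMono (mpair_subproof A B).

Definition stens (f : sseries C p) (g : sseries C q) : sseries C psum :=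
  SSeries (fun M => f (mleft M) * g (mright M)).

(* phi (x) id and id (x) phi, without signs. *)
Definition contrl (phi : sseries C p -> C) (t : sseries C psum) : sseries C q :=
  SSeries (fun B => phi (SSeries (fun A => t (mpair A B)))).
Definition contrr (phi : sseries C q -> C) (t : sseries C psum) : sseries C p :=
  SSeries (fun A => phi (SSeries (fun B => t (mpair A B)))).

End Tensor.

Record is_ideal (A : pzRingType) (K : set A) : Prop := IsIdeal {
  ideal0 : K 0;
  idealB : forall x y, K x -> K y -> K (x - y);
  idealMl : forall a x, K x -> K (a * x);
  idealMr : forall a x, K x -> K (x * a) }.

Definition ideal_gen (A : pzRingType) (S : set A) : set A := smallest (@is_ideal A) S.

Lemma ideal_gen_ideal (A : pzRingType) (S : set A) : is_ideal (ideal_gen S).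
Proof.
split=> [K [KI _]|x y Kx Ky K KS|a x Kx K KS|a x Kx K KS].
- exact: ideal0 KI.
- exact: (idealB KS.1 (Kx _ KS) (Ky _ KS)).
- exact: (idealMl KS.1 _ (Kx _ KS)).
- exact: (idealMr KS.1 _ (Kx _ KS)).
Qed.

Section Quotient.
Variables (C : pzRingType) (A : algType C) (S : set A).

Definition quo_equiv (x y : A) : bool := `[< ideal_gen S (x - y) >].

Lemma quo_equiv_class : equiv_class_of quo_equiv.
Proof.
have [K0 KB _ _] := ideal_gen_ideal S.
have KN x : ideal_gen S x -> ideal_gen S (- x) by rewrite -sub0r; exact: KB.
split=> [x|x y|y x z]; rewrite /quo_equiv ?subrr; first exact/asboolP.
  by apply/asboolP/asboolP => /KN; rewrite opprB.
move=> /asboolP xy /asboolP yz; apply/asboolP.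
by have := KB _ _ xy (KN _ yz); rewrite opprK addrA subrK.
Qed.

Canonical quo_equiv_equiv := EquivRelPack quo_equiv_class.
Canonical quo_equiv_encModRel := defaultEncModRel quo_equiv.

(* The quotient of [A] by the ideal generated by [S]. *)
Definition quo := {eq_quot quo_equiv}.

HB.instance Definition _ := EqQuotient.on quo.
HB.instance Definition _ := Choice.on quo.

Lemma quo_eqP (x y : A) : reflect (\pi_quo x = \pi_quo y) `[< ideal_gen S (x - y) >].
Proof. exact: (@eqquotP _ _ quo x y). Qed.

Lemma quo_reprP (x : A) : ideal_gen S (repr (\pi_quo x) - x).
Proof. by apply/asboolP/quo_eqP; rewrite reprK. Qed.

Definition qmap1 (phi : A -> A) (x : quo) : quo := \pi_quo (phi (repr x)).
Definition qmap2 (phi : A -> A -> A) (x y : quo) : quo :=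
  \pi_quo (phi (repr x) (repr y)).

Lemma qaddE (x y : A) : qmap2 +%R (\pi_quo x) (\pi_quo y) = \pi_quo (x + y).
Proof.
apply/quo_eqP/asboolP; rewrite opprD addrACA.
have [_ KB _ _] := ideal_gen_ideal S.
rewrite -[repr (\pi_quo y) - y]opprK; apply: (KB); first exact: quo_reprP.
rewrite -sub0r; apply: KB; [exact: (ideal0 (ideal_gen_ideal S))|exact: quo_reprP].
Qed.

Lemma qoppE (x : A) : qmap1 -%R (\pi_quo x) = \pi_quo (- x).
Proof.
apply/quo_eqP/asboolP; rewrite -opprD -sub0r.
by apply: (idealB (ideal_gen_ideal S)); [exact: (ideal0 (ideal_gen_ideal S))|exact: quo_reprP].
Qed.

Lemma qmulE (x y : A) : qmap2 *%R (\pi_quo x) (\pi_quo y) = \pi_quo (x * y).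
Proof.
apply/quo_eqP/asboolP; have KS := ideal_gen_ideal S.
set x' := repr _; set y' := repr _.
have -> : x' * y' - x * y = (x' - x) * y' - x * (y - y').
  by rewrite mulrBl mulrBr opprB addrA subrK.
apply: (idealB KS); [apply: (idealMr KS)|apply: (idealMl KS)]; first exact: quo_reprP.
by rewrite -opprB -sub0r; apply: (idealB KS); [exact: (ideal0 KS)|exact: quo_reprP].
Qed.

Lemma qscaleE (c : C) (x : A) : qmap1 ( *:%R c) (\pi_quo x) = \pi_quo (c *: x).
Proof.
apply/quo_eqP/asboolP; rewrite -scalerBr -mulr_algl.
by apply: (idealMl (ideal_gen_ideal S)); exact: quo_reprP.
Qed.

Lemma quoW (P : quo -> Prop) : (forall x, P (\pi_quo x)) -> forall x, P x.
Proof. by move=> Pp x; rewrite -[x]reprK. Qed.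

Fact qaddA : associative (qmap2 +%R).
Proof.
elim/quoW=> x; elim/quoW=> y; elim/quoW=> z.
by rewrite (qaddE y z) (qaddE x y) (qaddE x) qaddE addrA.
Qed.
Fact qaddC : commutative (qmap2 +%R).
Proof. by elim/quoW=> x; elim/quoW=> y; rewrite (qaddE x y) (qaddE y x) addrC. Qed.
Fact qadd0 : left_id (\pi_quo 0) (qmap2 +%R).
Proof. by elim/quoW=> x; rewrite (qaddE 0 x) add0r. Qed.
Fact qaddN : left_inverse (\pi_quo 0) (qmap1 -%R) (qmap2 +%R).
Proof. by elim/quoW=> x; rewrite (qoppE x) (qaddE (- x) x) addNr. Qed.

HB.instance Definition _ := GRing.isZmodule.Build quo qaddA qaddC qadd0 qaddN.

Lemma qadd_pi (x y : A) : \pi_quo x + \pi_quo y = \pi_quo (x + y).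
Proof. exact: qaddE. Qed.

Fact qmulA : associative (qmap2 *%R).
Proof.
elim/quoW=> x; elim/quoW=> y; elim/quoW=> z.
by rewrite (qmulE y z) (qmulE x y) (qmulE x) qmulE mulrA.
Qed.
Fact qmul1l : left_id (\pi_quo 1) (qmap2 *%R).
Proof. by elim/quoW=> x; rewrite (qmulE 1 x) mul1r. Qed.
Fact qmul1r : right_id (\pi_quo 1) (qmap2 *%R).
Proof. by elim/quoW=> x; rewrite (qmulE x 1) mulr1. Qed.
Fact qmulDl : left_distributive (qmap2 *%R) +%R.
Proof.
elim/quoW=> x; elim/quoW=> y; elim/quoW=> z.
by rewrite (qadd_pi x y) (qmulE x z) (qmulE y z) (qmulE (x + y) z) qadd_pi mulrDl.
Qed.
Fact qmulDr : right_distributive (qmap2 *%R) +%R.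
Proof.
elim/quoW=> x; elim/quoW=> y; elim/quoW=> z.
by rewrite (qadd_pi y z) (qmulE x y) (qmulE x z) (qmulE x (y + z)) qadd_pi mulrDr.
Qed.

HB.instance Definition _ := GRing.Zmodule_isPzRing.Build quo
  qmulA qmul1l qmul1r qmulDl qmulDr.

Fact qscaleA (a b : C) (x : quo) :
  qmap1 ( *:%R a) (qmap1 ( *:%R b) x) = qmap1 ( *:%R (a * b)) x.
Proof.
by elim/quoW: x => x; rewrite (qscaleE b x) (qscaleE a) (qscaleE (a * b) x) scalerA.
Qed.
Fact qscale1 : left_id 1 (fun c : C => qmap1 ( *:%R c)).
Proof. by elim/quoW=> x; rewrite (qscaleE 1 x) scale1r. Qed.
Fact qscaleDr : right_distributive (fun c : C => qmap1 ( *:%R c)) +%R.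
Proof.
move=> a; elim/quoW=> x; elim/quoW=> y.
by rewrite (qadd_pi x y) (qscaleE a x) (qscaleE a y) (qscaleE a (x + y)) qadd_pi scalerDr.
Qed.
Fact qscaleDl (x : quo) : {morph (fun c : C => qmap1 ( *:%R c) x) : a b / a + b}.
Proof.
move=> a b; elim/quoW: x => x.
by rewrite (qscaleE a x) (qscaleE b x) (qscaleE (a + b) x) qadd_pi scalerDl.
Qed.

HB.instance Definition _ := GRing.Zmodule_isLmodule.Build C quo
  qscaleA qscale1 qscaleDr qscaleDl.

End Quotient.

(* The map between quotients induced by a map compatible with the ideals. *)
Definition qlift (C : pzRingType) (A B : algType C) (S : set A) (T : set B)
    (phi : A -> B) (x : quo S) : quo T := \pi_(quo T) (phi (repr x)).

(* The relations presenting the completed tensor product of [quo S] and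
   [quo T].  These algebras being Noetherian and complete, all their ideals
   are closed, so that the algebraic ideal generated by the relations is the
   closed one. *)
Definition tens_rel (C : comNzRingType) (G G' : finType) (p : pred G)
    (q : pred G') (S : set (sseries C p)) (T : set (sseries C q)) :
    set (sseries C (psum p q)) :=
  [set stens s 1 | s in S] `|` [set stens 1 t | t in T].

(* The inverse in a ring which need not be commutative ([0] if there is none). *)
Definition ring_inv (A : pzRingType) (x : A) : A :=
  xget 0 [set y | x * y = 1 /\ y * x = 1].

Definition mx_inv (A : pzRingType) (n : nat) (M : 'M[A]_n) : 'M[A]_n :=
  xget 0 [set N | M *m N = 1%:M /\ N *m M = 1%:M].

Definition sdet (A : pzRingType) (m n : nat) (M : 'M[A]_(m + n)) : A :=
  \det (ulsubmx M - ursubmx M *m mx_inv (drsubmx M) *m dlsubmx M)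
    * ring_inv (\det (drsubmx M)).

Definition Str (A : pzRingType) (m n : nat) (M : 'M[A]_(m + n)) : A :=
  \tr (ulsubmx M) - \tr (drsubmx M).

Section SL.
Variables (C : numClosedFieldType) (m n : nat).

Definition ipar (i : 'I_(m + n)) : bool := (m <= i)%N.

Definition gen : finType := ('I_(m + n) * 'I_(m + n))%type.
Definition gpar : pred gen := fun ij => ipar ij.1 (+) ipar ij.2.

(* The ideal generated by sdet(1 + X) - 1 is a Hopf ideal, the superdeterminant
   being multiplicative. *)
Definition SL_rel : set (sseries C gpar) :=
  [set sdet (1%:M + \matrix_(i, j) svar C gpar (i, j)) - 1].

(* The variables y_ij are [inl (i, j)] and the variables z_ij are
   [inr (i, j)]; [copy] is [false] on the former and [true] on the latter. *)
Definition gen2 : finType := (gen + gen)%type.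
Definition gpar2 : pred gen2 := psum gpar gpar.
Definition copy (c : bool) (i j : 'I_(m + n)) : gen2 :=
  if c then inr (i, j) else inl (i, j).
Definition on_gens (T : Type) (u : bool -> 'I_(m + n) -> 'I_(m + n) -> T) (x : gen2) : T :=
  match x with inl ij => u false ij.1 ij.2 | inr ij => u true ij.1 ij.2 end.

(* Two copies of C[[x_ij]]; the Hopf superalgebra structure is that of the
   tensor product, acting on each copy separately. *)
Definition F2 := sseries C gpar2.
Definition xvar (c : bool) (i j : 'I_(m + n)) : F2 := svar C gpar2 (copy c i j).
Definition xmx (c : bool) : 'M[F2]_(m + n) := \matrix_(i, j) xvar c i j.

Definition H_rel : set F2 := tens_rel SL_rel SL_rel.
Definition Hsl := quo H_rel.
Definition Hsl2 := quo (tens_rel H_rel H_rel).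

Definition tensH (f g : Hsl) : Hsl2 :=
  \pi_Hsl2 (stens (repr f) (repr g)).

Definition Delta : Hsl -> Hsl2 :=
  qlift _ (ssubst (on_gens (fun c i j =>
    stens 1 (xvar c i j) + stens (xvar c i j) 1
      + \sum_k stens (xvar c i k) (xvar c k j)))).

Definition counit (f : Hsl) : C := repr f (mono1 gpar2).

(* S(y_ij) and S(z_ij) *)
Definition antipode_gen (c : bool) (i j : 'I_(m + n)) : F2 :=
  - (i == j)%:R + mx_inv (1%:M + xmx c) i j.

Definition antipode : Hsl -> Hsl := qlift _ (ssubst (on_gens antipode_gen)).

Definition sconj (f : F2) : F2 := SSeries (fun M => (f M)^*).

(* Antilinearity is the conjugation of coefficients; ssubst takes care of
   multiplicativity. *)
Definition star : Hsl -> Hsl :=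
  qlift _ (fun f => ssubst (on_gens (fun c i j =>
    (-1) ^+ ((ipar i (+) ipar j) && ipar j) * antipode_gen (~~ c) j i)) (sconj f)).

Definition hpart (e : bool) : Hsl -> Hsl := qlift _ (spart e).

Definition yvar (i j : 'I_(m + n)) : Hsl := \pi_Hsl (xvar false i j).
Definition zvar (i j : 'I_(m + n)) : Hsl := \pi_Hsl (xvar true i j).

(* The Hopf ideals generated by given elements are taken to be the ideals they
   generate; that the latter are Hopf ideals (hence the smallest ones) is part
   of [is_PL_sub_supergroup] below. *)
Definition SU_ideal : set Hsl :=
  ideal_gen [set f | exists i j, f = yvar i j - zvar i j].

Definition AN_ideal : set Hsl :=
  ideal_gen ([set f | exists i j : 'I_(m + n), (j < i)%N /\ (f = yvar j i \/ f = zvar i j)]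
         `|` [set f | exists i, f = antipode (yvar i i) - zvar i i]).

Definition dmx := ('M[C]_(m + n) * 'M[C]_(m + n))%type.

Definition dhomog (e : bool) (h : dmx) : Prop :=
  forall i j, ipar i (+) ipar j != e -> h.1 i j = 0 /\ h.2 i j = 0.

Definition dStr (h : dmx) : (C^o * C^o)%type := (Str h.1, Str h.2).

Definition gdefect (h : dmx) : 'M[C]_(m + n) := h.1 - h.2.

(* The entries of A above the diagonal, those of B below it, and the sum of
   the diagonals. *)
Definition bdefect (h : dmx) : 'M[C]_(m + n) :=
  \matrix_(i, j) if (i < j)%N then h.1 i j
                 else if (j < i)%N then h.2 i j else h.1 i j + h.2 i j.

Definition dlie : {vspace dmx} := lker (linfun dStr).
Definition glie : {vspace dmx} := (dlie :&: lker (linfun gdefect))%VS.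
Definition blie : {vspace dmx} := (dlie :&: lker (linfun bdefect))%VS.

Fact dStr_linear : linear dStr.
Proof.
have StrP (a : C) (M M' : 'M[C]_(m + n)) : Str (a *: M + M') = a * Str M + Str M'.
  rewrite /Str.
  have -> : ulsubmx (a *: M + M') = a *: ulsubmx M + ulsubmx M' by apply/matrixP=> i j; rewrite !mxE.
  have -> : drsubmx (a *: M + M') = a *: drsubmx M + drsubmx M' by apply/matrixP=> i j; rewrite !mxE.
  by rewrite !mxtraceD !mxtraceZ mulrBr opprD addrACA.
by move=> a h k; rewrite /dStr !StrP.
Qed.
HB.instance Definition _ := GRing.isLinear.Build C dmx (C^o * C^o)%type *:%R dStr dStr_linear.

Fact gdefect_linear : linear gdefect.
Proof. by move=> a h k; rewrite /gdefect scalerBr addrACA -opprD. Qed.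
HB.instance Definition _ := GRing.isLinear.Build C dmx 'M[C]_(m + n) *:%R gdefect gdefect_linear.

Fact bdefect_linear : linear bdefect.
Proof.
move=> a h k; apply/matrixP => i j; rewrite !mxE.
by do 2 case: ifP => _ //; rewrite mulrDr addrACA.
Qed.
HB.instance Definition _ := GRing.isLinear.Build C dmx 'M[C]_(m + n) *:%R bdefect bdefect_linear.

Lemma dlieP (h : dmx) : reflect (Str h.1 = 0 /\ Str h.2 = 0) (h \in dlie).
Proof.
rewrite memv_ker lfunE /= /dStr; apply: (iffP eqP) => [[-> ->]//|[-> ->]//].
Qed.

Lemma glieP (h : dmx) : reflect (h \in dlie /\ h.1 = h.2) (h \in glie).
Proof.
rewrite memv_cap memv_ker lfunE /= /gdefect subr_eq0.
by apply: (iffP andP) => -[hd /eqP].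
Qed.

Lemma blieP (h : dmx) :
  reflect [/\ h \in dlie, forall i j : 'I_(m + n), (i < j)%N -> h.1 i j = 0,
             forall i j : 'I_(m + n), (j < i)%N -> h.2 i j = 0
           & forall i, h.1 i i + h.2 i i = 0]
          (h \in blie).
Proof.
rewrite memv_cap memv_ker lfunE /=; apply: (iffP andP) => -[hd].
  move=> /eqP/matrixP hb; split=> // [i j ij|i j ji|i].
  - by have := hb i j; rewrite !mxE ij.
  - by have := hb i j; rewrite !mxE ji ltnNge ltnW.
  - by have := hb i i; rewrite !mxE ltnn.
move=> up lo di; split=> //; apply/eqP/matrixP => i j; rewrite !mxE.
by case: ltngtP => [/up|/lo|/val_inj ->].
Qed.

Definition dform (h k : dmx) : C :=
  - ('i / 2%:R) * Str (h.1 *m k.1) + 'i / 2%:R * Str (h.2 *m k.2).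

(* [daddv_pi U V] is the projection onto [U] along [V]. *)
Definition Rd (h : dmx) : dmx := daddv_pi blie glie h - daddv_pi glie blie h.

(* delta_(A,B) as an epsilon-derivation of C[[y_ij, z_ij]]: being determined by
   its values on the variables, it reads off the linear terms. *)
Definition deltaF (h : dmx) (f : F2) : C :=
  \sum_i \sum_j (h.1 i j * f (mvar gpar2 (copy false i j))
               + h.2 i j * f (mvar gpar2 (copy true i j))).

Definition nablaR (h : dmx) (f : Hsl) : Hsl :=
  qlift _ (contrl (deltaF h)) (Delta f).

(* [e] is the parity of [h], [s] that of a component of [f]. *)
Definition nablaL (e : bool) (h : dmx) (f : Hsl) : Hsl :=
  \sum_(s : bool) (-1) ^+ (e && ~~ s) *: qlift _ (contrr (deltaF h)) (Delta (hpart s f)).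

Section Bracket.
Variables (N : nat) (h hd : N.-tuple dmx) (par : 'I_N -> bool).

Definition homog_basis : Prop :=
  basis_of dlie h /\ (forall a, dhomog (par a) (tnth h a)).

Definition dual_basis : Prop :=
  (forall b, tnth hd b \in dlie)
  /\ (forall a b, dform (tnth h a) (tnth hd b) = (a == b)%:R).

(* [s] is the parity of a component of [f]. *)
Definition superbracket (f g : Hsl) : Hsl :=
  2%:R^-1 *: \sum_(s : bool) \sum_(a < N) \sum_(b < N)
    ((-1) ^+ (s && par a) * dform (Rd (tnth hd a)) (tnth hd b)) *:
      (nablaL (par a) (tnth h a) (hpart s f) * nablaL (par b) (tnth h b) g
       - nablaR (tnth h a) (hpart s f) * nablaR (tnth h b) g).

End Bracket.

(* The completed K (x) H + H (x) K. *)
Definition tens_ideal (K : set Hsl) : set Hsl2 :=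
  ideal_gen ([set t | exists k f, K k /\ t = tensH k f]
         `|` [set t | exists f k, K k /\ t = tensH f k]).

Record is_Hopf_ideal (K : set Hsl) : Prop := IsHopfIdeal {
  Hopf_ideal : is_ideal K;
  Hopf_graded : forall e f, K f -> K (hpart e f);
  Hopf_counit : forall f, K f -> counit f = 0;
  Hopf_coproduct : forall f, K f -> tens_ideal K (Delta f);
  Hopf_antipode : forall f, K f -> K (antipode f) }.

(* A property of the quotient of Hsl by K, which then inherits all the
   structures of Hsl. *)
Record is_PL_sub_supergroup (br : Hsl -> Hsl -> Hsl) (K : set Hsl) : Prop :=
  IsPLSubSupergroup {
  PL_Hopf_ideal : is_Hopf_ideal K;
  PL_star : forall f, K f -> K (star f);
  PL_bracket : forall f g, K f -> K (br f g) }.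

End SL.

(* Main.v *)
From HB Require Import structures.
From mathcomp Require Import fingroup perm.
From mathcomp Require Import all_boot all_order all_algebra.
From mathcomp Require Import boolp classical_sets.
From mathcomp Require Import ring.
From mathcomp Require Import reals complex.
Require Import Defs.

(** Everything is lifted from the quotient to the power series algebra
    [F2 = C[[y_ij, z_ij]]] of [GL(m|n) x GL(m|n)], where the invariant fields
    [nabla] are superderivations.  The lift is legitimate because the
    superdeterminant is multiplicative, is inverted by the antipode, is
    preserved by the supertranspose, and is killed by [nabla_h] as soon as
    [Str h = 0].

    Let [P_g], [P_b] be the projections of [d = g + b].  The Casimir element
    [sum_a h_a (x) hd_a] being invariant, the corresponding biderivations built
    from left and from right invariant fields coincide; it suffices to check
    this on the generators, where it amounts to an explicit formula for the
    Casimir element (it is here that [m <> n] is used).  Since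
    [R_d = 2 P_b - 1 = 1 - 2 P_g], the bracket may therefore be computed with
    [2 P_b] or with [- 2 P_g] in place of [R_d].  As [g] and [b] are isotropic,
    [(P_b x, y) = (x, P_g y)] and [(P_g x, y) = (x, P_b y)], so that the first
    argument of the bracket is only differentiated along [g], resp. along [b].
    These derivations preserve the ideal of the subgroup with Lie algebra [g],
    resp. [b]; this, like the stability of both ideals under the Hopf
    operations and the star, is verified on generators. *)

Set Implicit Arguments.
Unset Strict Implicit.
Unset Printing Implicit Defensive.

Import Order.TTheory GRing.Theory Num.Theory.

Local Open Scope ring_scope.
Local Open Scope classical_set_scope.
Local Open Scope quotient_scope.

(** * Supercommutative power series *)

(** Three obstacles shape the work on power series. Convergence is replaced by the order filtration
    [sord]: linear maps losing at most one order are determined by monomials, hence morphisms and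
    derivations by variables. The ring of series is not commutative, so determinants are computed in
    the subring of even series, and [sdet] is shown to be multiplicative through a block Gauss
    decomposition; the only case where something has to cancel is a lower unipotent factor times an
    elementary upper one, where the determinants of [1 - b C] and [1 + C b] agree because odd
    entries anticommute. Signs are carried by the automorphism [sigma e], which frees the Leibniz
    rules of homogeneity assumptions on the functions. The coordinates are the entries of
    [g = 1 + X] in each copy: the coproduct is then matrix multiplication, the antipode inversion,
    and the star the supertranspose of the inverse in the other copy. The Casimir tensor is a signed
    flip minus a multiple of the identity, and the invariance of the flip is supercommutativity
    itself. *)

Section MonomialTheory.
Variables (G : finType) (p : pred G).
Implicit Types (M N D E : smono p).

Lemma msubE M D x : msub M D x = (M x - D x)%N.
Proof. by rewrite ffunE. Qed.

Lemma mono1E x : mono1 p x = 0%N.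
Proof. by rewrite ffunE. Qed.

Lemma mvarE y x : mvar p y x = (x == y) :> nat.
Proof. by rewrite ffunE. Qed.

Lemma mle_sub M D : mle D M -> forall x, M x = (D x + msub M D x)%N.
Proof. by move=> /forallP DM x; rewrite msubE subnKC. Qed.

Lemma mle_msub M D : mle (msub M D) M.
Proof. by apply/forallP => x; rewrite msubE leq_subr. Qed.

Lemma msubK M D : mle D M -> msub M (msub M D) = D.
Proof. by move=> /forallP DM; apply: smonoP => x; rewrite !msubE subKn. Qed.

Lemma mdegD M D E : (forall x, M x = D x + E x)%N -> mdeg M = (mdeg D + mdeg E)%N.
Proof. by move=> ME; rewrite /mdeg -big_split; apply: eq_bigr. Qed.

Lemma mparD M D E : (forall x, M x = D x + E x)%N -> mpar M = mpar D (+) mpar E.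
Proof.
by move=> ME; rewrite /mpar -oddD -big_split; congr odd; apply: eq_bigr.
Qed.

Lemma mdeg1 : mdeg (mono1 p) = 0%N.
Proof. by rewrite /mdeg big1 // => x _; rewrite mono1E. Qed.

Lemma mdeg_eq0 M : (mdeg M == 0%N) = (M == mono1 p).
Proof.
apply/eqP/eqP => [/eqP|->]; last exact: mdeg1.
rewrite sum_nat_eq0 => /forallP M0; apply: smonoP => x.
by rewrite mono1E; apply/eqP; rewrite (implyP (M0 x)).
Qed.

Lemma mdeg_var x : mdeg (mvar p x) = 1%N.
Proof.
rewrite /mdeg (bigD1 x) //= mvarE eqxx big1 // => y /negPf yx.
by rewrite mvarE yx.
Qed.

Lemma mpar1 : mpar (mono1 p) = false.
Proof. by rewrite /mpar big1 // => x _; rewrite mono1E. Qed.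

Lemma mpar_var x : mpar (mvar p x) = p x.
Proof.
rewrite /mpar big_mkcond (bigD1 x) //= mvarE eqxx big1 ?addn0; first by case: (p x).
by move=> y /negPf yx; rewrite mvarE yx if_same.
Qed.

Lemma mvar_inj : injective (mvar p).
Proof.
move=> x y /(congr1 (fun M : smono p => M x)); rewrite !mvarE eqxx.
by case: eqP.
Qed.

Lemma mvar_neq1 x : (mvar p x == mono1 p) = false.
Proof. by rewrite -mdeg_eq0 mdeg_var. Qed.

Lemma mle_mono1 M : mle M (mono1 p) = (M == mono1 p).
Proof.
apply/forallP/eqP => [M0|-> //]; apply: smonoP => x.
by apply/eqP; rewrite mono1E -leqn0 -(mono1E x).
Qed.

Lemma mle1 M : mle (mono1 p) M.
Proof. by apply/forallP => x; rewrite mono1E. Qed.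

Lemma mle_refl M : mle M M.
Proof. exact/forallP. Qed.

Lemma msub1 M : msub M (mono1 p) = M.
Proof. by apply: smonoP => x; rewrite msubE mono1E subn0. Qed.

Lemma msubxx M : msub M M = mono1 p.
Proof. by apply: smonoP => x; rewrite msubE mono1E subnn. Qed.

(** Pairs [(a, b)] of odd variables split according to [b = a], [b] before [a] and [b] after [a].
    Modulo 2 this becomes the sign rule for exchanging two monomials. *)
Lemma minversions_sym (D E : smono p) :
  (\sum_(x | p x) D x * E x + (minversions D E + minversions E D) =
   (\sum_(x | p x) D x) * (\sum_(x | p x) E x))%N.
Proof.
rewrite big_distrlr /= [X in (_ + (_ + X))%N]/minversions.
rewrite (exchange_big_dep p) /=; last by move=> a b _ /andP[].
rewrite /minversions -!big_split; apply: eq_bigr => a pa /=.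
rewrite [RHS](bigD1 a) //=; congr (_ + _)%N.
rewrite [RHS](bigID (fun b => enum_rank b < enum_rank a)%N) /=.
congr (_ + _)%N.
  apply: eq_bigl => b; case: (p b) => //=.
  by case: ltngtP => [| |/val_inj/enum_rank_inj ->]; rewrite ?andbF //= ?andbT ?eqxx //;
     case: eqP => // ->; rewrite ltnn.
apply: eq_big => [b|b _]; last by rewrite mulnC.
case: (p b) => //=; rewrite pa; case: ltngtP => [| |/val_inj/enum_rank_inj ->].
- by case: eqP => // ->; rewrite ltnn.
- by rewrite /= andbF.
- by rewrite eqxx.
Qed.

Lemma odd_minversions D E : (forall x, p x -> D x * E x = 0)%N ->
  odd (minversions D E) = odd (minversions E D) (+) (mpar D && mpar E).
Proof.
move=> DE; rewrite /mpar -oddM -minversions_sym big1 // add0n oddD.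
by rewrite addbC addbK.
Qed.

Lemma mle_odd0 M D : mle D M -> forall x, p x -> (D x * msub M D x = 0)%N.
Proof.
move=> DM x px; have := sexp_le1 M px; rewrite (mle_sub DM).
by case: (D x) (msub M D x) => [|[|?]] [|[|?]].
Qed.

Lemma minversions1l M : minversions (mono1 p) M = 0%N.
Proof. by rewrite /minversions big1 // => a _; rewrite big1 // => b _; rewrite mono1E. Qed.

Lemma minversions1r M : minversions M (mono1 p) = 0%N.
Proof. by rewrite /minversions big1 // => a _; rewrite big1 // => b _; rewrite mono1E muln0. Qed.

Definition mcompat D E := [forall x, p x ==> (D x + E x <= 1)%N].

Fact madd_subproof D E : [forall x, p x ==>
  ([ffun x => if p x then minn 1 (D x + E x) else (D x + E x)%N] x <= 1)%N].
Proof. by apply/forallP => x; apply/implyP => px; rewrite ffunE px geq_minl. Qed.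

(* The product of two monomials up to sign, meaningful when they are [mcompat]. *)
Definition madd D E : smono p := SMono (madd_subproof D E).

Lemma maddE D E : mcompat D E -> forall x, madd D E x = (D x + E x)%N.
Proof.
move=> /forallP DE x; rewrite ffunE; case: ifP => // px.
by apply/minn_idPr; have := DE x; rewrite px.
Qed.

(** Turns divisibility with a prescribed quotient into an equality, so that the convolution defining
    [smon D * smon E] has at most one nonzero coefficient. *)
Lemma eq_madd M D E : mle D M && (msub M D == E) = mcompat D E && (M == madd D E).
Proof.
apply/andP/andP => [[DM /eqP<-]|[DE /eqP->]].
  have c : mcompat D (msub M D).
    by apply/forallP => x; apply/implyP => px; rewrite -(mle_sub DM) sexp_le1.
  by split=> //; apply/eqP/smonoP => x; rewrite maddE // -mle_sub.
split; first by apply/forallP => x; rewrite maddE // leq_addr.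
by apply/eqP/smonoP => x; rewrite msubE maddE // addKn.
Qed.

(** Passing to the complementary divisor is an involution; reindexing a convolution by it exchanges
    the two factors. *)
Lemma perm_mdivs M : perm_eq [seq msub M D | D <- mdivs M] (mdivs M).
Proof.
apply: uniq_perm => [||E]; last 1 first.
- rewrite mem_mdivs; apply/mapP/idP => [[D _ ->]|EM]; first exact: mle_msub.
  by exists (msub M E); rewrite ?mem_mdivs ?mle_msub ?msubK.
- rewrite map_inj_in_uniq ?mdivs_uniq // => D E; rewrite !mem_mdivs => DM EM.
  by move/(congr1 (msub M)); rewrite !msubK.
- exact: mdivs_uniq.
Qed.

End MonomialTheory.

Section SeriesTheory.
Variables (C : comNzRingType) (G : finType) (p : pred G).
Local Notation A := (sseries C p).
Implicit Types (f g h k : A) (M N D E : smono p) (e : bool).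

Lemma scoefD f g M : (f + g) M = f M + g M. Proof. by []. Qed.
Lemma scoefN f M : (- f) M = - f M. Proof. by []. Qed.
Lemma scoefB f g M : (f - g) M = f M - g M. Proof. by []. Qed.
Lemma scoef1 M : (1 : A) M = (M == mono1 p)%:R. Proof. by []. Qed.
Lemma scoefZ c f M : (c *: f) M = c * f M. Proof. by []. Qed.
Lemma scoefM f g M : (f * g) M =
  \sum_(D <- mdivs M) (-1) ^+ minversions D (msub M D) * (f D * g (msub M D)).
Proof. by []. Qed.

Lemma scoef_sum I (r : seq I) (P : pred I) (F : I -> A) M :
  (\sum_(i <- r | P i) F i) M = \sum_(i <- r | P i) F i M.
Proof. exact: (big_morph (fun f : A => f M)). Qed.

Definition smon M : A := SSeries (fun N => (N == M)%:R).

Lemma svarE x : svar C p x = smon (mvar p x). Proof. by []. Qed.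
Lemma smon1 : smon (mono1 p) = 1. Proof. by []. Qed.

Lemma smonM D E : smon D * smon E =
  if mcompat D E then (-1) ^+ minversions D E *: smon (madd D E) else 0.
Proof.
apply: sseriesP => M; rewrite scoefM /=.
transitivity (if mle D M && (msub M D == E) then (-1) ^+ minversions D E else 0 : C).
  case DM: (mle D M) => /=; last first.
    rewrite big_seq big1 // => N; rewrite mem_mdivs => NM.
    by case: eqP => [ND|_]; rewrite ?mul0r ?mulr0 // -ND NM in DM *.
  rewrite (bigD1_seq D) ?mem_mdivs ?mdivs_uniq //= eqxx big1 => [|N /negPf->].
    by rewrite mul1r addr0; case: eqP => [->|_]; rewrite ?mulr1 ?mulr0.
  by rewrite mul0r mulr0.
rewrite eq_madd; case: ifP => [/andP[-> /eqP->]|]; first by rewrite scoefZ /= eqxx mulr1.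
by case: (mcompat D E) => [] /= MD; rewrite ?MD ?mulr0.
Qed.

(** The filtration by total degree, which stands in for convergence: a series that has every order
    is zero. *)
Definition sord (d : nat) f := forall M, (mdeg M < d)%N -> f M = 0.

Lemma sord_0 d : sord d 0. Proof. by []. Qed.
Lemma sordW d d' f : (d' <= d)%N -> sord d f -> sord d' f.
Proof. by move=> dd fd M Md; apply: fd; exact: leq_trans dd. Qed.
Lemma sordD d f g : sord d f -> sord d g -> sord d (f + g).
Proof. by move=> fd gd M Md; rewrite scoefD fd // gd // addr0. Qed.
Lemma sordN d f : sord d f -> sord d (- f).
Proof. by move=> fd M Md; rewrite scoefN fd // oppr0. Qed.
Lemma sordB d f g : sord d f -> sord d g -> sord d (f - g).
Proof. by move=> fd /sordN; exact: sordD. Qed.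
Lemma sordZ d c f : sord d f -> sord d (c *: f).
Proof. by move=> fd M Md; rewrite scoefZ fd // mulr0. Qed.
Lemma sord_sum d I (r : seq I) (P : pred I) (F : I -> A) :
  (forall i, P i -> sord d (F i)) -> sord d (\sum_(i <- r | P i) F i).
Proof. by move=> Fd M Md; rewrite scoef_sum big1 // => i /Fd ->. Qed.

Lemma sordM d d' f g : sord d f -> sord d' g -> sord (d + d') (f * g).
Proof.
move=> fd gd M Md; rewrite scoefM big_seq big1 // => D; rewrite mem_mdivs => DM.
have := mdegD (mle_sub DM); move: Md => /[swap] -> Md.
have [/fd ->|dD] := ltnP (mdeg D) d; first by rewrite mul0r mulr0.
by rewrite gd ?mulr0 // -(ltn_add2l d); apply: leq_ltn_trans Md; rewrite leq_add2r.
Qed.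

Lemma sordMl d f g : sord d g -> sord d (f * g).
Proof. exact: (@sordM 0). Qed.
Lemma sordMr d f g : sord d f -> sord d (f * g).
Proof. by move=> fd; rewrite -[d]addn0; apply: sordM. Qed.

Lemma sord_eq0 f : (forall d, sord d f) -> f = 0.
Proof. by move=> fd; apply: sseriesP => M; exact: (fd (mdeg M).+1). Qed.

Definition strunc d f : A := \sum_(D <- mupto p d) f D *: smon D.

Lemma struncE d f M : (mdeg M <= d)%N -> strunc d f M = f M.
Proof.
move=> Md; rewrite scoef_sum (bigD1_seq M) ?mem_mupto ?mupto_uniq //=.
rewrite eqxx mulr1 big1 ?addr0 // => D DM.
by rewrite eq_sym (negPf DM) mulr0.
Qed.

Lemma sord_strunc d f : sord d.+1 (f - strunc d f).
Proof. by move=> M; rewrite ltnS => Md; rewrite scoefB struncE // subrr. Qed.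

(** A predicate rather than a parity function, because zero has both parities. *)
Definition shom e f := forall M, mpar M != e -> f M = 0.

Lemma shom0 e : shom e 0. Proof. by []. Qed.
Lemma shomD e f g : shom e f -> shom e g -> shom e (f + g).
Proof. by move=> fe ge M Me; rewrite scoefD fe // ge // addr0. Qed.
Lemma shomN e f : shom e f -> shom e (- f).
Proof. by move=> fe M Me; rewrite scoefN fe // oppr0. Qed.
Lemma shomB e f g : shom e f -> shom e g -> shom e (f - g).
Proof. by move=> fe /shomN; exact: shomD. Qed.
Lemma shomZ e c f : shom e f -> shom e (c *: f).
Proof. by move=> fe M Me; rewrite scoefZ fe // mulr0. Qed.
Lemma shom_sum e I (r : seq I) (P : pred I) (F : I -> A) :
  (forall i, P i -> shom e (F i)) -> shom e (\sum_(i <- r | P i) F i).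
Proof. by move=> Fd M Md; rewrite scoef_sum big1 // => i /Fd ->. Qed.

Lemma shomM e e' f g : shom e f -> shom e' g -> shom (e (+) e') (f * g).
Proof.
move=> fe ge M Me; rewrite scoefM big_seq big1 // => D; rewrite mem_mdivs => DM.
have [De|/fe ->] := eqVneq (mpar D) e; last by rewrite mul0r mulr0.
rewrite ge ?mulr0 //; apply: contra Me => /eqP<-.
by rewrite -De -(mparD (mle_sub DM)).
Qed.

Lemma shom_smon M : shom (mpar M) (smon M).
Proof. by move=> N NM /=; case: eqP => // E; rewrite E eqxx in NM. Qed.

Lemma shom_svar x : shom (p x) (svar C p x).
Proof. by rewrite svarE -[p x]mpar_var; apply: shom_smon. Qed.

Lemma shom1 : shom false 1.
Proof. by rewrite -smon1 -(mpar1 p); apply: shom_smon. Qed.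

Lemma shomX e f (k : nat) : shom e f -> shom (e && odd k) (f ^+ k).
Proof.
move=> fe; elim: k => [|k IH]; first by rewrite expr0 andbF; apply: shom1.
have -> : e && odd k.+1 = e (+) (e && odd k) by rewrite oddS; case: e {fe IH}; case: (odd k).
by rewrite exprS; apply: shomM.
Qed.

Lemma shom_spart e f : shom e (spart e f).
Proof. by move=> M Me /=; rewrite (negPf Me). Qed.

Lemma spart_shom e e' f : shom e f -> spart e' f = if e' == e then f else 0.
Proof.
move=> fe; apply: sseriesP => M /=.
have [<-|Me] := eqVneq (mpar M) e; first by rewrite eq_sym; case: ifP.
by case: ifP => [/eqP<-|_]; rewrite ?fe //; case: ifP => _; rewrite ?fe.
Qed.

Lemma spart_split f : f = \sum_(e : bool) spart e f.
Proof. by apply: sseriesP => M; rewrite big_bool scoefD /=; case: mpar; rewrite ?addr0 ?add0r. Qed.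

Lemma spartB e f g : spart e (f - g) = spart e f - spart e g.
Proof. by apply: sseriesP => M; rewrite scoefB /=; case: ifP; rewrite ?subrr. Qed.

Lemma spartM e f g : spart e (f * g) = \sum_(e' : bool) spart e' f * spart (e' (+) e) g.
Proof.
rewrite [f in LHS]spart_split [g in LHS]spart_split mulr_suml.
have spartD (u v : A) : spart e (u + v) = spart e u + spart e v.
  by apply: sseriesP => M; rewrite scoefD /=; case: ifP; rewrite ?addr0.
rewrite !big_bool /= !mulrDr !spartD.
have E e1 e2 := spart_shom e (shomM (@shom_spart e1 f) (@shom_spart e2 g)).
by rewrite !E; case: (e) {E}; rewrite /= ?addr0 ?add0r.
Qed.

(** The automorphism [(-1)^(e|f|) f], the sign for crossing an object of parity [e]. It lets
    exchange and Leibniz rules be stated for inhomogeneous [f]. *)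
Definition sigma e f : A := SSeries (fun M => (-1) ^+ (e && mpar M) * f M).

Lemma sigmaE e f M : sigma e f M = (-1) ^+ (e && mpar M) * f M. Proof. by []. Qed.

Fact sigma_additive e : additive (sigma e).
Proof. by move=> f g; apply: sseriesP => M; rewrite scoefB !sigmaE scoefB mulrBr. Qed.
HB.instance Definition _ e := GRing.isAdditive.Build A A (sigma e) (sigma_additive e).

Fact sigma_multiplicative e : multiplicative (sigma e).
Proof.
split=> [f g|]; apply: sseriesP => M.
  rewrite sigmaE !scoefM mulr_sumr; apply: eq_big_seq => D; rewrite mem_mdivs => DM.
  rewrite (mparD (mle_sub DM)) /=.
  have -> : (-1) ^+ (e && (mpar D (+) mpar (msub M D))) =
    (-1) ^+ (e && mpar D) * (-1) ^+ (e && mpar (msub M D)) :> C.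
    by case: e => //=; rewrite ?mulr1 // signr_addb.
  ring.
by rewrite sigmaE scoef1; case: eqP => [->|_]; rewrite ?mulr0 // mpar1 andbF mulr1.
Qed.
HB.instance Definition _ e := GRing.isMultiplicative.Build A A (sigma e) (sigma_multiplicative e).

Fact sigma_scalable e : scalable (sigma e).
Proof. by move=> c f; apply: sseriesP => M; rewrite scoefZ !sigmaE scoefZ mulrCA. Qed.
HB.instance Definition _ e := GRing.isScalable.Build C A A *:%R (sigma e) (sigma_scalable e).

Lemma sigmaZ e c f : sigma e (c *: f) = c *: sigma e f.
Proof. exact: sigma_scalable. Qed.

Lemma sigma_shom e e' f : shom e' f -> sigma e f = (-1) ^+ (e && e') *: f.
Proof.
move=> fe; apply: sseriesP => M; rewrite scoefZ sigmaE.
by have [->//|/fe ->] := eqVneq (mpar M) e'; rewrite !mulr0.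
Qed.

Lemma sigma_spart e f : sigma e f = \sum_(s : bool) (-1) ^+ (e && s) *: spart s f.
Proof.
rewrite {1}[f]spart_split raddf_sum; apply: eq_bigr => s _.
exact: (sigma_shom e (@shom_spart s f)).
Qed.

Lemma sigmaK e f : sigma e (sigma e f) = f.
Proof. by apply: sseriesP => M; rewrite !sigmaE mulrA -signr_addb addbb mul1r. Qed.

Lemma sigma0 f : sigma false f = f.
Proof. by apply: sseriesP => M; rewrite sigmaE mul1r. Qed.

Lemma sord_sigma d e f : sord d f -> sord d (sigma e f).
Proof. by move=> fd M Md; rewrite sigmaE fd // mulr0. Qed.

Lemma shom_sigma e e' f : shom e f -> shom e (sigma e' f).
Proof. by move=> fd M Md; rewrite sigmaE fd // mulr0. Qed.

(** Complementary divisors match the two convolutions term by term; where [k] contributes, its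
    divisor has parity [e], so the exchange sign depends only on the parity of the divisor taken
    from [f]. *)
Lemma smul_shomr e f k : shom e k -> f * k = k * sigma e f.
Proof.
move=> ke; apply: sseriesP => M; rewrite !scoefM -(perm_big _ (perm_mdivs M)) /=.
rewrite big_map; apply: eq_big_seq => D; rewrite mem_mdivs => DM; rewrite msubK //.
have [De|/ke ->] := eqVneq (mpar D) e; last by rewrite mul0r !mulr0.
have /odd_minversions : forall x, p x -> (msub M D x * D x = 0)%N.
  by move=> x px; rewrite mulnC mle_odd0.
rewrite -(signr_odd _ (minversions _ _)) => ->; rewrite signr_addb signr_odd De andbC; ring.
Qed.

Lemma smul_evenC f k : shom false k -> f * k = k * f.
Proof. by move/smul_shomr => ->; rewrite sigma0. Qed.

Lemma smul_shomC e e' f k : shom e f -> shom e' k -> f * k = (-1) ^+ (e && e') *: (k * f).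
Proof. by move=> fe /smul_shomr ->; rewrite (sigma_shom _ fe) -scalerAr andbC. Qed.

Definition sconst f : C := f (mono1 p).

Lemma mdivs1 : mdivs (mono1 p) = [:: mono1 p].
Proof.
apply: perm_small_eq => //; apply: uniq_perm; rewrite ?mdivs_uniq // => D.
by rewrite mem_mdivs mle_mono1 inE.
Qed.

Fact sconst_additive : additive sconst. Proof. by []. Qed.
HB.instance Definition _ := GRing.isAdditive.Build A C sconst sconst_additive.

Fact sconst_multiplicative : multiplicative sconst.
Proof.
split=> [f g|]; last by rewrite /sconst scoef1 eqxx.
by rewrite /sconst scoefM mdivs1 big_seq1 msubxx minversions1l mul1r.
Qed.
HB.instance Definition _ := GRing.isMultiplicative.Build A C sconst sconst_multiplicative.

Lemma sconst_svar x : sconst (svar C p x) = 0.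
Proof. by rewrite /sconst /= eq_sym mvar_neq1. Qed.

Lemma sconst_odd f : shom true f -> sconst f = 0.
Proof. by move=> f1; rewrite /sconst f1 // mpar1. Qed.

Lemma sord1 f : sconst f = 0 -> sord 1 f.
Proof. by move=> f0 M; rewrite ltnS leqn0 mdeg_eq0 => /eqP->. Qed.

Lemma sordX f (k : nat) : sconst f = 0 -> sord k (f ^+ k).
Proof.
move=> f0; elim: k => // k IH; rewrite exprS -add1n; apply: sordM => //; exact: sord1.
Qed.

End SeriesTheory.

Arguments smon {C G p} M.
Arguments sconst {C G p} f : simpl never.

Section ContinuousLinear.
Variables (C : comNzRingType) (G G' : finType) (p : pred G) (q : pred G').

(** A loss of one order is allowed so that the criterion also covers derivations: the error of a
    truncation still has arbitrarily high order. *)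
Lemma slin_eq0 (L : sseries C p -> sseries C q) :
  (forall f g, L (f + g) = L f + L g) -> (forall c f, L (c *: f) = c *: L f) ->
  (forall d f, sord d.+1 f -> sord d (L f)) -> (forall M, L (smon M) = 0) ->
  forall f, L f = 0.
Proof.
move=> LD LZ Ld L0 f; apply: sord_eq0 => d.
rewrite -[f](subrK (strunc d f)) LD; apply: sordD; first exact/Ld/sord_strunc.
have L_0 : L 0 = 0 by rewrite -(scale0r 0) LZ scale0r.
rewrite (big_morph L LD L_0); apply: sord_sum => D _; rewrite LZ L0 scaler0.
exact: sord_0.
Qed.

End ContinuousLinear.

Lemma sbilin_eq0 (C : comNzRingType) (G G' G'' : finType)
    (p : pred G) (p' : pred G') (q : pred G'')
    (B : sseries C p -> sseries C p' -> sseries C q) :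
  (forall f f' g, B (f + f') g = B f g + B f' g) ->
  (forall c f g, B (c *: f) g = c *: B f g) ->
  (forall f g g', B f (g + g') = B f g + B f g') ->
  (forall c f g, B f (c *: g) = c *: B f g) ->
  (forall d f g, sord d.+1 f -> sord d (B f g)) ->
  (forall d f g, sord d.+1 g -> sord d (B f g)) ->
  (forall M N, B (smon M) (smon N) = 0) -> forall f g, B f g = 0.
Proof.
move=> BDl BZl BDr BZr Bdl Bdr B0 f g.
apply: (slin_eq0 (L := fun f => B f g)) => [f1 f2|c f1|d f1 /Bdl|M]; do ?exact.
apply: (slin_eq0 (L := fun g => B (smon M) g)) => [g1 g2|c g1|d g1 /Bdr|N]; exact.
Qed.

(** * Substitutions *)

Lemma enum_rankE (T : finType) (x : T) : enum_rank x = index x (enum T) :> nat.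
Proof.
by rewrite /enum_rank enum_rank_in.unlock insubdK // -[_ \in _]/(_ < _)%N cardE index_mem mem_enum.
Qed.

Lemma pairwise_enum_rank (T : finType) :
  pairwise (fun x y : T => (enum_rank x < enum_rank y)%N) (enum T).
Proof.
case E: (enum T) => [//|x0 s]; rewrite -E; apply/(pairwiseP x0) => i j.
rewrite !inE => iT jT ij; rewrite !enum_rankE !index_uniq ?enum_uniq //.
Qed.

Lemma prodr_eq0_seq (R : pzSemiRingType) (I : eqType) (s : seq I) (F : I -> R) x :
  x \in s -> F x = 0 -> \prod_(i <- s) F i = 0.
Proof.
move=> xs Fx; case/splitPr: xs => s1 s2.
by rewrite big_cat big_cons /= Fx mul0r mulr0.
Qed.

(** Supercommutativity alone gives [2 f^2 = 0]; the coefficients have characteristic zero. *)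
Lemma shom_sqr0 (C : numDomainType) (G : finType) (p : pred G) (f : sseries C p) :
  shom true f -> f * f = 0.
Proof.
move=> f1; have := smul_shomC f1 f1; rewrite expr1 scaleN1r => /eqP.
rewrite -addr_eq0 -mulr2n => /eqP f0; apply: sseriesP => M.
have /(congr1 (fun g : sseries C p => g M)) := f0.
by rewrite mulr2n scoefD -mulr2n => /eqP; rewrite mulrn_eq0 => /eqP.
Qed.

Section SmonInd.
Variables (C : numDomainType) (G : finType) (p : pred G).

Lemma mvar_decomp (M : smono p) : M != mono1 p ->
  exists x, mle (mvar p x) M.
Proof.
move=> M1; have /forallPn[x Mx] : ~~ [forall x, M x == 0%N].
  apply: contra M1 => /forallP M0; apply/eqP/smonoP => x; rewrite mono1E; exact/eqP.
exists x; apply/forallP => y; rewrite mvarE; case: eqP => // ->.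
by rewrite lt0n.
Qed.

(** Induction on the degree; the closure under scaling absorbs the sign created when a variable is
    pulled to the front of a monomial. *)
Lemma smon_ind (P : sseries C p -> Prop) : P 1 ->
  (forall (c : C) f, P f -> P (c *: f)) ->
  (forall x (M : smono p), P (smon M) -> P (svar C p x * smon M)) ->
  forall M : smono p, P (smon M).
Proof.
move=> P1 PZ PM M; have [d] := ubnP (mdeg M); elim: d M => // d IH M Md.
have [->//|/mvar_decomp [x xM]] := eqVneq M (mono1 p).
have /andP[c /eqP E] : mcompat (mvar p x) (msub M (mvar p x)) &&
    (M == madd (mvar p x) (msub M (mvar p x))).
  by rewrite -eq_madd xM eqxx.
have -> : smon M = (-1) ^+ minversions (mvar p x) (msub M (mvar p x)) *:
    (svar C p x * smon (msub M (mvar p x))).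
  by rewrite svarE smonM c scalerA -exprMn mulrNN mulr1 expr1n scale1r -E.
apply/PZ/PM/IH; rewrite (mdegD (mle_sub xM)) mdeg_var in Md; exact: Md.
Qed.

End SmonInd.

Section Evaluation.
Variables (C : numDomainType) (G G' : finType) (p : pred G) (q : pred G').

(** The conditions making [ssubst] a superalgebra morphism: without constant terms its truncated sum
    omits nothing, and with the right parities the images of odd variables square to zero. *)
Record ssubdata := SSubData {
  ssubfun :> G -> sseries C q;
  ssubfun_hom : forall x, shom (p x) (ssubfun x);
  ssubfun_const : forall x, sconst (ssubfun x) = 0 }.

Variable u : ssubdata.

Definition sev (a : G -> nat) (s : seq G) := \prod_(x <- s) u x ^+ a x.

Lemma shom_sev a s : shom (odd (\sum_(x <- s | p x) a x)) (sev a s).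
Proof.
elim: s => [|x s IH]; rewrite /sev ?big_nil; first exact: shom1.
rewrite !big_cons; have := shomM (shomX (k := a x) (@ssubfun_hom u x)) IH.
by case: (p x) => //=; rewrite oddD.
Qed.

Definition sinversions (a b : G -> nat) (s : seq G) : nat :=
  \sum_(x <- s | p x) \sum_(y <- s | p y && (enum_rank y < enum_rank x)%N) a x * b y.

(** The power of the head variable coming from [b] has to cross the tail of the first product. As
    the list is sorted by [enum_rank], this crossing counts exactly the inversions that involve the
    head. *)
Lemma sevM a b s : pairwise (fun x y : G => (enum_rank x < enum_rank y)%N) s ->
  sev a s * sev b s = (-1) ^+ sinversions a b s *: sev (fun x => a x + b x)%N s.
Proof.
elim: s => [|x s IH] /=; first by rewrite /sev !big_nil /sinversions big_nil scale1r mul1r.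
case/andP=> /allP xs /IH{}IH.
have -> : sinversions a b (x :: s) =
    (p x * (b x * \sum_(y <- s | p y) a y) + sinversions a b s)%N.
  rewrite /sinversions big_cons.
  have -> : \sum_(y <- x :: s | p y && (enum_rank y < enum_rank x)%N) a x * b y = 0%N.
    rewrite big_cons ltnn andbF big_seq_cond big1 // => y /and3P[ys _].
    by have := xs _ ys; case: ltngtP.
  rewrite add0n if_same mulnA big_distrr /= -big_split /=.
  rewrite big_seq_cond [RHS]big_seq_cond; apply: eq_bigr => y /andP[ys py].
  by rewrite big_cons xs // andbT; case: (p x); rewrite ?mul1n // mulnC.
rewrite /sev !big_cons -/(sev a s) -/(sev b s) -/(sev _ s).
rewrite -mulrA [sev a s * _]mulrA (smul_shomC (@shom_sev a s) (shomX (k := b x) (@ssubfun_hom u x))).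
rewrite -!scalerAl -scalerAr -mulrA IH -!scalerAr scalerA mulrA.
congr (_ *: _); last by rewrite -exprD.
by rewrite exprD -[in RHS](signr_odd _ (_ * _)%N) !oddM oddb andbC -andbA.
Qed.

Lemma sevME (A B : smono p) : sev A (enum G) * sev B (enum G) =
  (-1) ^+ minversions A B *: sev (fun x => A x + B x)%N (enum G).
Proof.
rewrite sevM ?pairwise_enum_rank //; congr ((-1) ^+ _ *: _).
rewrite /sinversions /minversions big_enum_cond; apply: eq_bigr => x _.
by rewrite big_enum_cond.
Qed.

Lemma sord_sev a s : sord (\sum_(x <- s) a x) (sev a s).
Proof.
rewrite /sev; elim: s => [|x s IH]; rewrite ?big_nil ?big_cons //.
by apply: sordM => //; apply/sordX/ssubfun_const.
Qed.

Lemma sord_sevE (A : smono p) : sord (mdeg A) (sev A (enum G)).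
Proof. by have := @sord_sev A (enum G); rewrite big_enum. Qed.

Definition smorph (f : sseries C p) : sseries C q := ssubst u f.

Lemma smorphE f M : smorph f M =
  \sum_(A <- mupto p (mdeg M)) f A * sev A (enum G) M.
Proof. by []. Qed.

Fact smorph_additive : additive smorph.
Proof.
move=> f g; apply: sseriesP => M; rewrite scoefB !smorphE -sumrB.
by apply: eq_bigr => A _; rewrite scoefB mulrBl.
Qed.
HB.instance Definition _ :=
  GRing.isAdditive.Build (sseries C p) (sseries C q) smorph smorph_additive.

Fact smorph_scalable : scalable smorph.
Proof.
move=> c f; apply: sseriesP => M; rewrite scoefZ !smorphE mulr_sumr.
by apply: eq_bigr => A _; rewrite scoefZ mulrA.
Qed.
HB.instance Definition _ := GRing.isScalable.Build C (sseries C p) (sseries C q)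
  *:%R smorph smorph_scalable.

Lemma smorphZ c f : smorph (c *: f) = c *: smorph f.
Proof. exact: smorph_scalable. Qed.

Lemma smorph_smon (A : smono p) : smorph (smon A) = sev A (enum G).
Proof.
apply: sseriesP => M; rewrite smorphE; have [AM|MA] := leqP (mdeg A) (mdeg M).
  rewrite (bigD1_seq A) ?mem_mupto ?mupto_uniq //= eqxx mul1r big1 ?addr0 //.
  by move=> B /negPf ->; rewrite mul0r.
rewrite (sord_sevE MA) big_seq big1 // => B; rewrite mem_mupto => BM /=.
case: eqP => [BA|_]; last by rewrite mul0r.
by rewrite leqNgt BA MA in BM.
Qed.

Lemma sord_smorph d f : sord d f -> sord d (smorph f).
Proof.
move=> fd M Md; rewrite smorphE big_seq big1 // => A; rewrite mem_mupto => AM.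
by rewrite fd ?mul0r //; exact: leq_ltn_trans Md.
Qed.

Lemma shom_smorph e f : shom e f -> shom e (smorph f).
Proof.
move=> fe M Me; rewrite smorphE big1 // => A _.
have [Ae|/fe ->] := eqVneq (mpar A) e; last by rewrite mul0r.
rewrite (shom_sev (a := A)) ?mulr0 // big_enum_cond; apply: contra Me => /eqP->.
by rewrite -Ae.
Qed.

Fact smorph_multiplicative : multiplicative smorph.
Proof.
have m1 : smorph 1 = 1.
  rewrite -smon1 smorph_smon /sev big1 // => x _; by rewrite mono1E.
split=> // f g; apply/eqP; rewrite -subr_eq0; apply/eqP; move: f g.
apply: sbilin_eq0 => [f f' g|c f g|f g g'|c f g|d f g fd|d f g gd|A B].
- by rewrite mulrDl !raddfD /= mulrDl opprD addrACA.
- by rewrite -scalerAl !linearZ /= -scalerAl scalerBr.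
- by rewrite mulrDr !raddfD /= mulrDr opprD addrACA.
- by rewrite -scalerAr !linearZ /= -scalerAr scalerBr.
- apply: (@sordW _ _ _ d.+1) => //; apply: sordB; first exact/sord_smorph/sordMr.
  exact/sordMr/sord_smorph.
- apply: (@sordW _ _ _ d.+1) => //; apply: sordB; first exact/sord_smorph/sordMl.
  exact/sordMl/sord_smorph.
rewrite smonM !smorph_smon sevME; case: ifP => [c|/negbT/forallPn[x]].
  rewrite linearZ /= smorph_smon -scalerBr [X in _ - X](_ : _ = sev (madd A B) (enum G)) ?subrr ?scaler0 //.
  by apply: eq_bigr => x _; rewrite maddE.
(* Here some odd variable would get exponent at least 2: the product of the monomials is already 0,
   and on the other side the image of that variable occurs squared. *)
rewrite negb_imply -ltnNge => /andP[px ABx]; rewrite raddf0 sub0r.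
rewrite [sev _ _](prodr_eq0_seq (x := x)) ?scaler0 ?oppr0 ?mem_enum //.
rewrite -(subnK ABx) addn2 !exprSr -mulrA shom_sqr0 ?mulr0 //.
by rewrite -px; apply: ssubfun_hom.
Qed.
HB.instance Definition _ := GRing.isMultiplicative.Build
  (sseries C p) (sseries C q) smorph smorph_multiplicative.

Lemma smorph_svar x : smorph (svar C p x) = u x.
Proof.
rewrite svarE smorph_smon /sev; move: (mem_enum G x) (enum_uniq G) => xG.
case/splitPr: xG => s1 s2; rewrite cat_uniq /= negb_or => /and3P[_ /andP[xs1 _] /andP[xs2 _]].
rewrite big_cat big_cons /= !ffunE eqxx expr1.
rewrite !big_seq !big1 ?mul1r ?mulr1 // => y ys; rewrite ffunE; case: eqP => // yx.
  by rewrite -yx ys in xs2.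
by rewrite -yx ys in xs1.
Qed.

End Evaluation.

Lemma smorph_ext (C : numDomainType) (G G' : finType) (p : pred G) (q : pred G')
    (phi psi : {lrmorphism sseries C p -> sseries C q}) :
  (forall d f, sord d f -> sord d (phi f)) -> (forall d f, sord d f -> sord d (psi f)) ->
  (forall x, phi (svar C p x) = psi (svar C p x)) -> phi =1 psi.
Proof.
move=> phid psid E f; apply/eqP; rewrite -subr_eq0; apply/eqP; move: f.
apply: slin_eq0 => [f g|c f|d f fd|].
- by rewrite (rmorphD phi) (rmorphD psi) opprD addrACA.
- by rewrite !linearZZ -scalerDr.
- by apply: (@sordW _ _ _ d.+1) => //; apply: sordB; [exact: phid|exact: psid].
apply: (smon_ind (P := fun f => phi f - psi f = 0)) => [|c f|x M IH]; first by rewrite !rmorph1 subrr.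
  by move=> IH; rewrite !linearZZ -scalerDr /= IH scaler0.
by rewrite !rmorphM /= E -mulrBr IH mulr0.
Qed.

(** * Tensor products *)

(** That the variables of the first factor come first makes [mpair A B] an ordered product, and
    thereby fixes all the Koszul signs below. *)
Lemma enum_sum (G G' : finType) :
  enum ((G + G')%type : finType) = map inl (enum G) ++ map inr (enum G').
Proof. by rewrite !enumT [in LHS]unlock. Qed.

Section TensorTheory.
Variables (C : numDomainType) (G G' : finType) (p : pred G) (q : pred G').
Local Notation T := (sseries C (psum p q)).
Implicit Types (A D : smono p) (B E : smono q) (M : smono (psum p q)).

Lemma enum_rank_inl (x y : G) :
  (enum_rank (inl x : G + G') < enum_rank (inl y : G + G'))%N =
  (enum_rank x < enum_rank y)%N.
Proof.
rewrite !enum_rankE enum_sum !index_cat !(mem_map (@inl_inj _ _)) !mem_enum.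
by rewrite !(index_map (@inl_inj _ _)).
Qed.

Lemma enum_rank_inr (x y : G') :
  (enum_rank (inr x : G + G') < enum_rank (inr y : G + G'))%N =
  (enum_rank x < enum_rank y)%N.
Proof.
have nin z : (inr z : G + G') \in map inl (enum G) = false.
  by apply/negbTE/mapP => -[].
rewrite !enum_rankE enum_sum !index_cat !nin !(index_map (@inr_inj _ _)).
by rewrite ltn_add2l.
Qed.

Lemma enum_rank_inlr (x : G) (y : G') :
  (enum_rank (inl x : G + G') < enum_rank (inr y : G + G'))%N.
Proof.
have nin z : (inr z : G + G') \in map inl (enum G) = false.
  by apply/negbTE/mapP => -[].
rewrite !enum_rankE enum_sum !index_cat nin (mem_map (@inl_inj _ _)) mem_enum.
by rewrite (leq_trans _ (leq_addr _ _)) // index_mem (mem_map (@inl_inj _ _)) mem_enum.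
Qed.

Lemma mpairEl A B x : mpair A B (inl x) = A x. Proof. by rewrite ffunE. Qed.
Lemma mpairEr A B x : mpair A B (inr x) = B x. Proof. by rewrite ffunE. Qed.

Lemma mleft_mpair A B : mleft (mpair A B) = A.
Proof. by apply: smonoP => x; rewrite !ffunE. Qed.
Lemma mright_mpair A B : mright (mpair A B) = B.
Proof. by apply: smonoP => x; rewrite !ffunE. Qed.
Lemma mpairK M : mpair (mleft M) (mright M) = M.
Proof. by apply: smonoP => -[x|x]; rewrite !ffunE. Qed.

Lemma eq_mpair A B M : (M == mpair A B) = (mleft M == A) && (mright M == B).
Proof.
apply/eqP/andP => [->|[/eqP<- /eqP<-]]; last by rewrite mpairK.
by rewrite mleft_mpair mright_mpair !eqxx.
Qed.

Lemma mpair1 : mpair (mono1 p) (mono1 q) = mono1 (psum p q).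
Proof. by apply: smonoP => -[x|x]; rewrite !ffunE. Qed.

Lemma mdeg_mpair A B : mdeg (mpair A B) = (mdeg A + mdeg B)%N.
Proof.
rewrite /mdeg big_sumType /=; congr (_ + _)%N; apply: eq_bigr => x _; exact: ffunE.
Qed.

Lemma mpar_mpair A B : mpar (mpair A B) = mpar A (+) mpar B.
Proof.
rewrite /mpar big_sumType oddD /=.
by congr (odd _ (+) odd _); apply: eq_bigr => x _; exact: ffunE.
Qed.

Lemma mcompat_mpair A B D E :
  mcompat (mpair A B) (mpair D E) = mcompat A D && mcompat B E.
Proof.
apply/forallP/andP => [c|[/forallP AD /forallP BE] [x|x]]; last 2 first.
- by have := AD x; rewrite !mpairEl.
- by have := BE x; rewrite !mpairEr.
split; apply/forallP => x; first by have := c (inl x); rewrite !mpairEl.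
by have := c (inr x); rewrite !mpairEr.
Qed.

Lemma madd_mpair A B D E : madd (mpair A B) (mpair D E) = mpair (madd A D) (madd B E).
Proof. by apply: smonoP => -[x|x]; rewrite !ffunE. Qed.

(** Besides the inversions inside each factor, the odd variables of [B] must cross those of [D]:
    this is the Koszul sign. *)
Lemma odd_minversions_mpair A B D E : odd (minversions (mpair A B) (mpair D E)) =
  odd (minversions A D + minversions B E) (+) (mpar B && mpar D).
Proof.
rewrite -oddM -oddD; congr odd; rewrite {1}/minversions big_sumType /= -addnA.
congr (_ + _)%N.
  apply: eq_bigr => a _; rewrite big_sumType /= [X in (_ + X)%N]big1 => [|b /andP[_]]; last first.
    by rewrite ltnNge (ltnW (enum_rank_inlr _ _)).
  by rewrite addn0; apply: eq_big => b; rewrite ?enum_rank_inl // !mpairEl.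
rewrite big_distrlr /= /minversions -big_split /=; apply: eq_bigr => a _.
rewrite big_sumType /= addnC; congr (_ + _)%N.
  by apply: eq_big => b; rewrite ?enum_rank_inr // !mpairEr.
by apply: eq_big => b; rewrite ?enum_rank_inlr ?andbT // mpairEl mpairEr.
Qed.

Lemma stensE f g M : stens f g M = f (mleft M) * g (mright M) :> C.
Proof. by []. Qed.

Lemma stens_smon A B : stens (smon A) (smon B) = smon (mpair A B) :> T.
Proof.
apply: sseriesP => M /=; rewrite eq_mpair; case: eqP; case: eqP => //=.
all: by rewrite ?mulr0 ?mul0r ?mulr1.
Qed.

Lemma stensDl f f' g : stens (f + f') g = stens f g + stens f' g :> T.
Proof. by apply: sseriesP => M; rewrite scoefD !stensE scoefD mulrDl. Qed.
Lemma stensDr f g g' : stens f (g + g') = stens f g + stens f g' :> T.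
Proof. by apply: sseriesP => M; rewrite scoefD !stensE scoefD mulrDr. Qed.
Lemma stensZl c f g : stens (c *: f) g = c *: stens f g :> T.
Proof. by apply: sseriesP => M; rewrite scoefZ !stensE scoefZ mulrA. Qed.
Lemma stensZr c f g : stens f (c *: g) = c *: stens f g :> T.
Proof. by apply: sseriesP => M; rewrite scoefZ !stensE scoefZ mulrCA. Qed.
Lemma stens0l g : stens 0 g = 0 :> T.
Proof. by rewrite -(scale0r 0) stensZl scale0r. Qed.
Lemma stens0r f : stens f 0 = 0 :> T.
Proof. by rewrite -(scale0r 0) stensZr scale0r. Qed.
Lemma stensNl f g : stens (- f) g = - stens f g :> T.
Proof. by rewrite -scaleN1r stensZl scaleN1r. Qed.
Lemma stensNr f g : stens f (- g) = - stens f g :> T.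
Proof. by rewrite -scaleN1r stensZr scaleN1r. Qed.

Lemma sord_stens d d' f g : sord d f -> sord d' g -> sord (d + d') (stens f g : T).
Proof.
move=> fd gd M; rewrite -{1}[M]mpairK mdeg_mpair stensE => Md.
have [/fd ->|dM] := ltnP (mdeg (mleft M)) d; first by rewrite mul0r.
rewrite gd ?mulr0 // -(ltn_add2l d); apply: leq_ltn_trans Md.
by rewrite leq_add2r.
Qed.

Lemma sord_stensl d f g : sord d f -> sord d (stens f g : T).
Proof. by move=> fd; rewrite -[d]addn0; apply: sord_stens. Qed.
Lemma sord_stensr d f g : sord d g -> sord d (stens f g : T).
Proof. exact: (@sord_stens 0). Qed.

Lemma shom_stens e e' f g : shom e f -> shom e' g -> shom (e (+) e') (stens f g : T).
Proof.
move=> fe ge M; rewrite -{1}[M]mpairK mpar_mpair stensE => Me.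
have [le|/fe ->] := eqVneq (mpar (mleft M)) e; last by rewrite mul0r.
by rewrite ge ?mulr0 //; apply: contra Me => /eqP->; rewrite le.
Qed.

Lemma sconst_stens f g : sconst (stens f g : T) = sconst f * sconst g.
Proof. by rewrite {1}/sconst -mpair1 stensE mleft_mpair mright_mpair. Qed.

Lemma stens11 : stens 1 1 = 1 :> T.
Proof. by rewrite -!smon1 stens_smon mpair1. Qed.

Lemma smonM_mpair A B D E : smon (mpair A B) * smon (mpair D E) =
  (-1) ^+ (mpar B && mpar D) *: stens (smon A * smon D) (smon B * smon E) :> T.
Proof.
rewrite smonM (smonM _ A) (smonM _ B) mcompat_mpair madd_mpair.
case: (mcompat A D) => /=; last by rewrite stens0l scaler0.
case: (mcompat B E) => /=; last by rewrite stens0r scaler0.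
rewrite stensZl stensZr stens_smon !scalerA; congr (_ *: _).
rewrite -signr_odd odd_minversions_mpair signr_addb signr_odd exprD; ring.
Qed.

Lemma stensMl f f' : stens (f * f') 1 = stens f 1 * stens f' 1 :> T.
Proof.
apply/eqP; rewrite -subr_eq0; apply/eqP; move: f f'.
apply: sbilin_eq0 => [f f' g|c f g|f g g'|c f g|d f g fd|d f g gd|A B].
- by rewrite mulrDl !stensDl mulrDl opprD addrACA.
- by rewrite -scalerAl !stensZl -scalerAl scalerBr.
- by rewrite mulrDr !stensDl mulrDr opprD addrACA.
- by rewrite -scalerAr !stensZl -scalerAr scalerBr.
- apply: (@sordW _ _ _ d.+1) => //; apply: sordB; first exact/sord_stensl/sordMr.
  exact/sordMr/sord_stensl.
- apply: (@sordW _ _ _ d.+1) => //; apply: sordB; first exact/sord_stensl/sordMl.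
  exact/sordMl/sord_stensl.
by rewrite -(smon1 _ q) !stens_smon smonM_mpair mpar1 smon1 mulr1 scale1r subrr.
Qed.

Lemma stensMr g g' : stens 1 (g * g') = stens 1 g * stens 1 g' :> T.
Proof.
apply/eqP; rewrite -subr_eq0; apply/eqP; move: g g'.
apply: sbilin_eq0 => [f f' g|c f g|f g g'|c f g|d f g fd|d f g gd|A B].
- by rewrite mulrDl !stensDr mulrDl opprD addrACA.
- by rewrite -scalerAl !stensZr -scalerAl scalerBr.
- by rewrite mulrDr !stensDr mulrDr opprD addrACA.
- by rewrite -scalerAr !stensZr -scalerAr scalerBr.
- apply: (@sordW _ _ _ d.+1) => //; apply: sordB; first exact/sord_stensr/sordMr.
  exact/sordMr/sord_stensr.
- apply: (@sordW _ _ _ d.+1) => //; apply: sordB; first exact/sord_stensr/sordMl.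
  exact/sordMl/sord_stensr.
by rewrite -(smon1 _ p) !stens_smon smonM_mpair mpar1 andbF smon1 mulr1 scale1r subrr.
Qed.

Lemma stensE1 f g : stens f g = stens f 1 * stens 1 g :> T.
Proof.
apply/eqP; rewrite -subr_eq0; apply/eqP; move: f g.
apply: sbilin_eq0 => [f f' g|c f g|f g g'|c f g|d f g fd|d f g gd|A B].
- by rewrite !stensDl mulrDl opprD addrACA.
- by rewrite !stensZl -scalerAl scalerBr.
- by rewrite !stensDr mulrDr opprD addrACA.
- by rewrite !stensZr -scalerAr scalerBr.
- apply: (@sordW _ _ _ d.+1) => //; apply: sordB; first exact/sord_stensl.
  exact/sordMr/sord_stensl.
- apply: (@sordW _ _ _ d.+1) => //; apply: sordB; first exact/sord_stensr.
  exact/sordMl/sord_stensr.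
by rewrite -(smon1 _ p) -(smon1 _ q) !stens_smon smonM_mpair mpar1 !smon1 mulr1 mul1r scale1r
  stens_smon subrr.
Qed.

Lemma stensM_even f g f' g' : shom false g ->
  stens f g * stens f' g' = stens (f * f') (g * g') :> T.
Proof.
move=> g0; rewrite [in RHS]stensE1 stensMl stensMr (stensE1 f) (stensE1 f') !mulrA.
congr (_ * _); rewrite -!mulrA; congr (_ * _).
by apply/esym/smul_evenC; exact: (shom_stens (@shom1 C _ p) g0).
Qed.

Definition stensl (f : sseries C p) : T := stens f 1.
Fact stensl_additive : additive stensl.
Proof. by move=> f g; rewrite /stensl stensDl stensNl. Qed.
HB.instance Definition _ := GRing.isAdditive.Build _ _ stensl stensl_additive.
Fact stensl_multiplicative : multiplicative stensl.
Proof. by split=> [f g|]; [exact: stensMl|exact: stens11]. Qed.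
HB.instance Definition _ := GRing.isMultiplicative.Build _ _ stensl stensl_multiplicative.

Definition stensr (g : sseries C q) : T := stens 1 g.
Fact stensr_additive : additive stensr.
Proof. by move=> f g; rewrite /stensr stensDr stensNr. Qed.
HB.instance Definition _ := GRing.isAdditive.Build _ _ stensr stensr_additive.
Fact stensr_multiplicative : multiplicative stensr.
Proof. by split=> [f g|]; [exact: stensMr|exact: stens11]. Qed.
HB.instance Definition _ := GRing.isMultiplicative.Build _ _ stensr stensr_multiplicative.

(** Functionals on one tensor factor are assembled from these slices: the constant monomial gives
    the counit, the variables give the epsilon-derivations. *)
Definition slicel A (t : T) : sseries C q := SSeries (fun B => t (mpair A B)).
Definition slicer B (t : T) : sseries C p := SSeries (fun A => t (mpair A B)).

Lemma slicelD A t u : slicel A (t + u) = slicel A t + slicel A u. Proof. by []. Qed.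
Lemma slicelZ A c t : slicel A (c *: t) = c *: slicel A t. Proof. by []. Qed.
Lemma slicerD B t u : slicer B (t + u) = slicer B t + slicer B u. Proof. by []. Qed.
Lemma slicerZ B c t : slicer B (c *: t) = c *: slicer B t. Proof. by []. Qed.

Fact slicel_additive A : additive (slicel A). Proof. by []. Qed.
HB.instance Definition _ A := GRing.isAdditive.Build T (sseries C q) (slicel A) (slicel_additive A).
Fact slicel_scalable A : scalable (slicel A). Proof. by []. Qed.
HB.instance Definition _ A := GRing.isScalable.Build C T (sseries C q) *:%R (slicel A) (slicel_scalable A).
Fact slicer_additive B : additive (slicer B). Proof. by []. Qed.
HB.instance Definition _ B := GRing.isAdditive.Build T (sseries C p) (slicer B) (slicer_additive B).
Fact slicer_scalable B : scalable (slicer B). Proof. by []. Qed.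
HB.instance Definition _ B := GRing.isScalable.Build C T (sseries C p) *:%R (slicer B) (slicer_scalable B).

Lemma slicel_stens A f g : slicel A (stens f g) = f A *: g.
Proof. by apply: sseriesP => B; rewrite scoefZ /= mleft_mpair mright_mpair. Qed.
Lemma slicer_stens B f g : slicer B (stens f g) = g B *: f.
Proof. by apply: sseriesP => A; rewrite scoefZ /= mleft_mpair mright_mpair mulrC. Qed.

Lemma sord_slicel d A t : sord (d + mdeg A) t -> sord d (slicel A t).
Proof. by move=> td B Bd; apply: td; rewrite mdeg_mpair addnC ltn_add2r. Qed.
Lemma sord_slicer d B t : sord (d + mdeg B) t -> sord d (slicer B t).
Proof. by move=> td A Ad; apply: td; rewrite mdeg_mpair ltn_add2r. Qed.

Lemma shom_slicel e A t : shom e t -> shom (mpar A (+) e) (slicel A t).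
Proof.
move=> te B Be; apply: te; rewrite mpar_mpair; apply: contra Be => /eqP<-.
by rewrite addbA addbb.
Qed.
Lemma shom_slicer e B t : shom e t -> shom (mpar B (+) e) (slicer B t).
Proof.
move=> te A Ae; apply: te; rewrite mpar_mpair; apply: contra Ae => /eqP<-.
by rewrite addbC addbK.
Qed.

Lemma mle_var (r : pred G) (A : smono r) x : mle A (mvar r x) -> A = mono1 r \/ A = mvar r x.
Proof.
move=> /forallP Ax; have [Axx|Axx] := eqVneq (A x) 0%N; [left|right]; apply: smonoP => y.
  by have := Ax y; rewrite mono1E mvarE; case: eqP => [->|_]; rewrite ?Axx // leqn0 => /eqP.
have := Ax y; rewrite mvarE; case: eqP => [->|_]; last by rewrite leqn0 => /eqP.
by move=> A1; apply/eqP; rewrite eqn_leq A1 lt0n.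
Qed.

End TensorTheory.

Section LowCoefficients.
Variables (C : numDomainType) (G : finType) (p : pred G).

Lemma smon_coefM1 (A D : smono p) :
  (smon A * smon D : sseries C p) (mono1 p) = ((A == mono1 p) && (D == mono1 p))%:R.
Proof.
rewrite -[LHS]/(sconst (smon A * smon D)) rmorphM /= /sconst /=.
by rewrite ![mono1 p == _]eq_sym; case: eqP; case: eqP => _ _; rewrite ?mulr0 ?mulr1.
Qed.

Lemma scoefM_var (f g : sseries C p) x :
  (f * g) (mvar p x) = f (mvar p x) * sconst g + sconst f * g (mvar p x).
Proof.
rewrite scoefM (perm_big [:: mvar p x; mono1 p]) /=; last first.
  apply: uniq_perm; rewrite ?mdivs_uniq //= ?inE ?mvar_neq1 // => A.
  rewrite mem_mdivs !inE; apply/idP/orP => [/mle_var[]->|]; rewrite ?eqxx; auto.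
  by case=> /eqP->; rewrite ?mle_refl ?mle1.
by rewrite big_cons big_seq1 msubxx minversions1r msub1 minversions1l !mul1r.
Qed.

End LowCoefficients.

Section SliceMorphism.
Variables (C : numDomainType) (G G' : finType) (p : pred G) (q : pred G').
Local Notation T := (sseries C (psum p q)).

(** This is the counit applied to the first factor. A product has trivial left monomial only if both
    left monomials are trivial, and then no Koszul sign occurs. *)
Lemma slicel1M (t u : T) :
  slicel (mono1 p) (t * u) = slicel (mono1 p) t * slicel (mono1 p) u.
Proof.
apply/eqP; rewrite -subr_eq0; apply/eqP; move: t u.
apply: sbilin_eq0 => [f f' g|c f g|f g g'|c f g|d f g fd|d f g gd|A B].
- by rewrite mulrDl !slicelD mulrDl opprD addrACA.
- by rewrite -scalerAl !slicelZ -scalerAl scalerBr.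
- by rewrite mulrDr !slicelD mulrDr opprD addrACA.
- by rewrite -scalerAr !slicelZ -scalerAr scalerBr.
- have fd' := sordW (leqnSn d) fd; apply: sordB.
    by apply: sord_slicel; rewrite mdeg1 addn0; exact: sordMr.
  by apply/sordMr/sord_slicel; rewrite mdeg1 addn0.
- have gd' := sordW (leqnSn d) gd; apply: sordB.
    by apply: sord_slicel; rewrite mdeg1 addn0; exact: sordMl.
  by apply/sordMl/sord_slicel; rewrite mdeg1 addn0.
rewrite -[A]mpairK -[B]mpairK smonM_mpair slicelZ -!stens_smon !slicel_stens smon_coefM1 /=.
rewrite ![mono1 p == _]eq_sym; case: eqP => [_|_]; last by rewrite !scale0r mul0r scaler0 subrr.
case: eqP => [->|_]; last by rewrite !scale0r mulr0 scaler0 subrr.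
by rewrite mpar1 andbF !scale1r subrr.
Qed.

Lemma slicer1M (t u : T) :
  slicer (mono1 q) (t * u) = slicer (mono1 q) t * slicer (mono1 q) u.
Proof.
apply/eqP; rewrite -subr_eq0; apply/eqP; move: t u.
apply: sbilin_eq0 => [f f' g|c f g|f g g'|c f g|d f g fd|d f g gd|A B].
- by rewrite mulrDl !slicerD mulrDl opprD addrACA.
- by rewrite -scalerAl !slicerZ -scalerAl scalerBr.
- by rewrite mulrDr !slicerD mulrDr opprD addrACA.
- by rewrite -scalerAr !slicerZ -scalerAr scalerBr.
- have fd' := sordW (leqnSn d) fd; apply: sordB.
    by apply: sord_slicer; rewrite mdeg1 addn0; exact: sordMr.
  by apply/sordMr/sord_slicer; rewrite mdeg1 addn0.
- have gd' := sordW (leqnSn d) gd; apply: sordB.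
    by apply: sord_slicer; rewrite mdeg1 addn0; exact: sordMl.
  by apply/sordMl/sord_slicer; rewrite mdeg1 addn0.
rewrite -[A]mpairK -[B]mpairK smonM_mpair slicerZ -!stens_smon !slicer_stens smon_coefM1 /=.
rewrite ![mono1 q == _]eq_sym; case: eqP => [->|_]; last by rewrite !scale0r mul0r scaler0 subrr.
case: eqP => [_|_]; last by rewrite !scale0r mulr0 scaler0 subrr.
by rewrite mpar1 !scale1r subrr.
Qed.

(* [eps (x) id] followed by the coefficient of a variable is a superderivation. *)
Lemma slicel_varM x (t u : T) :
  slicel (mvar p x) (t * u) = slicel (mvar p x) t * slicel (mono1 p) u
    + sigma (p x) (slicel (mono1 p) t) * slicel (mvar p x) u.
Proof.
apply/eqP; rewrite -subr_eq0; apply/eqP; move: t u.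
have sordsig d f : sord d (slicel (mono1 p) f) -> sord d (sigma (p x) (slicel (mono1 p) f)).
  exact: sord_sigma.
apply: sbilin_eq0 => [f f' g|c f g|f g g'|c f g|d f g fd|d f g gd|A B].
- by rewrite mulrDl !slicelD ?(raddfD (sigma _)) !mulrDl [X in _ - X]addrACA opprD addrACA.
- by rewrite -scalerAl !slicelZ ?sigmaZ -!scalerAl -scalerDr scalerBr.
- by rewrite mulrDr !slicelD ?(raddfD (sigma _)) !mulrDr [X in _ - X]addrACA opprD addrACA.
- by rewrite -scalerAr !slicelZ ?sigmaZ -!scalerAr -scalerDr scalerBr.
- have fd' := sordW (leqnSn d) fd; apply: sordB; last apply: sordD.
  + by apply: sord_slicel; rewrite mdeg_var addn1; exact: sordMr.
  + by apply/sordMr/sord_slicel; rewrite mdeg_var addn1.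
  + by apply/sordMr; try apply: sordsig; apply/sord_slicel; rewrite mdeg1 addn0.
- have gd' := sordW (leqnSn d) gd; apply: sordB; last apply: sordD.
  + by apply: sord_slicel; rewrite mdeg_var addn1; exact: sordMl.
  + by apply/sordMl; try apply: sordsig; apply/sord_slicel; rewrite mdeg1 addn0.
  + by apply/sordMl/sord_slicel; rewrite mdeg_var addn1.
rewrite -[A]mpairK -[B]mpairK smonM_mpair slicelZ -!stens_smon !slicel_stens scoefM_var.
set A1 := mleft A; set A2 := mright A; set B1 := mleft B; set B2 := mright B.
rewrite sigmaZ (sigma_shom _ (@shom_smon _ _ _ _)) -!scalerAl -!scalerAr !scalerA -scalerDl.
apply/eqP; rewrite subr_eq0; apply/eqP; congr (_ *: _).
rewrite mulrDr; congr (_ + _); rewrite /sconst /=.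
  case: eqP => _; rewrite ?mul0r ?mulr0 // mul1r.
  by case: eqP => [<-|_]; rewrite ?mulr0 // mpar1 andbF mulr1.
rewrite mulrCA -!mulrA; case: eqP => _; rewrite ?mul0r // !mul1r.
by case: eqP => [<-|_]; rewrite ?mulr0 // mpar_var andbC.
Qed.

(** Now the functional acts on the right: an odd variable in the right factor of [t] crosses the
    left factor of [u], so the sign falls on [u] and not on [t]. *)
Lemma slicer_varM x (t u : T) :
  slicer (mvar q x) (t * u) = slicer (mvar q x) t * sigma (q x) (slicer (mono1 q) u)
    + slicer (mono1 q) t * slicer (mvar q x) u.
Proof.
apply/eqP; rewrite -subr_eq0; apply/eqP; move: t u.
have sordsig d f : sord d (slicer (mono1 q) f) -> sord d (sigma (q x) (slicer (mono1 q) f)).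
  exact: sord_sigma.
apply: sbilin_eq0 => [f f' g|c f g|f g g'|c f g|d f g fd|d f g gd|A B].
- by rewrite mulrDl !slicerD ?(raddfD (sigma _)) !mulrDl [X in _ - X]addrACA opprD addrACA.
- by rewrite -scalerAl !slicerZ ?sigmaZ -!scalerAl -scalerDr scalerBr.
- by rewrite mulrDr !slicerD ?(raddfD (sigma _)) !mulrDr [X in _ - X]addrACA opprD addrACA.
- by rewrite -scalerAr !slicerZ ?sigmaZ -!scalerAr -scalerDr scalerBr.
- have fd' := sordW (leqnSn d) fd; apply: sordB; last apply: sordD.
  + by apply: sord_slicer; rewrite mdeg_var addn1; exact: sordMr.
  + by apply/sordMr/sord_slicer; rewrite mdeg_var addn1.
  + by apply/sordMr; try apply: sordsig; apply/sord_slicer; rewrite mdeg1 addn0.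
- have gd' := sordW (leqnSn d) gd; apply: sordB; last apply: sordD.
  + by apply: sord_slicer; rewrite mdeg_var addn1; exact: sordMl.
  + by apply/sordMl; try apply: sordsig; apply/sord_slicer; rewrite mdeg1 addn0.
  + by apply/sordMl/sord_slicer; rewrite mdeg_var addn1.
rewrite -[A]mpairK -[B]mpairK smonM_mpair slicerZ -!stens_smon !slicer_stens scoefM_var.
set A1 := mleft A; set A2 := mright A; set B1 := mleft B; set B2 := mright B.
rewrite sigmaZ (sigma_shom _ (@shom_smon _ _ _ _)) -!scalerAl -!scalerAr !scalerA -scalerDl.
apply/eqP; rewrite subr_eq0; apply/eqP; congr (_ *: _).
rewrite mulrDr; congr (_ + _); rewrite /sconst /=.
  rewrite mulrCA; case: eqP => [<-|_]; rewrite ?mul0r // !mul1r.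
  by rewrite mpar_var mulrC.
case: eqP => [<-|_]; rewrite ?mul0r ?mulr0 // mul1r mpar1.
by rewrite mul1r.
Qed.

End SliceMorphism.

(** * Matrices of power series *)

Section EvenSubring.
Variables (C : numDomainType) (G : finType) (p : pred G).
Local Notation A := (sseries C p).

Definition seven : {pred A} := fun f => spart false f == f.

Lemma sevenP f : reflect (shom false f) (f \in seven).
Proof.
apply: (iffP eqP) => [<-|fe]; first exact: shom_spart.
by rewrite (spart_shom _ fe) eqxx.
Qed.

Fact seven_subring : subring_closed seven.
Proof.
split=> [|f g /sevenP fe /sevenP ge|f g /sevenP fe /sevenP ge]; apply/sevenP.
- exact: shom1.
- exact: shomB.
- by rewrite -[false]/(false (+) false); apply: shomM.
Qed.
HB.instance Definition _ := GRing.isSubringClosed.Build A seven seven_subring.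

(** A commutative ring, over which determinants are multiplicative and invariant under
    transposition; matrices with even entries are lifted to it and mapped back by [val]. *)
Record evseries := EvSeries { evval : A; evvalP : evval \in seven }.
HB.instance Definition _ := [isSub for evval].
HB.instance Definition _ := [Choice of evseries by <:].
HB.instance Definition _ := [SubChoice_isSubNzRing of evseries by <:].
Fact evmulC : commutative (@GRing.mul evseries).
Proof.
move=> f g; apply: val_inj; rewrite !rmorphM /=.
by apply: smul_evenC; apply/sevenP/evvalP.
Qed.
HB.instance Definition _ := GRing.PzRing_hasCommutativeMul.Build evseries evmulC.

Lemma evval_hom (f : evseries) : shom false (val f).
Proof. exact/sevenP/evvalP. Qed.

End EvenSubring.

Section GradedMatrices.
Variables (C : numDomainType) (G : finType) (p : pred G).
Local Notation A := (sseries C p).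

Definition gradedmx a b (q : pred 'I_a) (r : pred 'I_b) (M : 'M[A]_(a, b)) :=
  forall i j, shom (q i (+) r j) (M i j).

Notation evenmx := (gradedmx xpred0 xpred0).

Lemma gradedmx1 a (q : pred 'I_a) : gradedmx q q 1%:M.
Proof.
move=> i j; rewrite mxE; case: eqP => [->|_]; last exact: shom0.
by rewrite addbb; exact: shom1.
Qed.

Lemma gradedmx0 a b (q : pred 'I_a) (r : pred 'I_b) : gradedmx q r 0.
Proof. by move=> i j; rewrite mxE; exact: shom0. Qed.

Lemma gradedmxD a b (q : pred 'I_a) (r : pred 'I_b) M N :
  gradedmx q r M -> gradedmx q r N -> gradedmx q r (M + N).
Proof. by move=> Mq Nq i j; rewrite mxE; apply: shomD. Qed.

Lemma gradedmxN a b (q : pred 'I_a) (r : pred 'I_b) M :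
  gradedmx q r M -> gradedmx q r (- M).
Proof. by move=> Mq i j; rewrite mxE; apply: shomN. Qed.

Lemma gradedmxM a b c (q : pred 'I_a) (r : pred 'I_b) (s : pred 'I_c) M N :
  gradedmx q r M -> gradedmx r s N -> gradedmx q s (M *m N).
Proof.
move=> Mq Nr i j; rewrite mxE; apply: shom_sum => k _.
have := shomM (Mq i k) (Nr k j); rewrite addbA.
by rewrite -[_ (+) r k (+) r k]addbA addbb addbF.
Qed.

Lemma evenmx_lift a b (M : 'M[A]_(a, b)) : evenmx M ->
  exists M' : 'M[evseries C p]_(a, b), M = map_mx val M'.
Proof.
move=> Me; exists (\matrix_(i, j) insubd 0 (M i j)).
by apply/matrixP => i j; rewrite !mxE insubdK //; apply/sevenP; exact: Me.
Qed.

Lemma det_evenmx a (M : 'M[A]_a) : evenmx M -> shom false (\det M).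
Proof. by case/evenmx_lift => M' ->; rewrite det_map_mx; exact: evval_hom. Qed.

Lemma det_evenmx1 a : \det (1%:M : 'M[A]_a) = 1.
Proof. by rewrite -(map_mx1 (val : evseries C p -> A)) det_map_mx det1 rmorph1. Qed.

Lemma det_evenmxM a (M N : 'M[A]_a) : evenmx M -> evenmx N ->
  \det (M *m N) = \det M * \det N.
Proof.
case/evenmx_lift => M' -> /evenmx_lift[N' ->].
by rewrite -map_mxM !det_map_mx det_mulmx rmorphM.
Qed.

Lemma det_evenmx_tr a (M : 'M[A]_a) : evenmx M -> \det M^T = \det M.
Proof. by case/evenmx_lift => M' ->; rewrite map_trmx !det_map_mx det_tr. Qed.

Lemma trmx_evenmxM a (M N : 'M[A]_a) : evenmx M -> evenmx N -> (M *m N)^T = N^T *m M^T.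
Proof.
case/evenmx_lift => M' -> /evenmx_lift[N' ->].
by rewrite -map_mxM !map_trmx trmx_mul map_mxM.
Qed.

(** The cofactors along row [i] involve only the other rows, hence are those of the identity. *)
Lemma det_row'1 (R : comNzRingType) a (M : 'M[R]_a) i :
  row' i M = row' i 1%:M -> \det M = M i i.
Proof.
move=> Mi; have cofE l : cofactor M i l = (l == i)%:R.
  transitivity (cofactor (1%:M : 'M[R]_a) i l).
    rewrite /cofactor; congr (_ * \det _); apply/matrixP => k k'; rewrite !mxE.
    by have /matrixP/(_ k (lift l k')) := Mi; rewrite !mxE.
  by have /matrixP/(_ l i) := adj1 R a; rewrite !mxE.
rewrite (expand_det_row M i) (bigD1 i) //= cofE eqxx mulr1 big1 ?addr0 // => l li.
by rewrite cofE (negPf li) mulr0.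
Qed.

Lemma det_evenmx_row'1 a (M : 'M[A]_a) i : evenmx M ->
  (forall k l, k != i -> M k l = (k == l)%:R) -> \det M = M i i.
Proof.
case/evenmx_lift => M' -> Mi; rewrite det_map_mx (det_row'1 (i := i)) ?mxE //.
apply/matrixP => k l; rewrite !mxE; apply: val_inj.
by have := Mi (lift i k) l; rewrite !mxE eq_sym neq_lift => ->; rewrite // rmorph_nat.
Qed.

Lemma mx_inv_eq (R : pzRingType) a (M N : 'M[R]_a) :
  M *m N = 1%:M -> N *m M = 1%:M -> mx_inv M = N.
Proof.
move=> MN NM; rewrite /mx_inv; case: xgetP => [N' _ [MN' N'M]|/(_ N)]; last by case.
by rewrite -[N']mulmx1 -MN mulmxA N'M mul1mx.
Qed.

Lemma ring_inv_eq (R : pzRingType) (x y : R) : x * y = 1 -> y * x = 1 -> ring_inv x = y.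
Proof.
move=> xy yx; rewrite /ring_inv; case: xgetP => [z _ [xz zx]|/(_ y)]; last by case.
by rewrite -[z]mulr1 -xy mulrA zx mul1r.
Qed.

Definition sordmx d a b (M : 'M[A]_(a, b)) := forall i j, sord d (M i j).

Lemma sordmxM d d' a b c (M : 'M[A]_(a, b)) (N : 'M[A]_(b, c)) :
  sordmx d M -> sordmx d' N -> sordmx (d + d') (M *m N).
Proof. by move=> Md Nd i j; rewrite mxE; apply: sord_sum => k _; apply: sordM. Qed.

Lemma sordmxX a (M : 'M[A]_a) k : sordmx 1 M -> sordmx k (M ^+ k).
Proof.
move=> M1; elim: k => [|k IH]; first by move=> i j.
by rewrite exprS -add1n; apply: sordmxM.
Qed.

Lemma sordmx_eq a b (M N : 'M[A]_(a, b)) : (forall d, sordmx d (M - N)) -> M = N.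
Proof.
move=> MN; apply/matrixP => i j; apply/eqP; rewrite -subr_eq0; apply/eqP.
by apply: sord_eq0 => d; have := MN d i j; rewrite !mxE.
Qed.

(** The inverse is the geometric series in [P = 1 - M], whose powers have increasing order. *)
Lemma mx_inv_exists a (M : 'M[A]_a) : map_mx sconst M = 1%:M ->
  exists N, [/\ M *m N = 1%:M, N *m M = 1%:M & map_mx sconst N = 1%:M].
Proof.
move=> M1; pose P := 1%:M - M.
have P1 : sordmx 1 P.
  move=> i j; apply: sord1; have /matrixP/(_ i j) := M1.
  by rewrite !mxE raddfB /= => ->; rewrite rmorph_nat subrr.
have MP : M = 1 - P by rewrite opprB addrC subrK.
clearbody P; rewrite {M}MP in M1 *.
pose S d : 'M[A]_a := \sum_(0 <= k < d) P ^+ k.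
(* Powers of [P] beyond the degree of [X] do not reach the coefficient of [X], which is therefore
   read off a partial sum of suitable length. *)
pose N : 'M[A]_a := \matrix_(i, j) SSeries (fun X => S (mdeg X).+1 i j X).
have NS d : sordmx d (N - S d).
  move=> i j X Xd; rewrite !mxE scoefB /=.
  rewrite [S d](_ : _ = S (mdeg X).+1 + \sum_((mdeg X).+1 <= k < d) P ^+ k); last first.
    by rewrite /S -big_cat_nat.
  rewrite !mxE scoefD opprD addrA subrr add0r summxE scoef_sum big_nat big1 ?oppr0 //.
  by move=> k /andP[Xk _]; exact: sordmxX.
have SP d : (1 - P) * S d = 1 - P ^+ d.
  by rewrite -[1 - P ^+ d]opprB -[1 - P]opprB mulNr /S big_mkord -subrX1.
have PS d : S d * (1 - P) = 1 - P ^+ d.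
  rewrite -SP; apply: commrB; first exact/commr1.
  by apply/commr_sym; rewrite /S; apply: commr_sum => k _; apply/commrX.
have MN : (1 - P) *m N = 1%:M.
  apply: sordmx_eq => d.
  have -> : (1 - P) *m N - 1%:M = (1 - P) *m (N - S d) - P ^+ d.
    by rewrite mulmxBr [_ *m S d]SP opprD opprK addrA addrK.
  move=> i j; rewrite mxE [X in _ + X]mxE; apply: sordB; last exact: sordmxX.
  exact: (@sordmxM 0).
have NM : N *m (1 - P) = 1%:M.
  apply: sordmx_eq => d.
  have -> : N *m (1 - P) - 1%:M = (N - S d) *m (1 - P) - P ^+ d.
    by rewrite mulmxBl [S d *m _]PS opprD opprK addrA addrK.
  move=> i j; rewrite mxE [X in _ + X]mxE; apply: sordB; last exact: sordmxX.
  by have := sordmxM (NS d) (_ : sordmx 0 (1 - P)); rewrite addn0; apply.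
exists N; split=> //; have := congr1 (map_mx sconst) MN.
by rewrite map_mxM M1 mul1mx map_mx1.
Qed.

Lemma ring_inv_exists (x : A) : sconst x = 1 -> exists y, x * y = 1 /\ y * x = 1.
Proof.
move=> x1; have [|N [xN Nx _]] := @mx_inv_exists 1 x%:M.
  by apply/matrixP => i j; rewrite !ord1 !mxE eqxx.
exists (N 0 0); split.
  by have /matrixP/(_ 0 0) := xN; rewrite !mxE big_ord1 !mxE !eqxx.
by have /matrixP/(_ 0 0) := Nx; rewrite !mxE big_ord1 !mxE !eqxx.
Qed.

Lemma sigma_fixed (e : bool) (f : A) : sigma true f = (-1) ^+ e *: f -> shom e f.
Proof.
move=> fe M Me; have /(congr1 (fun g : A => g M)) := fe.
rewrite sigmaE scoefZ /=; case: e (mpar M) Me {fe} => [] [] //= _.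
  by rewrite mul1r mulN1r => /eqP; rewrite -addr_eq0 -mulr2n mulrn_eq0 => /eqP.
by rewrite mul1r mulN1r => /eqP; rewrite eq_sym -addr_eq0 -mulr2n mulrn_eq0 => /eqP.
Qed.

(* The inverse is the only one, hence equals its conjugate by the sign
   automorphism. *)
Lemma gradedmx_inv a (q : pred 'I_a) (M N : 'M[A]_a) : gradedmx q q M ->
  M *m N = 1%:M -> N *m M = 1%:M -> gradedmx q q N.
Proof.
move=> Mq MN NM.
pose N' : 'M[A]_a := \matrix_(i, j) ((-1) ^+ (q i (+) q j) *: sigma true (N i j)).
have MN' : M *m N' = 1%:M.
  apply/matrixP => i j; rewrite !mxE.
  transitivity ((-1) ^+ (q i (+) q j) *: sigma true ((M *m N) i j)).
    rewrite mxE raddf_sum scaler_sumr; apply: eq_bigr => k _ /=.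
    rewrite mxE rmorphM /= (sigma_shom _ (Mq i k)) -scalerAl -scalerAr scalerA.
    by congr (_ *: _); rewrite -signr_addb; case: (q i); case: (q j); case: (q k).
  rewrite MN mxE; case: eqP => [->|_]; last by rewrite rmorph0 scaler0.
  by rewrite addbb rmorph1 scale1r.
have NN : N = N' by rewrite -[N]mulmx1 -MN' mulmxA NM mul1mx.
move=> i j; apply: sigma_fixed; rewrite [in RHS]NN mxE scalerA -signr_addb addbb.
by rewrite scale1r.
Qed.

End GradedMatrices.
Notation evenmx := (gradedmx xpred0 xpred0).

(** * The superdeterminant *)

Lemma ipar_lshift m n (i : 'I_m) : ipar (lshift n i) = false.
Proof. by rewrite /ipar /= leqNgt ltn_ord. Qed.

Lemma ipar_rshift m n (i : 'I_n) : ipar (rshift m i) = true.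
Proof. by rewrite /ipar /= leq_addr. Qed.

Section Superdeterminant.
Variables (K : numDomainType) (G : finType) (p : pred G) (m n : nat).
Local Notation R := (sseries K p).
Local Notation ip := (@ipar m n).

(** Points of the formal neighbourhood of the identity in [GL(m|n)]; the condition on constant terms
    makes the diagonal blocks and their determinants invertible. *)
Definition gmx (M : 'M[R]_(m + n)) := gradedmx ip ip M /\ map_mx sconst M = 1%:M.

Lemma gmx1 : gmx 1%:M.
Proof. by split; [exact: gradedmx1|rewrite map_mx1]. Qed.

Lemma gmxM M N : gmx M -> gmx N -> gmx (M *m N).
Proof.
move=> [Mg M1] [Ng N1]; split; first exact: gradedmxM Mg Ng.
by rewrite map_mxM M1 N1 mulmx1.
Qed.

Lemma gmx_inv M : gmx M -> exists2 N, gmx N & M *m N = 1%:M /\ N *m M = 1%:M.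
Proof.
move=> [Mg /mx_inv_exists[N [MN NM N1]]]; exists N; split=> //.
exact: gradedmx_inv Mg MN NM.
Qed.

Lemma shom_inv (x y : R) : shom false x -> x * y = 1 -> y * x = 1 -> shom false y.
Proof.
move=> x0 xy yx; have xM : evenmx (x%:M : 'M_1) by move=> i j; rewrite !ord1 mxE eqxx.
have /(_ 0 0) : evenmx (y%:M : 'M_1).
  by apply: (gradedmx_inv xM); rewrite -scalar_mxM ?xy ?yx.
by rewrite mxE eqxx.
Qed.

Lemma gmx_block A B C D : evenmx A -> gradedmx xpred0 xpredT B ->
  gradedmx xpredT xpred0 C -> evenmx D ->
  map_mx sconst A = 1%:M -> map_mx sconst D = 1%:M -> gmx (block_mx A B C D).
Proof.
move=> Ae Bo Co De A1 D1; split.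
  move=> i j; case: (split_ordP i) => k ->; case: (split_ordP j) => l ->;
  rewrite ?ipar_lshift ?ipar_rshift ?block_mxEul ?block_mxEur ?block_mxEdl ?block_mxEdr.
  - exact: Ae.
  - exact: Bo.
  - exact: Co.
  - exact: De.
rewrite map_block_mx A1 D1 scalar_mx_block; congr block_mx; apply/matrixP => i j; rewrite !mxE.
  by apply: sconst_odd; exact: Bo.
by apply: sconst_odd; exact: Co.
Qed.

(** [D'] and [d] are the two inverses occurring in [sdet]; with this view in hand, computations no
    longer meet [mx_inv] and [ring_inv]. *)
Variant gmx_spec (M : 'M[R]_(m + n)) : Prop := GmxSpec A B C D D' d of
  M = block_mx A B C D & [/\ evenmx A, gradedmx xpred0 xpredT B,
  gradedmx xpredT xpred0 C & evenmx D] & map_mx sconst A = 1%:M /\ map_mx sconst D = 1%:M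
  & [/\ D *m D' = 1%:M, D' *m D = 1%:M & evenmx D']
  & [/\ \det D * d = 1, d * \det D = 1 & shom false d].

Lemma gmxP M : gmx M -> gmx_spec M.
Proof.
move=> [Mg M1].
have Ae : evenmx (ulsubmx M).
  by move=> i j; have := Mg (lshift n i) (lshift n j); rewrite !mxE !ipar_lshift.
have Bo : gradedmx xpred0 xpredT (ursubmx M).
  by move=> i j; have := Mg (lshift n i) (rshift m j); rewrite !mxE ipar_lshift ipar_rshift.
have Co : gradedmx xpredT xpred0 (dlsubmx M).
  by move=> i j; have := Mg (rshift m i) (lshift n j); rewrite !mxE ipar_lshift ipar_rshift.
have De : evenmx (drsubmx M).
  by move=> i j; have := Mg (rshift m i) (rshift m j); rewrite !mxE !ipar_rshift.
have A1 : map_mx sconst (ulsubmx M) = 1%:M.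
  apply/matrixP => i j; have /matrixP/(_ (lshift n i) (lshift n j)) := M1.
  by rewrite !mxE (inj_eq (@lshift_inj _ _)).
have D1 : map_mx sconst (drsubmx M) = 1%:M.
  apply/matrixP => i j; have /matrixP/(_ (rshift m i) (rshift m j)) := M1.
  by rewrite !mxE (inj_eq (@rshift_inj _ _)).
have [D' [DD' D'D D'1]] := mx_inv_exists D1.
have [|d [Dd dD]] := @ring_inv_exists _ _ _ (\det (drsubmx M)).
  by rewrite -det_map_mx D1 det1.
apply: (@GmxSpec M (ulsubmx M) (ursubmx M) (dlsubmx M) (drsubmx M) D' d) => //; first by rewrite submxK.
- by split=> //; exact: gradedmx_inv De DD' D'D.
- by split=> //; exact: shom_inv (det_evenmx De) Dd dD.
Qed.

Lemma sdet_block A B C D D' (d : R) : D *m D' = 1%:M -> D' *m D = 1%:M ->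
  \det D * d = 1 -> d * \det D = 1 ->
  sdet (block_mx A B C D : 'M_(m + n)) = \det (A - B *m D' *m C) * d.
Proof.
move=> DD' D'D Dd dD; rewrite /sdet block_mxKul block_mxKur block_mxKdl block_mxKdr.
by rewrite (mx_inv_eq DD' D'D) (ring_inv_eq Dd dD).
Qed.

Lemma evenmx_schur (A : 'M[R]_m) (B : 'M_(m, n)) (C : 'M_(n, m)) (D : 'M_n) : evenmx A ->
  gradedmx xpred0 xpredT B -> gradedmx xpredT xpred0 C -> evenmx D ->
  evenmx (A - B *m D *m C).
Proof.
move=> Ae Bo Co De; apply: gradedmxD => //; apply: gradedmxN.
by apply: gradedmxM Co; apply: gradedmxM Bo _ => i j; exact: De.
Qed.

Lemma shom_sdet M : gmx M -> shom false (sdet M).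
Proof.
case/gmxP => A B C D D' d -> [Ae Bo Co De] _ [DD' D'D D'e] [Dd dD d0].
rewrite (sdet_block _ _ _ DD' D'D Dd dD) -[false]/(false (+) false).
by apply: shomM => //; apply/det_evenmx/evenmx_schur.
Qed.

Lemma sconst_sdet M : gmx M -> sconst (sdet M) = 1.
Proof.
case/gmxP => A B C D D' d -> [Ae Bo Co De] [A1 D1] [DD' D'D D'e] [Dd dD d0].
rewrite (sdet_block _ _ _ DD' D'D Dd dD) rmorphM /= -det_map_mx map_mxB A1 !map_mxM.
have -> : map_mx sconst B = 0.
  by apply/matrixP => i j; rewrite !mxE; apply: sconst_odd; exact: Bo.
rewrite !mul0mx subr0 det1 mul1r; have := congr1 sconst Dd.
by rewrite rmorphM rmorph1 -det_map_mx D1 det1 mul1r.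
Qed.

Definition diagmx (P : 'M[R]_m) (Q : 'M[R]_n) : 'M_(m + n) := block_mx P 0 0 Q.
Definition umx (B : 'M[R]_(m, n)) : 'M_(m + n) := block_mx 1%:M B 0 1%:M.
Definition lmx (C : 'M[R]_(n, m)) : 'M_(m + n) := block_mx 1%:M 0 C 1%:M.

(** Block Gauss elimination with pivot [D]: the upper left block of the middle factor is the Schur
    complement entering [sdet]. *)
Lemma gmx_UDL M : gmx M -> exists B P Q C, [/\
  M = umx B *m (diagmx P Q *m lmx C),
  gradedmx xpred0 xpredT B, gradedmx xpredT xpred0 C & gmx (diagmx P Q)].
Proof.
case/gmxP => A B C D D' d -> [Ae Bo Co De] [A1 D1] [DD' D'D D'e] [Dd dD d0].
exists (B *m D'), (A - B *m D' *m C), D, (D' *m C).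
have BD'o : gradedmx xpred0 xpredT (B *m D') by apply: gradedmxM Bo _ => i j; exact: D'e.
split=> //.
- rewrite /umx /diagmx /lmx !mulmx_block !mul0mx !mulmx0 !mulmx1 !mul1mx !addr0 !add0r.
  by rewrite -!(mulmxA _ D' D) D'D mulmx1 !(mulmxA D) DD' mul1mx subrK.
- by apply: (gradedmxM (r := xpredT) _ Co) => i j; exact: D'e.
apply: gmx_block => //; try exact: gradedmx0; first exact: evenmx_schur.
rewrite map_mxB A1 !map_mxM.
have -> : map_mx sconst B = 0.
  by apply/matrixP => i j; rewrite !mxE; apply: sconst_odd; exact: Bo.
by rewrite !mul0mx subr0.
Qed.

Lemma gmx_umx B : gradedmx xpred0 xpredT B -> gmx (umx B).
Proof.
move=> Bo; apply: gmx_block => //; rewrite ?map_mx1 //; try exact: gradedmx1.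
exact: gradedmx0.
Qed.

Lemma gmx_lmx C : gradedmx xpredT xpred0 C -> gmx (lmx C).
Proof.
move=> Co; apply: gmx_block => //; rewrite ?map_mx1 //; try exact: gradedmx1.
exact: gradedmx0.
Qed.

Lemma sdet_umxl B M : gmx M -> sdet (umx B *m M) = sdet M.
Proof.
case/gmxP => A B' C D D' d -> _ _ [DD' D'D _] [Dd dD _].
rewrite /umx mulmx_block !mul0mx !mul1mx !add0r !(sdet_block _ _ _ DD' D'D Dd dD).
rewrite mulmxDl mulmxDl -(mulmxA B D D') DD' mulmx1 opprD addrACA.
by rewrite addrN addr0.
Qed.

Lemma sdet_lmxr C M : gmx M -> sdet (M *m lmx C) = sdet M.
Proof.
case/gmxP => A B C' D D' d -> _ _ [DD' D'D _] [Dd dD _].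
rewrite /lmx mulmx_block !mulmx0 !mulmx1 !add0r !(sdet_block _ _ _ DD' D'D Dd dD).
rewrite mulmxDr (mulmxA _ D C) -(mulmxA B D' D) D'D mulmx1 opprD.
by rewrite addrACA addrN addr0.
Qed.

Lemma sdet_diagmxl P Q M : gmx (diagmx P Q) -> gmx M ->
  sdet (diagmx P Q *m M) = sdet (diagmx P Q) * sdet M.
Proof.
move=> /gmxP[P0 B0 C0 Q0 Q' q E]; move: E => /eq_block_mx[<- <- <- <-].
move=> [Pe _ _ Qe] _ [QQ' Q'Q Q'e] [Qq qQ q0].
case/gmxP => A B C D D' d -> [Ae Bo Co De] _ [DD' D'D D'e] [Dd dD d0].
rewrite /diagmx mulmx_block !mul0mx !addr0 !add0r.
rewrite (sdet_block _ _ _ DD' D'D Dd dD) (sdet_block _ _ _ QQ' Q'Q Qq qQ).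
rewrite !mul0mx subr0 (@sdet_block _ _ _ _ (D' *m Q') (q * d)).
- rewrite -!mulmxA !(mulmxA Q') Q'Q mul1mx -mulmxBr det_evenmxM //; last first.
    by rewrite mulmxA; exact: evenmx_schur.
  rewrite -!mulrA; congr (_ * _); rewrite !mulrA; congr (_ * _).
  by rewrite (smul_evenC _ q0).
- by rewrite mulmxA -(mulmxA Q) DD' mulmx1.
- by rewrite mulmxA -(mulmxA D') Q'Q mulmx1.
- by rewrite det_evenmxM // (smul_evenC _ d0) mulrA -(mulrA _ _ d) Dd mulr1.
- by rewrite det_evenmxM // (smul_evenC _ d0) mulrA -(mulrA d) qQ mulr1.
Qed.

Lemma sdet_umx B : sdet (umx B) = 1.
Proof.
by rewrite (@sdet_block _ _ _ _ 1%:M 1) ?mulmx1 ?mulr1 ?mul1r // ?mulmx0 ?subr0 det_evenmx1.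
Qed.

Lemma sdet_lmx C : sdet (lmx C) = 1.
Proof.
by rewrite (@sdet_block _ _ _ _ 1%:M 1) ?mulmx1 ?mulr1 ?mul1r // ?mul0mx ?subr0 det_evenmx1.
Qed.

Lemma sdet1 : sdet (1%:M : 'M[R]_(m + n)) = 1.
Proof. by rewrite scalar_mx_block; exact: (sdet_umx 0). Qed.

(* For an elementary [b] one has [b C b = 0], so that both determinants are
   those of rank one perturbations of the identity. *)
Lemma sdet_lmx_umx_delta C (x : R) i j : gradedmx xpredT xpred0 C -> shom true x ->
  sdet (lmx C *m umx (x *: delta_mx i j)) = 1.
Proof.
move=> Co xo; set b := x *: delta_mx i j.
have bE k l : b k l = if (k == i) && (l == j) then x else 0.
  by rewrite !mxE; case: ifP => _; rewrite ?mulr1n ?mulr0n ?mulr1 ?mulr0.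
have bCE k l : (b *m C) k l = if k == i then x * C j l else 0.
  rewrite mxE (bigD1 j) //= big1 ?addr0 => [|r rj]; last first.
    by rewrite bE (negPf rj) andbF mul0r.
  by rewrite bE eqxx andbT; case: ifP => //; rewrite mul0r.
have CbE k l : (C *m b) k l = if l == j then C k i * x else 0.
  rewrite mxE (bigD1 i) //= big1 ?addr0 => [|r ri]; last first.
    by rewrite bE (negPf ri) mulr0.
  by rewrite bE eqxx /=; case: ifP => //; rewrite mulr0.
have bCb : b *m C *m b = 0.
  apply/matrixP => k l; rewrite !mxE big1 // => r _; rewrite bCE bE.
  case: ifP => _; last by rewrite mul0r.
  case: ifP => _; last by rewrite mulr0.
  by rewrite -mulrA (smul_shomC (Co _ _) xo) -scalerAr mulrA shom_sqr0 // mul0r scaler0.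
(* This sign makes the two rank one determinants below equal, so that their quotient is 1. *)
have xC : x * C j i = - (C j i * x).
  by rewrite (smul_shomC xo (Co j i)) expr1 scaleN1r.
have bo : gradedmx xpred0 xpredT b.
  by move=> k l; rewrite bE; case: ifP => _ //; exact: shom0.
have D1 : evenmx (1%:M + C *m b).
  apply: gradedmxD; first exact: gradedmx1.
  exact: (gradedmxM Co bo).
have A1 : evenmx (1%:M - b *m C).
  apply: gradedmxD; first exact: gradedmx1.
  by apply: gradedmxN; exact: (gradedmxM bo Co).
have detD : \det (1%:M + C *m b) = 1 + C j i * x.
  rewrite -det_evenmx_tr // (@det_evenmx_row'1 _ _ _ _ _ j).
  - by rewrite mxE mxE CbE eqxx mxE eqxx.
  - by move=> k l; rewrite mxE; exact: D1.
  by move=> k l kj; rewrite mxE mxE CbE (negPf kj) addr0 mxE eq_sym.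
have detA : \det (1%:M - b *m C) = 1 + C j i * x.
  rewrite (@det_evenmx_row'1 _ _ _ _ _ i) //.
    by rewrite mxE [X in _ + X]mxE bCE eqxx xC opprK mxE eqxx.
  by move=> k l ki; rewrite mxE [X in _ + X]mxE bCE (negPf ki) oppr0 addr0 mxE.
have [|d [Dd dD]] := @ring_inv_exists _ _ _ (\det (1%:M + C *m b)).
  rewrite detD rmorphD rmorph1 rmorphM /= (_ : sconst (C j i) = 0) ?mul0r ?addr0 //.
  by apply: sconst_odd; exact: Co.
rewrite /lmx /umx mulmx_block !mul0mx !mulmx1 !mul1mx !addr0 addrC.
(* Since [b C b = 0], the matrix [C b] squares to zero and [1 - C b] inverts the lower right block;
   for the same reason the Schur complement reduces to [1 - b C]. *)
rewrite (@sdet_block _ _ _ _ (1%:M - C *m b) d) //.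
- by rewrite mulmxBr mulmx1 mulmxA bCb subr0 detA -detD.
- by rewrite mulmxBr mulmx1 mulmxDl mul1mx -(mulmxA C) (mulmxA b C b) bCb mulmx0 addr0 addrK.
- by rewrite mulmxDr mulmx1 mulmxBl mul1mx -(mulmxA C) (mulmxA b C b) bCb mulmx0 subr0 subrK.
Qed.

(** The property passes to products of right factors, so by [gmx_UDL] it has to be checked only on
    unipotent and block diagonal ones. *)
Definition sdet_multr t := forall g, gmx g -> sdet (g *m t) = sdet g * sdet t.

Lemma sdet_multrM s t : gmx s -> sdet_multr s -> sdet_multr t -> sdet_multr (s *m t).
Proof.
move=> sg sm tm g gg; rewrite mulmxA (tm _ (gmxM gg sg)) (sm _ gg) (tm _ sg).
by rewrite mulrA.
Qed.

(** Decomposing [g] and stripping off its upper and diagonal factors on the left leaves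
    [lmx C *m umx b], which [sdet_lmx_umx_delta] settles. *)
Lemma sdet_multr_umx_delta (x : R) i j : shom true x -> sdet_multr (umx (x *: delta_mx i j)).
Proof.
move=> xo g /gmx_UDL[B [P [Q [C [-> Bo Co PQ]]]]]; set b := x *: _.
have bg : gmx (umx b).
  apply: gmx_umx => k l; rewrite !mxE; case: (_ && _); rewrite ?mulr1n ?mulr0n ?mulr1 ?mulr0; [exact: xo|exact: shom0].
have Cg := gmx_lmx Co.
rewrite sdet_umx mulr1 -!mulmxA.
rewrite (sdet_umxl _ (gmxM PQ (gmxM Cg bg))) (sdet_umxl _ (gmxM PQ Cg)).
rewrite (sdet_diagmxl PQ (gmxM Cg bg)) (sdet_diagmxl PQ Cg).
by rewrite sdet_lmx_umx_delta // sdet_lmx.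
Qed.

Lemma umxD B B' : umx (B + B') = umx B *m umx B'.
Proof.
by rewrite /umx mulmx_block !mul0mx !mulmx0 !mulmx1 !mul1mx !addr0 add0r addrC.
Qed.

(** [umx] turns sums into products, so an arbitrary odd block is assembled from elementary ones. *)
Lemma sdet_multr_umx B : gradedmx xpred0 xpredT B -> sdet_multr (umx B).
Proof.
move=> Bo; rewrite [B]matrix_sum_delta.
suff : (gmx (umx (\sum_i \sum_j B i j *: delta_mx i j)) /\
  sdet_multr (umx (\sum_i \sum_j B i j *: delta_mx i j))) by case.
pose T (N : 'M[R]_(m, n)) := gmx (umx N) /\ sdet_multr (umx N).
have TD N N' : T N -> T N' -> T (N + N').
  by move=> [gN mN] [gN' mN']; rewrite /T umxD; split; [exact: gmxM|exact: sdet_multrM].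
have T0 : T 0.
  rewrite /T /umx -scalar_mx_block; split; first exact: gmx1.
  by move=> g _; rewrite mulmx1 sdet1 mulr1.
apply: (big_ind T T0 TD) => i _; apply: (big_ind T T0 TD) => j _; split.
  apply: gmx_umx => k l; rewrite !mxE; case: (_ && _); rewrite ?mulr1n ?mulr0n ?mulr1 ?mulr0; [exact: Bo|exact: shom0].
by apply: sdet_multr_umx_delta; exact: Bo.
Qed.

Lemma sdet_multr_diagmx P Q : gmx (diagmx P Q) -> sdet_multr (diagmx P Q).
Proof.
move=> /gmxP[P0 B0 C0 Q0 Q' q E]; move: E => /eq_block_mx[<- <- <- <-].
move=> [Pe _ _ Qe] _ [QQ' Q'Q Q'e] [Qq qQ q0] g.
case/gmxP => A B C D D' d -> [Ae Bo Co De] _ [DD' D'D D'e] [Dd dD d0].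
rewrite /diagmx mulmx_block !mulmx0 !addr0 !add0r.
rewrite (sdet_block _ _ _ DD' D'D Dd dD) (sdet_block _ _ _ QQ' Q'Q Qq qQ).
rewrite !mul0mx subr0 (@sdet_block _ _ _ _ (Q' *m D') (q * d)).
- rewrite !mulmxA -(mulmxA B Q Q') QQ' mulmx1 -mulmxBl det_evenmxM //; last first.
    exact: evenmx_schur.
  rewrite -!mulrA; congr (_ * _); rewrite !mulrA (smul_evenC d) //; last exact: det_evenmx.
  by rewrite -!mulrA (smul_evenC _ q0).
- by rewrite mulmxA -(mulmxA D) QQ' mulmx1.
- by rewrite mulmxA -(mulmxA Q') D'D mulmx1.
- by rewrite det_evenmxM // mulrA -(mulrA _ _ q) Qq mulr1.
- by rewrite det_evenmxM // mulrA -(mulrA q) dD mulr1.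
Qed.

Lemma sdetM g t : gmx g -> gmx t -> sdet (g *m t) = sdet g * sdet t.
Proof.
move=> gg /gmx_UDL[B [P [Q [C [-> Bo Co PQ]]]]].
have Ug := gmx_umx Bo; have Lg := gmx_lmx Co.
apply: sdet_multrM => //; first exact: sdet_multr_umx.
apply: sdet_multrM => //; first exact: sdet_multr_diagmx.
by move=> h hg; rewrite sdet_lmxr // sdet_lmx mulr1.
Qed.

(** The supertranspose, with the sign convention of the star operation. *)
Definition stmx (M : 'M[R]_(m + n)) : 'M[R]_(m + n) :=
  \matrix_(i, j) ((-1) ^+ ((ip i (+) ip j) && ip j) * M j i).

Lemma stmx_block A B C D : stmx (block_mx A B C D) = block_mx A^T (- C^T) B^T D^T.
Proof.
apply/matrixP => i j; rewrite mxE; case: (split_ordP i) => k ->; case: (split_ordP j) => l ->;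
rewrite ?ipar_lshift ?ipar_rshift ?block_mxEul ?block_mxEur ?block_mxEdl ?block_mxEdr;
by rewrite !mxE ?mul1r // expr1 mulN1r.
Qed.

(** The sign in the block [- C^T] is cancelled by the exchange of the odd entries of [C] and [B], so
    the new Schur complement is the transpose of the old one. *)
Lemma sdet_stmx M : gmx M -> sdet (stmx M) = sdet M.
Proof.
case/gmxP => A B C D D' d -> [Ae Bo Co De] _ [DD' D'D D'e] [Dd dD d0].
rewrite stmx_block (sdet_block _ _ _ DD' D'D Dd dD) (@sdet_block _ _ _ _ D'^T d).
- congr (_ * _); rewrite -[RHS]det_evenmx_tr; last exact: evenmx_schur.
  rewrite mulNmx mulNmx opprK raddfB /=; congr (\det (_ + _)).
  apply/matrixP => i j; rewrite !mxE -sumrN.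
  transitivity (\sum_k \sum_l C l i * D' k l * B j k).
    apply: eq_bigr => k _; rewrite !mxE mulr_suml; apply: eq_bigr => l _.
    by rewrite !mxE.
  rewrite exchange_big /=; apply: eq_bigr => l _; rewrite mxE mulr_suml -sumrN.
  apply: eq_bigr => k _; rewrite (smul_evenC (C l i) (D'e k l)).
  rewrite (smul_evenC (B j k) (D'e k l)) -!mulrA (smul_shomC (Co l i) (Bo j k)).
  by rewrite expr1 scaleN1r mulrN.
- by rewrite -trmx_evenmxM // D'D trmx1.
- by rewrite -trmx_evenmxM // DD' trmx1.
- by rewrite det_evenmx_tr.
- by rewrite det_evenmx_tr.
Qed.
End Superdeterminant.

Lemma sdet_map (K K' : numDomainType) (G G' : finType) (p : pred G) (q : pred G') m n
    (phi : {rmorphism sseries K p -> sseries K' q}) (M : 'M_(m + n)) :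
  gmx M -> phi (sdet M) = sdet (map_mx phi M).
Proof.
case/gmxP => A B C D D' d -> _ _ [DD' D'D _] [Dd dD _].
rewrite map_block_mx (sdet_block _ _ _ DD' D'D Dd dD).
rewrite (@sdet_block _ _ _ _ _ _ _ _ _ (map_mx phi D') (phi d)).
- by rewrite rmorphM -det_map_mx map_mxB !map_mxM.
- by rewrite -map_mxM DD' map_mx1.
- by rewrite -map_mxM D'D map_mx1.
- by rewrite det_map_mx -rmorphM Dd rmorph1.
- by rewrite det_map_mx -rmorphM dD rmorph1.
Qed.

(** * The differential of the superdeterminant at the identity *)

Section LinearTerms.
Variables (K : numDomainType) (G : finType) (p : pred G) (x : G).
Local Notation R := (sseries K p).
Implicit Types f : R.

Local Notation dx := (fun f : R => f (mvar p x)).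

Lemma scoef_prod_var (I : eqType) (r : seq I) (F : I -> R) : uniq r ->
  dx (\prod_(i <- r) F i) =
  \sum_(i <- r) dx (F i) * \prod_(k <- r | k != i) sconst (F k).
Proof.
elim: r => [|i r IH] /=; first by rewrite !big_nil scoef1 mvar_neq1.
case/andP=> ir /IH{}IH; rewrite !big_cons scoefM_var IH eqxx rmorph_prod; congr (_ * _ + _).
  rewrite big_seq_cond [RHS]big_seq_cond; apply: eq_bigl => k.
  by case kr: (k \in r) => //=; case: eqP => // ki; rewrite -ki kr in ir.
rewrite mulr_sumr; apply: eq_big_seq => k kr; rewrite big_cons ifT.
  by rewrite mulrCA.
by apply: contraNneq ir => ->.
Qed.

(** A permutation other than the identity moves at least two indices, so after differentiating one
    factor an off-diagonal constant term, which is 0, remains. *)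
Lemma scoef_det_var a (M : 'M[R]_a) : map_mx sconst M = 1%:M ->
  dx (\det M) = \sum_i dx (M i i).
Proof.
move=> M1; have ME i j : sconst (M i j) = (i == j)%:R.
  by have /matrixP/(_ i j) := M1; rewrite !mxE.
have -> : dx (\det M) = \sum_(s : 'S_a) (-1) ^+ s *
    \sum_i dx (M i (s i)) * \prod_(k | k != i) sconst (M k (s k)).
  rewrite /determinant scoef_sum; apply: eq_bigr => s _.
  rewrite -(scoef_prod_var _ (index_enum_uniq _)) -scoefZ.
  by case: (s : bool); rewrite ?expr0 ?expr1 ?mul1r ?scale1r ?mulN1r ?scaleN1r.
rewrite (bigD1 (1%g : 'S_a)) //= odd_perm1 expr0 mul1r [X in _ + X]big1 ?addr0 => [|s s1].
  apply: eq_bigr => i _; rewrite big1 ?mulr1 ?perm1 // => k _.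
  by rewrite ME perm1 eqxx.
rewrite big1 ?mulr0 // => i _.
have [k ki sk] : exists2 k, k != i & s k != k.
  have /existsP[k sk] : [exists k, s k != k].
    rewrite -negb_forall; apply: contra s1 => /forallP s1; apply/eqP/perm.permP => k.
    by rewrite perm1; exact/eqP.
  have [ki|ki] := eqVneq k i; last by exists k.
  exists (s k); first by rewrite -ki.
  by rewrite (inj_eq perm_inj).
by rewrite (bigD1 k) //= ME eq_sym (negPf sk) mul0r mulr0.
Qed.

(** The correction [B D' C] has no linear term because [B] and [C] have no constant term, and the
    inverse of [det D] contributes minus the trace. *)
Lemma scoef_sdet_var m n (M : 'M[R]_(m + n)) : gmx M ->
  dx (sdet M) = Str (map_mx (fun f : R => dx f) M).
Proof.
case/gmxP => A B C D D' d -> [Ae Bo Co De] [A1 D1] [DD' D'D D'e] [Dd dD d0].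
have cB i j : sconst (B i j) = 0 by apply: sconst_odd; exact: Bo.
have cC i j : sconst (C i j) = 0 by apply: sconst_odd; exact: Co.
have cdet : sconst (\det D) = 1 by rewrite -det_map_mx D1 det1.
have cd : sconst d = 1.
  by have := congr1 sconst Dd; rewrite rmorph1 rmorphM /= cdet mul1r.
rewrite (sdet_block _ _ _ DD' D'D Dd dD) scoefM_var cd mulr1.
have BD' i k : sconst ((B *m D') i k) = 0.
  have /matrixP/(_ i k) : map_mx sconst (B *m D') = 0; last by rewrite !mxE.
  rewrite map_mxM [map_mx _ B](_ : _ = 0) ?mul0mx //.
  by apply/matrixP => a b; rewrite !mxE; exact: cB.
have A'1 : map_mx sconst (A - B *m D' *m C) = 1%:M.
  rewrite map_mxB A1 map_mxM [map_mx _ (B *m D')](_ : _ = 0) ?mul0mx ?subr0 //.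
  by apply/matrixP => a b; rewrite mxE [RHS]mxE; exact: BD'.
rewrite -det_map_mx A'1 det1 mul1r /Str map_block_mx block_mxKul block_mxKdr.
rewrite scoef_det_var // /mxtrace; congr (_ + _).
  apply: eq_bigr => i _; rewrite mxE [X in _ + X]mxE scoefB mxE scoef_sum big1 ?subr0 ?mxE // => k _.
  by rewrite scoefM_var cC BD' mulr0 mul0r addr0.
have := congr1 dx Dd; rewrite scoefM_var cdet cd mulr1 mul1r scoef_det_var // scoef1 mvar_neq1.
move=> /eqP; rewrite addrC addr_eq0 => /eqP->; congr (- _).
by apply: eq_bigr => i _; rewrite !mxE.
Qed.

End LinearTerms.

(** * Ideals and quotients *)

Section Ideals.
Variables (A : pzRingType) (K : set A) (KI : is_ideal K).

Lemma ideal_opp x : K x -> K (- x).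
Proof. by rewrite -sub0r => Kx; apply: (idealB KI) => //; exact: ideal0. Qed.

Lemma ideal_add x y : K x -> K y -> K (x + y).
Proof. by move=> Kx /ideal_opp Ky; rewrite -[y]opprK; exact: (idealB KI). Qed.

Lemma ideal_sum I (r : seq I) (P : pred I) (F : I -> A) :
  (forall i, P i -> K (F i)) -> K (\sum_(i <- r | P i) F i).
Proof. by move=> KF; elim/big_ind: _ => //; [exact: ideal0|exact: ideal_add]. Qed.

Lemma ideal_trans x y : K (x - y) -> K y -> K x.
Proof. by move=> xy Ky; rewrite -(subrK y x); exact: ideal_add. Qed.

Lemma ideal_mulB x x' y y' : K (x - x') -> K (y - y') -> K (x * y - x' * y').
Proof.
move=> xx yy; have -> : x * y - x' * y' = (x - x') * y + x' * (y - y').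
  by rewrite mulrBl mulrBr addrA subrK.
by apply: ideal_add; [exact: idealMr|exact: idealMl].
Qed.

End Ideals.

Lemma ideal_gen_sub (A : pzRingType) (S K : set A) :
  is_ideal K -> S `<=` K -> ideal_gen S `<=` K.
Proof. by move=> KI SK x; apply. Qed.

Lemma ideal_gen_in (A : pzRingType) (S : set A) x : S x -> ideal_gen S x.
Proof. by move=> Sx K [_]; apply. Qed.

Lemma ideal_preim (A B : pzRingType) (phi : {rmorphism A -> B}) (K : set B) :
  is_ideal K -> is_ideal (fun x => K (phi x)).
Proof.
move=> KI; split=> [|x y|a x|a x]; rewrite ?rmorph0 ?rmorphB ?rmorphM.
- exact: ideal0.
- exact: idealB.
- exact: idealMl.
- exact: idealMr.
Qed.

Lemma ideal_gen_map (A B : pzRingType) (phi : {rmorphism A -> B}) (S : set A) (K : set B) :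
  is_ideal K -> (forall s, S s -> K (phi s)) -> forall x, ideal_gen S x -> K (phi x).
Proof. by move=> KI SK; apply: (ideal_gen_sub (ideal_preim phi KI)). Qed.

Section QuotientMorphism.
Variables (C : pzRingType) (A : algType C) (S : set A).
Local Notation pi := (\pi_(quo S)).

Lemma piD x y : pi (x + y) = pi x + pi y. Proof. exact/esym/qaddE. Qed.
Lemma piN x : pi (- x) = - pi x. Proof. exact/esym/qoppE. Qed.
Lemma piB x y : pi (x - y) = pi x - pi y. Proof. by rewrite piD piN. Qed.
Lemma piM x y : pi (x * y) = pi x * pi y. Proof. exact/esym/qmulE. Qed.
Lemma piZ c x : pi (c *: x) = c *: pi x. Proof. exact/esym/qscaleE. Qed.
Lemma pi_sum I (r : seq I) (P : pred I) (F : I -> A) :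
  pi (\sum_(i <- r | P i) F i) = \sum_(i <- r | P i) pi (F i).
Proof. exact: (big_morph _ piD (erefl _)). Qed.

Lemma pi_eqP x y : pi x = pi y <-> ideal_gen S (x - y).
Proof. by split=> [/quo_eqP/asboolP|/asboolP/quo_eqP]. Qed.

Definition qpi x : quo S := pi x.
Fact qpi_additive : additive qpi. Proof. exact: piB. Qed.
HB.instance Definition _ := GRing.isAdditive.Build A (quo S) qpi qpi_additive.
Fact qpi_multiplicative : multiplicative qpi. Proof. by split=> // x y; exact: piM. Qed.
HB.instance Definition _ := GRing.isMultiplicative.Build A (quo S) qpi qpi_multiplicative.

(** Ideals of the quotient correspond to ideals containing the relations [S]; membership is thus
    tested on representatives. *)
Lemma ideal_gen_pi (T : set A) (f : A) :
  ideal_gen [set pi t | t in T] (pi f) <-> ideal_gen (S `|` T) f.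
Proof.
have ST := ideal_gen_ideal (S `|` T).
have SST : ideal_gen S `<=` ideal_gen (S `|` T).
  by apply: ideal_gen_sub => // s Ss; apply: ideal_gen_in; left.
split=> [|].
  pose K : set (quo S) := fun x => ideal_gen (S `|` T) (repr x).
  have Kpi g : K (pi g) <-> ideal_gen (S `|` T) g.
    have gg := SST _ (@quo_reprP C A S g); split=> [Kg|STg]; last exact: (ideal_trans ST gg STg).
    have {}Kg : ideal_gen (S `|` T) (repr (pi g)) := Kg.
    by apply: (ideal_trans ST _ Kg); rewrite -opprB; apply: (ideal_opp ST).
  have KI : is_ideal K.
    split=> [|x y|a x|a x].
    - by apply/(Kpi 0); exact: ideal0.
    - move=> Kx Ky; rewrite -[x]reprK -[y]reprK -piB; apply/Kpi.
      by apply: (idealB ST).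
    - move=> Kx; rewrite -[x]reprK -[a]reprK -piM; apply/Kpi; exact: (idealMl ST).
    - move=> Kx; rewrite -[x]reprK -[a]reprK -piM; apply/Kpi; exact: (idealMr ST).
  move=> Kf; apply/Kpi; apply: Kf; split=> // x [t Tt E].
  by rewrite -E; apply/Kpi; apply: ideal_gen_in; right.
move=> STf; have KI := ideal_gen_ideal [set pi t | t in T].
apply: (ideal_gen_map (phi := qpi) KI _ STf) => s [Ss|Ts] /=.
  rewrite [qpi s](_ : _ = 0); first exact: ideal0.
  by apply/pi_eqP; rewrite subr0; exact: ideal_gen_in.
by apply: ideal_gen_in; exists s.
Qed.

End QuotientMorphism.

(** The arbitrary representative chosen by [qlift] is harmless once [phi] is additive and respects
    the ideals; all structure maps are brought down in this way. *)
Lemma qlift_pi (C : pzRingType) (A B : algType C) (S : set A) (T : set B) (phi : A -> B) :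
  {morph phi : x y / x - y} ->
  (forall f, ideal_gen S f -> ideal_gen T (phi f)) ->
  forall f, qlift T phi (\pi_(quo S) f) = \pi_(quo T) (phi f).
Proof.
move=> phiB phiS f; apply/pi_eqP; rewrite -phiB; apply: phiS; exact: quo_reprP.
Qed.

(** * The Hopf structure on the level of power series *)

Lemma gmx_map (K K' : numDomainType) (G G' : finType) (p : pred G) (q : pred G') m n
    (phi : {rmorphism sseries K p -> sseries K' q}) (M : 'M_(m + n)) :
  (forall e f, shom e f -> shom e (phi f)) ->
  (forall f, sconst f = 0 -> sconst (phi f) = 0) ->
  gmx M -> gmx (map_mx phi M).
Proof.
move=> phih phi0 [Mg M1]; split; first by move=> i j; rewrite mxE; apply/phih/Mg.
apply/matrixP => i j; have /matrixP/(_ i j) := M1; rewrite !mxE => Mij.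
have /phi0 : sconst (M i j - (i == j)%:R) = 0.
  by rewrite rmorphB rmorph_nat /= Mij subrr.
by rewrite !rmorphB !rmorph_nat => /eqP; rewrite subr_eq0 => /eqP.
Qed.

Section Generators.
Variables (C : numClosedFieldType) (m n : nat).
Local Notation F2 := (F2 C m n).
Local Notation gpar2 := (@gpar2 m n).
Local Notation ip := (@ipar m n).
Local Notation D2 := (sseries C (psum gpar2 gpar2)).
Local Notation xvar := (@xvar C m n).
Implicit Types (c : bool) (i j k : 'I_(m + n)).

Lemma gpar2_copy c i j : gpar2 (copy c i j) = ip i (+) ip j.
Proof. by case: c. Qed.

Lemma on_gens_copy (T : Type) (u : bool -> 'I_(m + n) -> 'I_(m + n) -> T) c i j :
  on_gens u (copy c i j) = u c i j.
Proof. by case: c. Qed.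

Lemma copyP (x : gen2 m n) : exists c i j, x = copy c i j.
Proof. by case: x => -[i j]; [exists false|exists true]; exists i, j. Qed.

Lemma shom_xvar c i j : shom (ip i (+) ip j) (xvar c i j).
Proof. by rewrite -(gpar2_copy c); exact: shom_svar. Qed.

Lemma sconst_xvar c i j : sconst (xvar c i j) = 0.
Proof. exact: sconst_svar. Qed.

(* The generic matrices [1 + Y] and [1 + Z].  They are locked because telling
   [gm false] from [gm true] by conversion does not terminate in practice. *)
Fact gm_key : unit. Proof. exact: tt. Qed.
Definition gm : bool -> 'M[F2]_(m + n) :=
  locked_with gm_key (fun c => 1%:M + @xmx C m n c).

Lemma gm_unlock c : gm c = 1%:M + @xmx C m n c.
Proof. by rewrite /gm locked_withE. Qed.

Lemma gmE c i j : gm c i j = (i == j)%:R + xvar c i j.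
Proof. by rewrite gm_unlock !mxE. Qed.

Lemma gmx_gm c : gmx (gm c).
Proof.
split; last first.
  by apply/matrixP => i j; rewrite mxE gmE rmorphD rmorph_nat [X in _ + X]sconst_xvar addr0 mxE.
rewrite gm_unlock.
by apply: gradedmxD; [exact: gradedmx1|move=> i j; rewrite mxE; exact: shom_xvar].
Qed.

Lemma shom_gm c i j : shom (ip i (+) ip j) (gm c i j).
Proof. by have [] := gmx_gm c. Qed.

Definition gmi : bool -> 'M[F2]_(m + n) := locked_with gm_key (fun c => mx_inv (gm c)).

Lemma gmi_unlock c : gmi c = mx_inv (gm c).
Proof. by rewrite /gmi locked_withE. Qed.

Lemma gmiP c : [/\ gm c *m gmi c = 1%:M, gmi c *m gm c = 1%:M & gmx (gmi c)].
Proof.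
by have [N Ng [MN NM]] := gmx_inv (gmx_gm c); rewrite gmi_unlock (mx_inv_eq MN NM).
Qed.

Lemma stensl_svar (G G' : finType) (p : pred G) (q : pred G') x :
  stens (svar C p x) 1 = svar C (psum p q) (inl x).
Proof.
rewrite svarE -(smon1 C q) stens_smon svarE; congr smon.
by apply: smonoP => -[y|y]; rewrite !ffunE.
Qed.

Lemma stensr_svar (G G' : finType) (p : pred G) (q : pred G') x :
  stens 1 (svar C q x) = svar C (psum p q) (inr x).
Proof.
rewrite svarE -(smon1 C p) stens_smon svarE; congr smon.
by apply: smonoP => -[y|y]; rewrite !ffunE.
Qed.

Let g1 : 'M[sseries C (@gpar m n)]_(m + n) := 1%:M + \matrix_(i, j) svar C (@gpar m n) (i, j).

Let gmx_g1 : gmx g1.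
Proof.
split; last first.
  by apply/matrixP => i j; rewrite !mxE rmorphD rmorph_nat [X in _ + X]sconst_svar addr0.
by apply: gradedmxD; [exact: gradedmx1|move=> i j; rewrite mxE; exact: (@shom_svar C _ (@gpar m n) (i, j))].
Qed.

Lemma H_relP f : @H_rel C m n f <-> exists c, f = sdet (gm c) - 1.
Proof.
have sl : stens (sdet g1 - 1) 1 = sdet (gm false) - 1.
  transitivity (stensl (@gpar m n) (sdet g1 - 1)); first by [].
  rewrite rmorphB rmorph1 (sdet_map _ gmx_g1); congr (sdet _ - 1).
  by apply/matrixP => i j; rewrite gmE !mxE rmorphD rmorph_nat; congr (_ + _); exact: stensl_svar.
have sr : stens 1 (sdet g1 - 1) = sdet (gm true) - 1.
  transitivity (stensr (@gpar m n) (sdet g1 - 1)); first by [].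
  rewrite rmorphB rmorph1 (sdet_map _ gmx_g1); congr (sdet _ - 1).
  by apply/matrixP => i j; rewrite gmE !mxE rmorphD rmorph_nat; congr (_ + _); exact: stensr_svar.
split=> [[[s -> <-]|[s -> <-]]|[[] ->]].
- by exists false; exact: sl.
- by exists true; exact: sr.
- by right; exists (sdet g1 - 1); [exact: erefl|exact: sr].
- by left; exists (sdet g1 - 1); [exact: erefl|exact: sl].
Qed.

Definition DU_fun : gen2 m n -> D2 := on_gens (fun c i j =>
    stens 1 (xvar c i j) + stens (xvar c i j) 1
      + \sum_k stens (xvar c i k) (xvar c k j)).

Fact DU_hom x : shom (gpar2 x) (DU_fun x).
Proof.
have [c [i [j ->]]] := copyP x; rewrite gpar2_copy /DU_fun on_gens_copy.
apply: shomD; first apply: shomD.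
- by have := shom_stens (@shom1 C _ gpar2) (@shom_xvar c i j).
- by have := shom_stens (@shom_xvar c i j) (@shom1 C _ gpar2); rewrite addbF.
apply: shom_sum => k _; have := shom_stens (@shom_xvar c i k) (@shom_xvar c k j).
by rewrite addbA -[_ (+) ip k (+) ip k]addbA addbb addbF.
Qed.

Fact DU_const x : sconst (DU_fun x) = 0.
Proof.
have [c [i [j ->]]] := copyP x; rewrite /DU_fun on_gens_copy !rmorphD rmorph_sum /=.
by rewrite !sconst_stens sconst_xvar mulr0 mul0r !add0r big1 // => k _; rewrite sconst_stens sconst_xvar mul0r.
Qed.

Definition DU := SSubData DU_hom DU_const.

(** In the coordinates [1 + X] the coproduct is plain matrix multiplication, which with [sdetM]
    makes the superdeterminant group-like. *)
Lemma DU_gm c : map_mx (smorph DU) (gm c) =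
  map_mx (@stensl _ _ _ gpar2 gpar2) (gm c) *m map_mx (@stensr _ _ _ gpar2 gpar2) (gm c).
Proof.
rewrite gm_unlock !map_mxD !map_mx1 mulmxDl mul1mx mulmxDr mulmx1 -addrA; congr (_ + _).
apply/matrixP => i j; rewrite !mxE /= smorph_svar /= /DU_fun on_gens_copy addrA; congr (_ + _ + _).
by apply: eq_bigr => k _; rewrite !mxE stensE1.
Qed.

Lemma DU_sdet c : smorph DU (sdet (gm c)) = stens (sdet (gm c)) (sdet (gm c)).
Proof.
rewrite (sdet_map _ (gmx_gm c)) DU_gm sdetM.
- by rewrite -!(sdet_map _ (gmx_gm c)) [RHS]stensE1.
- apply: gmx_map (gmx_gm c) => [e f fe|f f0].
    by have := shom_stens fe (@shom1 C _ gpar2); rewrite addbF.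
  by rewrite -[X in X = 0]/(sconst (stens _ _)) sconst_stens f0 mul0r.
- apply: gmx_map (gmx_gm c) => [e f fe|f f0].
    exact: shom_stens (@shom1 C _ gpar2) fe.
  by rewrite -[X in X = 0]/(sconst (stens _ _)) sconst_stens f0 mulr0.
Qed.

Definition SU_fun : gen2 m n -> F2 := on_gens (@antipode_gen C m n).

Lemma antipode_genE c i j : @antipode_gen C m n c i j = gmi c i j - (i == j)%:R.
Proof. by rewrite gmi_unlock gm_unlock addrC. Qed.

Lemma shom_antipode_gen c i j : shom (ip i (+) ip j) (@antipode_gen C m n c i j).
Proof.
rewrite antipode_genE; have [_ _ [gmih _]] := gmiP c.
apply: shomB; first exact: gmih.
by have := @gradedmx1 C _ gpar2 _ ip i j; rewrite mxE.
Qed.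

Lemma sconst_antipode_gen c i j : sconst (@antipode_gen C m n c i j) = 0.
Proof.
have [_ _ [_ /matrixP/(_ i j)]] := gmiP c; rewrite !mxE => E.
by rewrite antipode_genE rmorphB rmorph_nat /= E subrr.
Qed.

Fact SU_hom x : shom (gpar2 x) (SU_fun x).
Proof.
have [c [i [j ->]]] := copyP x; rewrite gpar2_copy /SU_fun on_gens_copy.
exact: shom_antipode_gen.
Qed.

Fact SU_const x : sconst (SU_fun x) = 0.
Proof.
have [c [i [j ->]]] := copyP x; rewrite /SU_fun on_gens_copy; exact: sconst_antipode_gen.
Qed.

Definition SU := SSubData SU_hom SU_const.

Lemma SU_gm c : map_mx (smorph SU) (gm c) = gmi c.
Proof.
rewrite gm_unlock map_mxD map_mx1; apply/matrixP => i j.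
by rewrite !mxE /= smorph_svar /= /SU_fun on_gens_copy antipode_genE addrC subrK.
Qed.

Lemma sdet_gmi c : sdet (gm c) * sdet (gmi c) = 1.
Proof. by have [E _ g] := gmiP c; rewrite -(sdetM (gmx_gm c) g) E sdet1. Qed.

Lemma SU_sdet c : smorph SU (sdet (gm c)) = sdet (gmi c).
Proof. by rewrite (sdet_map _ (gmx_gm c)) SU_gm. Qed.

Lemma sconjE (f : F2) M : sconj f M = (f M)^*. Proof. by []. Qed.

Fact sconj_additive : additive (@sconj C m n).
Proof. by move=> f g; apply: sseriesP => M; rewrite scoefB !sconjE scoefB rmorphB. Qed.
HB.instance Definition _ := GRing.isAdditive.Build F2 F2 (@sconj C m n) sconj_additive.
Fact sconj_multiplicative : multiplicative (@sconj C m n).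
Proof.
split=> [f g|]; apply: sseriesP => M; last by rewrite /= rmorph_nat.
rewrite sconjE !scoefM rmorph_sum; apply: eq_bigr => D _.
by rewrite !sconjE !rmorphM rmorph_sign.
Qed.
HB.instance Definition _ := GRing.isMultiplicative.Build F2 F2 (@sconj C m n) sconj_multiplicative.

Lemma sconj_xvar c i j : sconj (xvar c i j) = xvar c i j.
Proof. by apply: sseriesP => M; rewrite /= rmorph_nat. Qed.

Definition TU_fun : gen2 m n -> F2 := on_gens (fun c i j =>
  (-1) ^+ ((ip i (+) ip j) && ip j) * @antipode_gen C m n (~~ c) j i).

Lemma TU_fun_copy c i j : TU_fun (copy c i j) =
  (-1) ^+ ((ip i (+) ip j) && ip j) *: @antipode_gen C m n (~~ c) j i.
Proof. by rewrite /TU_fun on_gens_copy; case: (_ && _); rewrite ?mul1r ?scale1r // !expr1 mulN1r scaleN1r. Qed.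

Fact TU_hom x : shom (gpar2 x) (TU_fun x).
Proof.
have [c [i [j ->]]] := copyP x; rewrite gpar2_copy TU_fun_copy addbC.
by apply: shomZ; exact: shom_antipode_gen.
Qed.

Fact TU_const x : sconst (TU_fun x) = 0.
Proof.
have [c [i [j ->]]] := copyP x; rewrite TU_fun_copy /sconst scoefZ.
by have := sconst_antipode_gen (~~ c) j i; rewrite /sconst => ->; rewrite mulr0.
Qed.

Definition TU := SSubData TU_hom TU_const.

(** Antilinear, but still a ring morphism, which is all that [sdet_map] and the transport of ideals
    require. *)
Definition sstar (f : F2) : F2 := smorph TU (sconj f).

Fact sstar_additive : additive sstar.
Proof. by move=> f g; rewrite /sstar !rmorphB. Qed.
HB.instance Definition _ := GRing.isAdditive.Build F2 F2 sstar sstar_additive.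
Fact sstar_multiplicative : multiplicative sstar.
Proof. by split=> [f g|]; rewrite /sstar ?rmorphM // !rmorph1. Qed.
HB.instance Definition _ := GRing.isMultiplicative.Build F2 F2 sstar sstar_multiplicative.

Lemma sstar_gm c : map_mx sstar (gm c) = stmx (gmi (~~ c)).
Proof.
apply/matrixP => i j; rewrite mxE gmE mxE rmorphD rmorph_nat /= /sstar sconj_xvar smorph_svar /=.
rewrite /TU_fun on_gens_copy antipode_genE.
have [->|ij] := eqVneq i j; first by rewrite ?eqxx addbb !mul1r addrC subrK.
by rewrite subr0 add0r.
Qed.

Lemma sstar_sdet c : sstar (sdet (gm c)) = sdet (gmi (~~ c)).
Proof.
by rewrite (sdet_map _ (gmx_gm c)) sstar_gm sdet_stmx //; have [] := gmiP (~~ c).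
Qed.

End Generators.

(** * Invariant derivations *)

Section CounitSlices.
Variables (C : numDomainType) (G G' : finType) (p : pred G) (q : pred G').
Local Notation T := (sseries C (psum p q)).

Definition etal (t : T) : sseries C q := slicel (mono1 p) t.
HB.instance Definition _ := GRing.isAdditive.Build T (sseries C q) etal (@slicel_additive C G G' p q _).
HB.instance Definition _ := GRing.isScalable.Build C T (sseries C q) *:%R etal
  (@slicel_scalable C G G' p q _).
Fact etal_multiplicative : multiplicative etal.
Proof.
split; first exact: slicel1M.
by rewrite -stens11 /etal slicel_stens scoef1 eqxx scale1r.
Qed.
HB.instance Definition _ := GRing.isMultiplicative.Build T (sseries C q) etal etal_multiplicative.

Definition etar (t : T) : sseries C p := slicer (mono1 q) t.
HB.instance Definition _ := GRing.isAdditive.Build T (sseries C p) etar (@slicer_additive C G G' p q _).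
HB.instance Definition _ := GRing.isScalable.Build C T (sseries C p) *:%R etar
  (@slicer_scalable C G G' p q _).
Fact etar_multiplicative : multiplicative etar.
Proof.
split; first exact: slicer1M.
by rewrite -stens11 /etar slicer_stens scoef1 eqxx scale1r.
Qed.
HB.instance Definition _ := GRing.isMultiplicative.Build T (sseries C p) etar etar_multiplicative.

Lemma etal_stens f g : etal (stens f g) = sconst f *: g.
Proof. exact: slicel_stens. Qed.
Lemma etar_stens f g : etar (stens f g) = sconst g *: f.
Proof. exact: slicer_stens. Qed.

End CounitSlices.

Section Derivations.
Variables (C : numClosedFieldType) (m n : nat).
Local Notation F2 := (F2 C m n).
Local Notation gpar2 := (@gpar2 m n).
Local Notation ip := (@ipar m n).
Local Notation D2 := (sseries C (psum gpar2 gpar2)).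
Local Notation xvar := (@xvar C m n).
Local Notation gm := (@gm C m n).
Local Notation DU := (@DU C m n).
Implicit Types (c e : bool) (i j k : 'I_(m + n)) (h : dmx C m n) (f g : F2) (t u : D2).

Definition dcomp c h : 'M[C]_(m + n) := if c then h.2 else h.1.

Definition dcoef h : gen2 m n -> C := on_gens (fun c i j => dcomp c h i j).

Lemma dcoef_copy h c i j : dcoef h (copy c i j) = dcomp c h i j.
Proof. exact: on_gens_copy. Qed.

Lemma big_gen2 (V : nmodType) (F : gen2 m n -> V) :
  \sum_x F x = \sum_c \sum_i \sum_j F (copy c i j).
Proof.
by rewrite big_sumType /= big_bool addrC !pair_big; congr (_ + _); apply: eq_bigr => -[].
Qed.

Lemma deltaFE h f : deltaF h f = \sum_x dcoef h x * f (mvar gpar2 x).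
Proof.
rewrite big_gen2 big_bool /= addrC /deltaF -big_split; apply: eq_bigr => i _ /=.
by rewrite -big_split; apply: eq_bigr => j _.
Qed.

Lemma dcoef_hom e h x : dhomog e h -> gpar2 x != e -> dcoef h x = 0.
Proof.
have [c [i [j ->]]] := copyP x; rewrite gpar2_copy dcoef_copy => he /he[h1 h2].
by case: c.
Qed.

Lemma contrlE h t : contrl (deltaF h) t = \sum_x dcoef h x *: slicel (mvar gpar2 x) t.
Proof. by apply: sseriesP => B; rewrite scoef_sum /= deltaFE. Qed.

Lemma contrrE h t : contrr (deltaF h) t = \sum_x dcoef h x *: slicer (mvar gpar2 x) t.
Proof. by apply: sseriesP => B; rewrite scoef_sum /= deltaFE. Qed.

Lemma contrlB h : {morph @contrl C _ _ gpar2 gpar2 (deltaF h) : t u / t - u}.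
Proof.
move=> t u; rewrite !contrlE -sumrB; apply: eq_bigr => x _.
by rewrite -scalerBr.
Qed.
HB.instance Definition _ h := GRing.isAdditive.Build D2 F2 (@contrl C _ _ gpar2 gpar2 (deltaF h)) (@contrlB h).

Lemma contrrB h : {morph @contrr C _ _ gpar2 gpar2 (deltaF h) : t u / t - u}.
Proof.
move=> t u; rewrite !contrrE -sumrB; apply: eq_bigr => x _.
by rewrite -scalerBr.
Qed.
HB.instance Definition _ h := GRing.isAdditive.Build D2 F2 (@contrr C _ _ gpar2 gpar2 (deltaF h)) (@contrrB h).

Lemma contrlZ h a t : contrl (deltaF h) (a *: t) = a *: contrl (deltaF h) t.
Proof.
by rewrite !contrlE scaler_sumr; apply: eq_bigr => x _; rewrite slicelZ !scalerA mulrC.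
Qed.

Lemma contrrZ h a t : contrr (deltaF h) (a *: t) = a *: contrr (deltaF h) t.
Proof.
by rewrite !contrrE scaler_sumr; apply: eq_bigr => x _; rewrite slicerZ !scalerA mulrC.
Qed.

(** For homogeneous [h] only variables of parity [e] have a nonzero coefficient, so the signs of
    [slicel_varM] combine into a single [sigma e]. *)
Lemma contrlM e h t u : dhomog e h -> contrl (deltaF h) (t * u) =
  contrl (deltaF h) t * etal u + sigma e (etal t) * contrl (deltaF h) u.
Proof.
move=> he; rewrite !contrlE mulr_suml mulr_sumr -big_split; apply: eq_bigr => x _.
rewrite slicel_varM scalerDr -scalerAl -scalerAr; congr (_ + _).
by have [<-//|/(dcoef_hom he) ->] := eqVneq (gpar2 x) e; rewrite !scale0r.
Qed.

Lemma contrrM e h t u : dhomog e h -> contrr (deltaF h) (t * u) =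
  contrr (deltaF h) t * sigma e (etar u) + etar t * contrr (deltaF h) u.
Proof.
move=> he; rewrite !contrrE mulr_suml mulr_sumr -big_split; apply: eq_bigr => x _.
rewrite slicer_varM scalerDr -scalerAl -scalerAr; congr (_ + _).
by have [<-//|/(dcoef_hom he) ->] := eqVneq (gpar2 x) e; rewrite !scale0r.
Qed.

Lemma contrl_stens h f g : contrl (deltaF h) (stens f g) = deltaF h f *: g.
Proof.
rewrite contrlE deltaFE scaler_suml; apply: eq_bigr => x _.
by rewrite slicel_stens scalerA.
Qed.

Lemma contrr_stens h f g : contrr (deltaF h) (stens f g) = deltaF h g *: f.
Proof.
rewrite contrrE deltaFE scaler_suml; apply: eq_bigr => x _.
by rewrite slicer_stens scalerA.
Qed.

Lemma deltaF_nat h (k : nat) : deltaF h k%:R = 0.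
Proof.
rewrite deltaFE big1 // => x _; elim: k => [|k IH]; first by rewrite mulr0n mulr0.
by rewrite mulrS scoefD mulrDr IH addr0 scoef1 mvar_neq1 mulr0.
Qed.

Lemma deltaFB h : {morph deltaF h : f g / f - g}.
Proof. by move=> f g; rewrite !deltaFE -sumrB; apply: eq_bigr => x _; rewrite scoefB mulrBr. Qed.

Lemma deltaF_xvar h c i j : deltaF h (xvar c i j) = dcomp c h i j.
Proof.
rewrite deltaFE (bigD1 (copy c i j)) //= eqxx mulr1 dcoef_copy big1 ?addr0 // => x xc.
by rewrite (inj_eq (@mvar_inj _ gpar2)) (negPf xc) mulr0.
Qed.

Lemma deltaF_sdet h c : deltaF h (sdet (gm c)) = Str (dcomp c h).
Proof.
rewrite deltaFE.
transitivity (\sum_x dcoef h x * Str (\matrix_(i, j) (x == copy c i j)%:R : 'M[C]_(m + n))).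
  apply: eq_bigr => x _; rewrite (scoef_sdet_var _ (gmx_gm _ _ _ c)); congr (_ * Str _).
  apply/matrixP => i j; rewrite mxE [RHS]mxE gmE scoefD /= (inj_eq (@mvar_inj _ gpar2)).
  rewrite [X in X + _](_ : _ = 0) ?add0r //; case: (i == j); last by [].
  by rewrite scoef1 mvar_neq1.
have E i0 : \sum_x dcoef h x * (x == copy c i0 i0)%:R = dcomp c h i0 i0.
  rewrite (bigD1 (copy c i0 i0)) //= eqxx mulr1 dcoef_copy big1 ?addr0 // => x xc.
  by rewrite (negPf xc) mulr0.
rewrite /Str /mxtrace (eq_bigr (fun x =>
    \sum_i dcoef h x * (x == copy c (lshift n i) (lshift n i))%:R
    - \sum_i dcoef h x * (x == copy c (rshift m i) (rshift m i))%:R)); last first.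
  by move=> x _; rewrite mulrBr !mulr_sumr; congr (_ - _); apply: eq_bigr => i _; rewrite !mxE.
rewrite sumrB; congr (_ - _); rewrite exchange_big; apply: eq_bigr => i _; rewrite !mxE; exact: E.
Qed.

Lemma sord_contrl d h t : sord d.+1 t -> sord d (contrl (deltaF h) t).
Proof.
move=> td; rewrite contrlE; apply: sord_sum => x _; apply: sordZ.
by apply: sord_slicel; rewrite mdeg_var addn1.
Qed.

Lemma sord_contrr d h t : sord d.+1 t -> sord d (contrr (deltaF h) t).
Proof.
move=> td; rewrite contrrE; apply: sord_sum => x _; apply: sordZ.
by apply: sord_slicer; rewrite mdeg_var addn1.
Qed.

(** The counit axiom; it turns the Leibniz rule of the slices into that of [nabR]. *)
Lemma etal_DU f : etal (smorph DU f) = f.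
Proof.
have : @etal C _ _ gpar2 gpar2 \o smorph DU =1 idfun.
  apply: smorph_ext => // [d g gd|x] /=.
    by apply: sord_slicel; rewrite mdeg1 addn0; exact: sord_smorph.
  have [c [i [j ->]]] := copyP x; rewrite smorph_svar /= /DU_fun on_gens_copy.
  rewrite !raddfD raddf_sum /= !etal_stens sconst_xvar scale0r addr0 rmorph1 scale1r.
  rewrite big1 ?addr0 // => k _; by rewrite etal_stens sconst_xvar scale0r.
exact.
Qed.

Lemma etar_DU f : etar (smorph DU f) = f.
Proof.
have : @etar C _ _ gpar2 gpar2 \o smorph DU =1 idfun.
  apply: smorph_ext => // [d g gd|x] /=.
    by apply: sord_slicer; rewrite mdeg1 addn0; exact: sord_smorph.
  have [c [i [j ->]]] := copyP x; rewrite smorph_svar /= /DU_fun on_gens_copy.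
  rewrite !raddfD raddf_sum /= !etar_stens sconst_xvar scale0r add0r rmorph1 scale1r.
  rewrite big1 ?addr0 // => k _; by rewrite etar_stens sconst_xvar scale0r.
exact.
Qed.

Definition nabR h f : F2 := contrl (deltaF h) (smorph DU f).
Definition nabL e h f : F2 :=
  \sum_(s : bool) (-1) ^+ (e && ~~ s) *: contrr (deltaF h) (smorph DU (spart s f)).

(** The sign [(-1)^(|h|(|f|+1))] splits into a global factor and [sigma e]. *)
Lemma nabLE e h f : nabL e h f = (-1) ^+ e *: contrr (deltaF h) (smorph DU (sigma e f)).
Proof.
rewrite sigma_spart !raddf_sum /=; apply: eq_bigr => s _; rewrite smorphZ.
rewrite contrrZ scalerA -signr_addb; congr (_ ^+ _ *: _).
by case: e; case: s.
Qed.

Lemma nabRD h f g : nabR h (f + g) = nabR h f + nabR h g.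
Proof. by rewrite /nabR !raddfD. Qed.
Lemma nabLD e h f g : nabL e h (f + g) = nabL e h f + nabL e h g.
Proof. by rewrite !nabLE !raddfD. Qed.
Lemma nabRB h f g : nabR h (f - g) = nabR h f - nabR h g.
Proof. by rewrite /nabR !raddfB. Qed.
Lemma nabLB e h f g : nabL e h (f - g) = nabL e h f - nabL e h g.
Proof. by rewrite !nabLE !raddfB. Qed.
Lemma nabRZ h a f : nabR h (a *: f) = a *: nabR h f.
Proof. by rewrite /nabR smorphZ contrlZ. Qed.
Lemma nabLZ e h a f : nabL e h (a *: f) = a *: nabL e h f.
Proof. by rewrite !nabLE sigmaZ smorphZ contrrZ !scalerA mulrC. Qed.

Lemma nabRM e h f g : dhomog e h ->
  nabR h (f * g) = nabR h f * g + sigma e f * nabR h g.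
Proof. by move=> he; rewrite /nabR rmorphM (contrlM _ _ he) !etal_DU. Qed.

(** [contrrM] puts the sign on the second factor; the [sigma e] inside [nabL] cancels it there and
    recreates it on the first, so left and right invariant fields obey the same rule. *)
Lemma nabLM e h f g : dhomog e h ->
  nabL e h (f * g) = nabL e h f * g + sigma e f * nabL e h g.
Proof.
move=> he; rewrite !nabLE !rmorphM (contrrM _ _ he) !etar_DU sigmaK scalerDr.
by rewrite -scalerAl -scalerAr.
Qed.

Lemma sord_nabR d h f : sord d.+1 f -> sord d (nabR h f).
Proof. by move=> fd; apply/sord_contrl/sord_smorph. Qed.
Lemma sord_nabL d e h f : sord d.+1 f -> sord d (nabL e h f).
Proof. by move=> fd; rewrite nabLE; apply/sordZ/sord_contrr/sord_smorph/sord_sigma. Qed.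

Lemma nabR1 h : nabR h 1 = 0.
Proof. by rewrite /nabR rmorph1 -stens11 contrl_stens -[1]/(1%:R) deltaF_nat scale0r. Qed.
Lemma nabL1 e h : nabL e h 1 = 0.
Proof.
by rewrite nabLE !rmorph1 -stens11 contrr_stens -[X in deltaF _ X]/(1%:R) deltaF_nat scale0r scaler0.
Qed.

Lemma nabR_nat h (k : nat) : nabR h k%:R = 0.
Proof.
elim: k => [|k IH]; last by rewrite mulrS nabRD IH nabR1 addr0.
by rewrite mulr0n -(scale0r 0) nabRZ !scale0r.
Qed.
Lemma nabL_nat e h (k : nat) : nabL e h k%:R = 0.
Proof.
elim: k => [|k IH]; last by rewrite mulrS nabLD IH nabL1 addr0.
by rewrite mulr0n -(scale0r 0) nabLZ !scale0r.
Qed.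

Lemma nabR_gm h c i j : nabR h (gm c i j) = \sum_k dcomp c h i k *: gm c k j.
Proof.
rewrite gmE nabRD nabR_nat add0r /nabR smorph_svar /= /DU_fun on_gens_copy.
rewrite !raddfD raddf_sum /= !contrl_stens -[1]/(1%:R) deltaF_nat scale0r add0r deltaF_xvar.
under eq_bigr => k _ do rewrite contrl_stens deltaF_xvar.
under [RHS]eq_bigr => k _ do rewrite gmE scalerDr.
rewrite big_split /=; congr (_ + _); rewrite (bigD1 j) //= eqxx big1 ?addr0 // => k kj.
by rewrite (negPf kj) scaler0.
Qed.

Lemma nabL_gm e h c i j : nabL e h (gm c i j) =
  (-1) ^+ (e && ~~ (ip i (+) ip j)) *: \sum_k dcomp c h k j *: gm c i k.
Proof.
rewrite gmE nabLD nabL_nat add0r nabLE (sigma_shom _ (@shom_xvar C m n c i j)).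
rewrite smorphZ contrrZ scalerA -signr_addb.
congr (_ ^+ _ *: _); first by case: e; case: (ip i); case: (ip j).
rewrite smorph_svar /= /DU_fun on_gens_copy.
rewrite !raddfD raddf_sum /= !contrr_stens -[1]/(1%:R) deltaF_nat scale0r addr0 deltaF_xvar.
under eq_bigr => k _ do rewrite contrr_stens deltaF_xvar.
under [RHS]eq_bigr => k _ do rewrite gmE scalerDr.
rewrite big_split /=; congr (_ + _); rewrite (bigD1 i) //= eqxx big1 ?addr0 // => k ki.
by rewrite eq_sym (negPf ki) scaler0.
Qed.

(** The superdeterminant being group-like, the field multiplies it by [deltaF h (sdet (gm c))],
    which is a supertrace. *)
Lemma nabR_sdet h c : Str (dcomp c h) = 0 -> nabR h (sdet (gm c)) = 0.
Proof. by move=> h0; rewrite /nabR DU_sdet contrl_stens deltaF_sdet h0 scale0r. Qed.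

Lemma nabL_sdet e h c : Str (dcomp c h) = 0 -> nabL e h (sdet (gm c)) = 0.
Proof.
move=> h0; rewrite nabLE (sigma_shom _ (shom_sdet (gmx_gm _ _ _ c))) andbF scale1r.
by rewrite DU_sdet contrr_stens deltaF_sdet h0 scale0r scaler0.
Qed.

End Derivations.

(** * The Casimir element *)

Section Superderivations.
Variables (C : numDomainType) (G : finType) (p : pred G).
Local Notation A := (sseries C p).

Record sderiv (e : bool) (D : A -> A) : Prop := SDeriv {
  sderivD : forall f g, D (f + g) = D f + D g;
  sderivZ : forall c f, D (c *: f) = c *: D f;
  sderivM : forall f g, D (f * g) = D f * g + sigma e f * D g;
  sderiv_hom : forall e' f, shom e' f -> shom (e (+) e') (D f);
  sderiv_ord : forall d f, sord d.+1 f -> sord d (D f) }.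

Lemma sderiv1 e D : sderiv e D -> D 1 = 0.
Proof.
move=> DD; have := sderivM DD 1 1; rewrite !mulr1 rmorph1 mul1r => /eqP.
by rewrite -subr_eq0 opprD addrA subrr add0r oppr_eq0 => /eqP.
Qed.

Variables (N : nat) (par : 'I_N -> bool) (D D' : bool -> 'I_N -> A -> A).
Hypothesis DP : forall b a, sderiv (par a) (D b a).
Hypothesis D'P : forall b a, sderiv (par a) (D' b a).

(** [sigma (par a) f] encodes the factor [(-1)^(|f||a|)] of the superbracket; it is what makes the
    sum a superbiderivation. *)
Definition biderT b f g : A := \sum_a D b a (sigma (par a) f) * D' b a g.
Definition bider f g : A := biderT true f g - biderT false f g.

Lemma biderT_Ml b e eg f k g : shom e k -> shom eg g ->
  biderT b (f * k) g = f * biderT b k g + (-1) ^+ (e && eg) *: (biderT b f g * k).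
Proof.
move=> ke ge; rewrite /biderT mulr_sumr mulr_suml scaler_sumr -big_split.
apply: eq_bigr => a _ /=; rewrite rmorphM (sderivM (DP b a)) sigmaK mulrDl addrC -mulrA /=.
congr (_ + _); last by rewrite (sigma_shom _ ke) -mulrA.
rewrite -mulrA (sigma_shom _ ke) -scalerAl.
rewrite (smul_shomC ke (sderiv_hom (D'P b a) ge)) scalerA -scalerAr mulrA -signr_addb.
by congr (_ ^+ _ *: _); case: (par a); case: e {ke}; case: eg {ge}.
Qed.

Lemma biderT_Mr b e ef f k g : shom e k -> shom ef f ->
  biderT b f (k * g) = biderT b f k * g + (-1) ^+ (e && ef) *: (k * biderT b f g).
Proof.
move=> ke fe; rewrite /biderT mulr_sumr mulr_suml scaler_sumr -big_split.
apply: eq_bigr => a _ /=; rewrite (sderivM (D'P b a)) mulrDr mulrA; congr (_ + _).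
have De := sderiv_hom (DP b a) (@shom_sigma _ _ _ _ (par a) _ fe).
rewrite (sigma_shom _ ke) -scalerAl -scalerAr [X in _ *: X = _]mulrA (smul_shomC De ke).
rewrite -scalerAl scalerA mulrA -signr_addb; congr (_ ^+ _ *: _).
by case: (par a); case: e {ke}; case: ef {fe De}.
Qed.

Lemma biderT_1l b g : biderT b 1 g = 0.
Proof. by rewrite /biderT big1 // => a _; rewrite rmorph1 (sderiv1 (DP b a)) mul0r. Qed.
Lemma biderT_1r b f : biderT b f 1 = 0.
Proof. by rewrite /biderT big1 // => a _; rewrite (sderiv1 (D'P b a)) mulr0. Qed.

Lemma biderT_Dl b f f' g : biderT b (f + f') g = biderT b f g + biderT b f' g.
Proof.
by rewrite /biderT -big_split; apply: eq_bigr => a _; rewrite rmorphD (sderivD (DP b a)) mulrDl.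
Qed.
Lemma biderT_Dr b f g g' : biderT b f (g + g') = biderT b f g + biderT b f g'.
Proof.
by rewrite /biderT -big_split; apply: eq_bigr => a _; rewrite (sderivD (D'P b a)) mulrDr.
Qed.
Lemma biderT_Zl b c f g : biderT b (c *: f) g = c *: biderT b f g.
Proof.
by rewrite /biderT scaler_sumr; apply: eq_bigr => a _; rewrite sigmaZ (sderivZ (DP b a)) -scalerAl.
Qed.
Lemma biderT_Zr b c f g : biderT b f (c *: g) = c *: biderT b f g.
Proof.
by rewrite /biderT scaler_sumr; apply: eq_bigr => a _; rewrite (sderivZ (D'P b a)) -scalerAr.
Qed.

(** The Leibniz rules in both arguments reduce the claim to variables. They need homogeneous
    arguments, so they are run on monomials, and continuity gives the rest. *)
Lemma bider_eq0 : (forall x y, bider (svar C p x) (svar C p y) = 0) ->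
  forall f g, bider f g = 0.
Proof.
move=> B0; apply: sbilin_eq0 => [f f' g|c f g|f g g'|c f g|d f g fd|d f g gd|X Y].
- by rewrite /bider !biderT_Dl opprD addrACA.
- by rewrite /bider !biderT_Zl scalerBr.
- by rewrite /bider !biderT_Dr opprD addrACA.
- by rewrite /bider !biderT_Zr scalerBr.
- by apply: sordB; apply: sord_sum => a _; apply/sordMr/(sderiv_ord (DP _ a))/sord_sigma.
- by apply: sordB; apply: sord_sum => a _; apply/sordMl/(sderiv_ord (D'P _ a)).
apply: (smon_ind (P := fun f => bider f (smon Y) = 0)) => [|c f B|x M B].
- by rewrite /bider !biderT_1l subrr.
- by rewrite /bider !biderT_Zl -scalerBr -/(bider _ _) B scaler0.
rewrite /bider !(biderT_Ml _ _ (@shom_smon _ _ _ M) (@shom_smon _ _ _ Y)).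
rewrite opprD addrACA -mulrBr -scalerBr -mulrBl -!/(bider _ _) B mulr0 add0r.
rewrite (_ : bider _ _ = 0) ?mul0r ?scaler0 //.
apply: (smon_ind (P := fun g => bider (svar C p x) g = 0)) => [|c g E|y L E].
- by rewrite /bider !biderT_1r subrr.
- by rewrite /bider !biderT_Zr -scalerBr -/(bider _ _) E scaler0.
rewrite /bider !(biderT_Mr _ _ (@shom_svar C _ p y) (@shom_svar C _ p x)).
rewrite opprD addrACA -mulrBl -scalerBr -mulrBr -!/(bider _ _) E mulr0 scaler0 addr0.
by rewrite B0 mul0r.
Qed.

End Superderivations.

Section InvariantSuperderivations.
Variables (C : numClosedFieldType) (m n : nat).
Local Notation F2 := (F2 C m n).
Local Notation gpar2 := (@gpar2 m n).

Lemma nabR_sderiv e (h : dmx C m n) : dhomog e h -> sderiv e (nabR h).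
Proof.
move=> he; split=> [f g|c f|f g|e' f fe|d f].
- exact: nabRD.
- exact: nabRZ.
- exact: nabRM.
- rewrite /nabR contrlE; apply: shom_sum => x _.
  have [xe|/(dcoef_hom he) ->] := eqVneq (gpar2 x) e; last by rewrite scale0r; exact: shom0.
  by rewrite -xe -(mpar_var gpar2 x); apply/shomZ/shom_slicel/shom_smorph.
- exact: sord_nabR.
Qed.

Lemma nabL_sderiv e (h : dmx C m n) : dhomog e h -> sderiv e (nabL e h).
Proof.
move=> he; split=> [f g|c f|f g|e' f fe|d f].
- exact: nabLD.
- exact: nabLZ.
- exact: nabLM.
- rewrite nabLE contrrE; apply/shomZ/shom_sum => x _.
  have [xe|/(dcoef_hom he) ->] := eqVneq (gpar2 x) e; last by rewrite scale0r; exact: shom0.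
  by rewrite -xe -{1}(mpar_var gpar2 x); apply/shomZ/shom_slicer/shom_smorph/shom_sigma.
- exact: sord_nabL.
Qed.

End InvariantSuperderivations.

(** * The scalar product, dual bases and the Casimir tensor *)

Section Duality.
Variables (C : numClosedFieldType) (m n : nat).
Local Notation F2 := (F2 C m n).
Local Notation gpar2 := (@gpar2 m n).
Local Notation ip := (@ipar m n).
Local Notation gm := (@gm C m n).
Local Notation dmx := (dmx C m n).
Implicit Types (c e : bool) (i j k q : 'I_(m + n)) (x y : dmx).

Lemma StrE (M : 'M[C]_(m + n)) : Str M = \sum_i (-1) ^+ ip i * M i i.
Proof.
rewrite big_split_ord /= /Str /mxtrace -sumrN; congr (_ + _); apply: eq_bigr => i _.
  by rewrite ipar_lshift mul1r !mxE.
by rewrite ipar_rshift expr1 mulN1r !mxE.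
Qed.

Lemma Str_mulE (M M' : 'M[C]_(m + n)) :
  Str (M *m M') = \sum_i \sum_j (-1) ^+ ip i * (M i j * M' j i).
Proof. by rewrite StrE; apply: eq_bigr => i _; rewrite mxE mulr_sumr. Qed.

Definition kappa c : C := if c then 'i / 2%:R else - ('i / 2%:R).

Lemma kappa_neq0 c : kappa c != 0.
Proof.
have i2 : ('i / 2%:R : C) != 0 by rewrite mulf_neq0 ?neq0Ci ?invr_neq0 ?pnatr_eq0.
by case: c => //=; rewrite oppr_eq0.
Qed.

Lemma dformE x y : dform x y = \sum_c kappa c * Str (dcomp c x *m dcomp c y).
Proof. by rewrite big_bool /= addrC. Qed.

Lemma dcompE x y : (forall c, dcomp c x = dcomp c y) -> x = y.
Proof. by move=> E; have := E true; have := E false; case: x y {E} => a b [a' b'] /= -> ->. Qed.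

Lemma dcompD c x y : dcomp c (x + y) = dcomp c x + dcomp c y. Proof. by case: c. Qed.
Lemma dcompZ c a x : dcomp c (a *: x) = a *: dcomp c x. Proof. by case: c. Qed.
Lemma dcomp_sum c I (r : seq I) (P : pred I) (F : I -> dmx) :
  dcomp c (\sum_(a <- r | P a) F a) = \sum_(a <- r | P a) dcomp c (F a).
Proof. by apply: (big_morph _ (dcompD c)); case: c. Qed.

Lemma Str_linear a (M M' : 'M[C]_(m + n)) : Str (a *: M + M') = a * Str M + Str M'.
Proof.
rewrite !StrE mulr_sumr -big_split; apply: eq_bigr => i _ /=.
by rewrite !mxE mulrDr mulrCA.
Qed.

Lemma dform_linearl a x x' y : dform (a *: x + x') y = a * dform x y + dform x' y.
Proof.
rewrite !dformE mulr_sumr -big_split; apply: eq_bigr => c _ /=.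
by rewrite dcompD dcompZ mulmxDl -scalemxAl Str_linear mulrDr mulrCA.
Qed.

Lemma dform_linearr a x y y' : dform x (a *: y + y') = a * dform x y + dform x y'.
Proof.
rewrite !dformE mulr_sumr -big_split; apply: eq_bigr => c _ /=.
by rewrite dcompD dcompZ mulmxDr -scalemxAr Str_linear mulrDr mulrCA.
Qed.

Lemma dform0l y : dform 0 y = 0.
Proof. by have := dform_linearl 1 0 0 y; rewrite scale1r add0r mul1r => /eqP; rewrite -subr_eq0 opprD addrA subrr add0r oppr_eq0 => /eqP. Qed.
Lemma dformDl x x' y : dform (x + x') y = dform x y + dform x' y.
Proof. by rewrite -{1}[x]scale1r dform_linearl mul1r. Qed.
Lemma dformDr x y y' : dform x (y + y') = dform x y + dform x y'.
Proof. by rewrite -{1}[y]scale1r dform_linearr mul1r. Qed.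
Lemma dformZl a x y : dform (a *: x) y = a * dform x y.
Proof. by rewrite -[a *: x]addr0 dform_linearl dform0l addr0. Qed.
Lemma dform_suml I (r : seq I) (P : pred I) (F : I -> dmx) y :
  dform (\sum_(a <- r | P a) F a) y = \sum_(a <- r | P a) dform (F a) y.
Proof. exact: (big_morph (fun x => dform x y) (fun a b => dformDl a b y) (dform0l y)). Qed.

Lemma dhomogE e x : dhomog e x <-> forall c i j, ip i (+) ip j != e -> dcomp c x i j = 0.
Proof.
split=> [xe c i j /xe[x1 x2]|xe i j ij]; first by case: c.
by split; [exact: (xe false)|exact: (xe true)].
Qed.

Definition dpart e x : dmx :=
  (\matrix_(i, j) (if ip i (+) ip j == e then x.1 i j else 0),
   \matrix_(i, j) (if ip i (+) ip j == e then x.2 i j else 0)).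

Lemma dcomp_dpart c e x i j :
  dcomp c (dpart e x) i j = if ip i (+) ip j == e then dcomp c x i j else 0.
Proof. by case: c; rewrite mxE. Qed.

Lemma dhomog_dpart e x : dhomog e (dpart e x).
Proof. by apply/dhomogE => c i j /negPf ij; rewrite dcomp_dpart ij. Qed.

Lemma dpart_split x : x = dpart false x + dpart true x.
Proof.
apply: dcompE => c; apply/matrixP => i j; rewrite dcompD mxE !dcomp_dpart.
by case: (_ (+) _); rewrite ?addr0 ?add0r.
Qed.

Lemma dform_hom0 e e' x y : dhomog e x -> dhomog e' y -> e != e' -> dform x y = 0.
Proof.
move=> /dhomogE xe /dhomogE ye ee; rewrite dformE big1 // => c _.
rewrite Str_mulE big1 ?mulr0 // => i _; rewrite big1 // => j _.
have [ij|/xe ->] := eqVneq (ip i (+) ip j) e; last by rewrite mul0r mulr0.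
by rewrite ye ?mulr0 // addbC ij.
Qed.

Lemma dform_dpartr e x y : dhomog e x -> dform x (dpart e y) = dform x y.
Proof.
move=> xe; rewrite [in RHS](dpart_split y) dformDr.
have D e' := @dform_hom0 e e' x _ xe (@dhomog_dpart e' y).
by case: e {xe} D => D; [rewrite (D false) ?add0r|rewrite (D true) ?addr0].
Qed.

Lemma dform_sym e x y : dhomog e x -> dform x y = (-1) ^+ e * dform y x.
Proof.
move=> /dhomogE xe; rewrite !dformE mulr_sumr; apply: eq_bigr => c _.
rewrite mulrCA; congr (_ * _); rewrite !Str_mulE exchange_big mulr_sumr; apply: eq_bigr => j _.
rewrite mulr_sumr; apply: eq_bigr => i _ /=; have [<-|/xe ->] := eqVneq (ip i (+) ip j) e.
  by rewrite [RHS]mulrA -signr_addb -addbA addbb addbF; congr (_ * _); rewrite mulrC.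
by rewrite mul0r !mulr0.
Qed.

Lemma dlieE x : x \in dlie C m n <-> forall c, Str (dcomp c x) = 0.
Proof.
split=> [/dlieP[x1 x2] []//|x0]; apply/dlieP.
by split; [exact: (x0 false)|exact: (x0 true)].
Qed.

Lemma dlie_dpart e x : x \in dlie C m n -> dpart e x \in dlie C m n.
Proof.
move=> /dlieE x0; apply/dlieE => c; case: e.
  by rewrite StrE big1 // => i _; rewrite dcomp_dpart addbb mulr0.
rewrite -[RHS](x0 c) !StrE; apply: eq_bigr => i _.
by rewrite dcomp_dpart addbb.
Qed.

(* The projection of the matrix unit [E_qk] of one of the two factors onto the
   orthogonal of the identity; it lies in [sl(m|n)] as [Str 1 = m - n] is
   nonzero. *)
Definition dunit c q k : dmx :=
  let E := delta_mx q k - ((q == k)%:R * (-1) ^+ ip q / (m%:R - n%:R))%:M in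
  if c then (0, E) else (E, 0).

Lemma dcomp_dunit c c' q k i j : dcomp c (dunit c' q k) i j =
  (c == c')%:R * (((i == q) && (j == k))%:R
    - (q == k)%:R * (-1) ^+ ip q / (m%:R - n%:R) * (i == j)%:R).
Proof. by case: c c' => [] []; rewrite /= !mxE ?mul0r ?mul1r // mulr_natr. Qed.

Lemma Str_scalar (a : C) : Str (a%:M : 'M_(m + n)) = a * (m%:R - n%:R).
Proof.
rewrite StrE big_split_ord /= (eq_bigr (fun=> a)) => [|i _]; last first.
  by rewrite ipar_lshift mul1r mxE eqxx.
rewrite [X in _ + X](eq_bigr (fun=> - a)) => [|i _]; last first.
  by rewrite ipar_rshift expr1 mulN1r mxE eqxx.
by rewrite !sumr_const !card_ord mulrBr !mulr_natr mulNrn.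
Qed.

Lemma Str_delta q k : Str (delta_mx q k : 'M[C]_(m + n)) = (q == k)%:R * (-1) ^+ ip q.
Proof.
rewrite StrE (bigD1 q) //= mxE eqxx big1 => [|i /negPf iq]; last by rewrite mxE iq mulr0.
by rewrite addr0 mulrC eq_sym; congr (_%:R * _).
Qed.

Hypothesis hmn : m <> n.

Let mn_neq0 : (m%:R - n%:R : C) != 0.
Proof. by rewrite subr_eq0 eqr_nat; apply/eqP. Qed.

Lemma dunit_dlie c q k : dunit c q k \in dlie C m n.
Proof.
have E0 : Str (delta_mx q k - ((q == k)%:R * (-1) ^+ ip q / (m%:R - n%:R))%:M : 'M[C]_(m + n)) = 0.
  by rewrite addrC -scaleN1r Str_linear Str_scalar divfK // Str_delta mulN1r addNr.
have S0 : Str (0 : 'M[C]_(m + n)) = 0.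
  by rewrite StrE big1 // => i _; rewrite mxE mulr0.
by apply/dlieE => -[]; case: c.
Qed.

(** The matrix unit reads off one entry of [y], and the scalar correction in [dunit] pairs to zero
    because [y] is supertraceless. This is also how nondegeneracy is used. *)
Lemma dform_dunit c q k y : y \in dlie C m n ->
  dform (dunit c q k) y = kappa c * ((-1) ^+ ip q * dcomp c y k q).
Proof.
move=> /dlieE y0; rewrite dformE (bigD1 c) //= big1 ?addr0 => [|c' /negPf c'c]; last first.
  rewrite Str_mulE big1 ?mulr0 // => i _; rewrite big1 // => j _.
  by rewrite dcomp_dunit c'c !mul0r mulr0.
congr (_ * _).
have -> : dcomp c (dunit c q k) =
    delta_mx q k - ((q == k)%:R * (-1) ^+ ip q / (m%:R - n%:R))%:M by case: (c).
rewrite mulmxBl mul_scalar_mx addrC -scaleNr Str_linear y0 mulr0 add0r StrE.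
rewrite (bigD1 q) //= big1 ?addr0 => [|i iq].
  congr (_ * _); rewrite mxE (bigD1 k) //= mxE !eqxx mul1r big1 ?addr0 // => j jk.
  by rewrite mxE (negPf jk) andbF mul0r.
by rewrite mxE big1 ?mulr0 // => j _; rewrite mxE (negPf iq) mul0r.
Qed.

Variables (N : nat) (h hd : N.-tuple dmx) (par : 'I_N -> bool).
Hypotheses (h_basis : homog_basis h par) (hd_dual : dual_basis h hd).

Lemma h_hom a : dhomog (par a) (tnth h a).
Proof. by case: h_basis => _; apply. Qed.

Lemma h_dlie a : tnth h a \in dlie C m n.
Proof. by case: h_basis => hb _; exact: (basis_mem hb (mem_tnth a h)). Qed.

Lemma hd_dlie a : tnth hd a \in dlie C m n.
Proof. by case: hd_dual => + _; apply. Qed.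

Lemma dlie_expand x : x \in dlie C m n -> x = \sum_a dform x (tnth hd a) *: tnth h a.
Proof.
case: h_basis => hb _ xd.
have xE : x = \sum_a coord h a x *: tnth h a.
  rewrite {1}(coord_basis hb xd); apply: eq_bigr => a _; by rewrite (tnth_nth 0).
rewrite {1}xE; apply: eq_bigr => a _; congr (_ *: _).
rewrite [in RHS]xE dform_suml (bigD1 a) //= dformZl hd_dual.2 eqxx mulr1.
rewrite big1 ?addr0 // => b ba.
by rewrite dformZl hd_dual.2 (negPf ba) mulr0.
Qed.

(** The wrong-parity part [w] is orthogonal to the basis vectors of its own parity by duality and to
    the others because the form is even. It is then orthogonal to all [dunit], so its entries
    vanish. *)
Lemma hd_hom a : dhomog (par a) (tnth hd a).
Proof.
set w := dpart (~~ par a) (tnth hd a).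
have hw b : dform (tnth h b) w = 0.
  have [ba|] := eqVneq (par b) (~~ par a).
    rewrite /w -ba dform_dpartr; last exact: h_hom.
    by rewrite hd_dual.2; case: eqP => // E; rewrite E in ba; case: (par a) ba.
  exact/dform_hom0/dhomog_dpart/h_hom.
have w0 : w = 0.
  have wd : w \in dlie C m n by apply/dlie_dpart/hd_dlie.
  apply: dcompE => c; apply/matrixP => k q.
  have : dform (dunit c q k) w = 0.
    rewrite (dlie_expand (dunit_dlie c q k)) dform_suml big1 // => b _.
    by rewrite dformZl hw mulr0.
  rewrite dform_dunit // => /eqP; rewrite mulf_eq0 (negPf (kappa_neq0 c)) mulf_eq0 signr_eq0.
  by move/eqP => ->; case: c; rewrite mxE.
have -> : tnth hd a = dpart (par a) (tnth hd a).
  by rewrite [LHS]dpart_split; move: w0; rewrite /w; case: (par a) => /= ->; rewrite ?addr0 ?add0r.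
exact: dhomog_dpart.
Qed.

(** The coefficients of [dunit] in the basis [h] are, by [dform_dunit], entries of the dual vectors;
    expanding it sums the Casimir tensor in closed form. *)
Lemma casimir_tensor c c' i p k q :
  \sum_a dcomp c (tnth h a) i p * dcomp c' (tnth hd a) k q =
  (kappa c')^-1 * (-1) ^+ ip q * dcomp c (dunit c' q k) i p.
Proof.
rewrite (dlie_expand (dunit_dlie c' q k)) dcomp_sum summxE mulr_sumr.
apply: eq_bigr => a _; rewrite dcompZ mxE dform_dunit; last exact: hd_dlie.
rewrite [LHS]mulrC !mulrA [_ * kappa c']mulrC !mulrA divff ?kappa_neq0 // mul1r.
by rewrite -signr_addb addbb mul1r.
Qed.

End Duality.

(** * Invariance of the Casimir element, and the bracket on power series *)

Section Casimir.
Variables (C : numClosedFieldType) (m n : nat).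
Local Notation F2 := (F2 C m n).
Local Notation gpar2 := (@gpar2 m n).
Local Notation ip := (@ipar m n).
Local Notation gm := (@gm C m n).
Local Notation dmx := (dmx C m n).
Implicit Types (b c e : bool) (i j k q l : 'I_(m + n)) (x y : dmx) (f g : F2).

(* The left ([b = true]) and right ([b = false]) invariant derivations. *)
Definition nab b e x f : F2 := if b then nabL e x f else nabR x f.

Lemma nab_sderiv b e x : dhomog e x -> sderiv e (nab b e x).
Proof. by case: b => xe; [exact: nabL_sderiv|exact: nabR_sderiv]. Qed.

Lemma nab_sum b e I (r : seq I) (F : I -> dmx) (a : I -> C) f :
  nab b e (\sum_(s <- r) a s *: F s) f = \sum_(s <- r) a s *: nab b e (F s) f.
Proof.
have dE z : dcoef (\sum_(s <- r) a s *: F s) z = \sum_(s <- r) a s * dcoef (F s) z.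
  have [c [i [j ->]]] := copyP z; rewrite dcoef_copy dcomp_sum summxE.
  by apply: eq_bigr => s _; rewrite dcompZ mxE dcoef_copy.
case: b; rewrite /nab ?nabLE /nabR ?contrlE ?contrrE.
  under [RHS]eq_bigr => s _ do rewrite nabLE contrrE scalerA mulrC -scalerA scaler_sumr.
  rewrite -scaler_sumr exchange_big /=; congr (_ *: _); apply: eq_bigr => z _.
  by rewrite dE scaler_suml; apply: eq_bigr => s _; rewrite scalerA.
under [RHS]eq_bigr => s _ do rewrite contrlE scaler_sumr.
rewrite exchange_big /=; apply: eq_bigr => z _.
by rewrite dE scaler_suml; apply: eq_bigr => s _; rewrite scalerA.
Qed.

Hypothesis hmn : m <> n.
Variables (N : nat) (h hd : N.-tuple dmx) (par : 'I_N -> bool).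
Hypotheses (h_basis : homog_basis h par) (hd_dual : dual_basis h hd).

Let Dh b a := nab b (par a) (tnth h a).
Let Dhd b a := nab b (par a) (tnth hd a).

Let DhP b a : sderiv (par a) (Dh b a).
Proof. exact/nab_sderiv/(h_hom h_basis). Qed.
Let DhdP b a : sderiv (par a) (Dhd b a).
Proof. exact/nab_sderiv/(hd_hom hmn h_basis hd_dual). Qed.

Lemma biderT_natl b (k : nat) g : biderT par Dh Dhd b k%:R g = 0.
Proof. by rewrite -[k%:R]scaler_nat (biderT_Zl _ DhP) (biderT_1l _ DhP) scaler0. Qed.
Lemma biderT_natr b (k : nat) f : biderT par Dh Dhd b f k%:R = 0.
Proof. by rewrite -[k%:R]scaler_nat (biderT_Zr _ DhdP) (biderT_1r _ DhdP) scaler0. Qed.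

Lemma biderT_xvar b c i j c' k l :
  biderT par Dh Dhd b (xvar C c i j) (xvar C c' k l) =
  biderT par Dh Dhd b (gm c i j) (gm c' k l).
Proof.
by rewrite !gmE (biderT_Dl _ DhP) !(biderT_Dr _ DhdP) !biderT_natl !biderT_natr !add0r.
Qed.

Let T c c' i p k q := (kappa C c')^-1 * (-1) ^+ ip q * dcomp c (dunit C c' q k) i p.

(** A nonzero entry [(i, p)] of a homogeneous [h_a] forces its parity, so the sign does not depend
    on [a] and the sum over [a] becomes the Casimir tensor. *)
Lemma biderT_gmR c i j c' k l : biderT par Dh Dhd false (gm c i j) (gm c' k l) =
  \sum_p \sum_q ((-1) ^+ ((ip i (+) ip j) && (ip i (+) ip p)) * T c c' i p k q) *:
    (gm c p j * gm c' q l).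
Proof.
transitivity (\sum_p \sum_q \sum_a ((-1) ^+ ((ip i (+) ip j) && (ip i (+) ip p)) *
   (dcomp c (tnth h a) i p * dcomp c' (tnth hd a) k q)) *: (gm c p j * gm c' q l)); last first.
  apply: eq_bigr => p _; apply: eq_bigr => q _.
  by rewrite /T -(casimir_tensor hmn h_basis hd_dual) mulr_sumr scaler_suml.
under eq_bigr => p _ do rewrite exchange_big /=.
rewrite exchange_big /=; apply: eq_bigr => a _.
rewrite (sigma_shom _ (@shom_gm C m n c i j)) (sderivZ (DhP _ _)) /Dh /Dhd /= !nabR_gm.
rewrite -scalerAl mulr_suml scaler_sumr; apply: eq_bigr => p _.
rewrite mulr_sumr scaler_sumr; apply: eq_bigr => q _.
rewrite -scalerAl -scalerAr !scalerA mulrA; congr (_ *: _); congr (_ * _).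
have [<-|/(proj1 (dhomogE _ _) (@h_hom _ _ _ _ _ _ h_basis a) c) ->] := eqVneq (ip i (+) ip p) (par a).
  by rewrite andbC.
by rewrite !mulr0.
Qed.

Lemma biderT_gmL c i j c' k l : biderT par Dh Dhd true (gm c i j) (gm c' k l) =
  \sum_p \sum_q ((-1) ^+ ((ip p (+) ip j) && (ip k (+) ip l)) * T c c' p j q l) *:
    (gm c i p * gm c' k q).
Proof.
transitivity (\sum_p \sum_q \sum_a ((-1) ^+ ((ip p (+) ip j) && (ip k (+) ip l)) *
   (dcomp c (tnth h a) p j * dcomp c' (tnth hd a) q l)) *: (gm c i p * gm c' k q)); last first.
  apply: eq_bigr => p _; apply: eq_bigr => q _.
  by rewrite /T -(casimir_tensor hmn h_basis hd_dual) mulr_sumr scaler_suml.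
under eq_bigr => p _ do rewrite exchange_big /=.
rewrite exchange_big /=; apply: eq_bigr => a _.
rewrite (sigma_shom _ (@shom_gm C m n c i j)) (sderivZ (DhP _ _)) /Dh /Dhd /= !nabL_gm.
rewrite -!scalerAl -!scalerAr !scalerA -!signr_addb mulr_suml scaler_sumr.
apply: eq_bigr => p _; rewrite mulr_sumr scaler_sumr; apply: eq_bigr => q _.
rewrite -scalerAl -scalerAr !scalerA mulrA; congr (_ *: _); congr (_ * _).
have [<-|/(proj1 (dhomogE _ _) (@h_hom _ _ _ _ _ _ h_basis a) c) ->] := eqVneq (ip p (+) ip j) (par a).
  by congr (_ ^+ _ * _); case: (ip p); case: (ip i); case: (ip j); case: (ip k); case: (ip l).
by rewrite !mulr0.
Qed.

Lemma sum2_delta (V : lmodType C) (a b : 'I_(m + n)) (F : 'I_(m + n) -> 'I_(m + n) -> C)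
    (W : 'I_(m + n) -> 'I_(m + n) -> V) :
  \sum_p \sum_q (((p == a) && (q == b))%:R * F p q) *: W p q = F a b *: W a b.
Proof.
rewrite (bigD1 a) //= (bigD1 b) //= !eqxx mul1r.
rewrite [X in _ + X + _]big1 ?addr0 => [|q /negPf qb]; last by rewrite qb mul0r scale0r.
rewrite big1 ?addr0 // => p /negPf pa.
by rewrite big1 // => q _; rewrite pa mul0r scale0r.
Qed.

(** The identity part of the tensor yields the same multiple of [gm c i j * gm c k l] on both sides.
    The flip part yields the entries [(i, l)] and [(k, j)] in opposite orders, and
    supercommutativity reconciles them. Distinct copies do not interact. *)
Lemma casimir_gm c i j c' k l :
  biderT par Dh Dhd true (gm c i j) (gm c' k l) = biderT par Dh Dhd false (gm c i j) (gm c' k l).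
Proof.
rewrite biderT_gmL biderT_gmR /T.
have [cc|cc] := boolP (c == c'); last first.
  rewrite !big1 // => p _; rewrite big1 // => q _;
  by rewrite dcomp_dunit (negPf cc) mul0r !mulr0 scale0r.
move/eqP: cc => <-.
set kk := (kappa C c)^-1; set mn := (m%:R - n%:R : C)^-1.
transitivity (\sum_p \sum_q (((p == l) && (q == j))%:R *
     ((-1) ^+ ((ip p (+) ip j) && (ip k (+) ip l)) * (kk * (-1) ^+ ip l))) *: (gm c i p * gm c k q)
   - \sum_p \sum_q (((p == j) && (q == l))%:R * (kk * mn)) *: (gm c i p * gm c k q)).
  rewrite -sumrB; apply: eq_bigr => p _; rewrite -sumrB; apply: eq_bigr => q _.
  rewrite -scalerBl; congr (_ *: _); rewrite dcomp_dunit eqxx mul1r -/mn.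
  rewrite !mulrBr (eq_sym j) (eq_sym l); congr (_ - _); first ring.
  have [->|_] := eqVneq p j; last by rewrite !mulr0 mul0r.
  have [_|_] := eqVneq q l; last by rewrite !(mul0r, mulr0).
  by rewrite addbb /= !mul1r mulr1 mulrA -(mulrA kk) -signr_addb addbb mulr1.
rewrite !sum2_delta.
transitivity (\sum_p \sum_q (((p == k) && (q == i))%:R *
     ((-1) ^+ ((ip i (+) ip j) && (ip i (+) ip p)) * (kk * (-1) ^+ ip q))) *: (gm c p j * gm c q l)
   - \sum_p \sum_q (((p == i) && (q == k))%:R * (kk * mn)) *: (gm c p j * gm c q l)); last first.
  rewrite -sumrB; apply: eq_bigr => p _; rewrite -sumrB; apply: eq_bigr => q _.
  rewrite -scalerBl; congr (_ *: _); rewrite dcomp_dunit eqxx mul1r -/mn.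
  rewrite !mulrBr (eq_sym i q) [(p == k) && _]andbC; congr (_ - _); first ring.
  rewrite (eq_sym i p); have [->|_] := eqVneq p i; last by rewrite !mulr0 mul0r.
  have [->|_] := eqVneq q k; last by rewrite !(mul0r, mulr0).
  by rewrite addbb andbF /= !mul1r mulr1 mulrA -(mulrA kk) -signr_addb addbb mulr1.
rewrite !sum2_delta; congr (_ - _).
rewrite (smul_shomC (@shom_gm C m n c k j) (@shom_gm C m n c i l)) scalerA; congr (_ *: _).
rewrite ![_ * (kk * _)]mulrCA -mulrA -!signr_addb; congr (_ * _ ^+ _).
by case: (ip i); case: (ip j); case: (ip k); case: (ip l).
Qed.

Lemma casimir f g : bider par Dh Dhd f g = 0.
Proof.
apply: (bider_eq0 DhP DhdP) => x y.
have [c [i [j ->]]] := copyP x; have [c' [k [l ->]]] := copyP y.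
by rewrite /bider -!/(xvar C _ _ _) !biderT_xvar casimir_gm subrr.
Qed.

(** [nab] takes the parity as a separate argument; where [par a] differs from [e] the coefficient
    vanishes, so each basis vector may be used with its own parity. *)
Lemma nab_expand b e x f : x \in dlie C m n -> dhomog e x ->
  nab b e x f = \sum_a dform x (tnth hd a) *: nab b (par a) (tnth h a) f.
Proof.
move=> xd xe; rewrite {1}(dlie_expand h_basis hd_dual xd) nab_sum.
apply: eq_bigr => a _; have [->//|ea] := eqVneq (par a) e.
by rewrite (dform_hom0 xe (@hd_hom _ _ _ hmn _ _ _ _ h_basis hd_dual a)) ?scale0r // eq_sym.
Qed.

(* The Poisson bracket on power series attached to a bilinear form, [f] being
   acted upon by [sigma] to account for the signs. *)
Definition brF (r : 'I_N -> 'I_N -> C) f g : F2 :=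
  \sum_a \sum_s r a s *: (Dh true a (sigma (par a) f) * Dh true s g
                         - Dh false a (sigma (par a) f) * Dh false s g).

Lemma brF_linear (t u : C) r r' f g :
  brF (fun a s => t * r a s + u * r' a s) f g = t *: brF r f g + u *: brF r' f g.
Proof.
rewrite /brF !scaler_sumr -big_split; apply: eq_bigr => a _ /=.
rewrite !scaler_sumr -big_split; apply: eq_bigr => s _ /=.
by rewrite !scalerA -scalerDl.
Qed.

(** The [dform (tnth hd a) (tnth hd s)] are the coordinates of [hd_a] in the basis [h]: the sum over
    [s] rebuilds the derivation along [hd_a] and leaves the Casimir biderivations. *)
Lemma brF_dform f g : brF (fun a s => dform (tnth hd a) (tnth hd s)) f g = 0.
Proof.
rewrite -[RHS](casimir f g) /bider /biderT -sumrB; apply: eq_bigr => a _.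
rewrite /Dhd !(nab_expand _ _ (hd_dlie hd_dual a) (@hd_hom _ _ _ hmn _ _ _ _ h_basis hd_dual a)).
rewrite !mulr_sumr -sumrB; apply: eq_bigr => s _.
by rewrite -!scalerAr -scalerBr.
Qed.

(** For fixed [s] the sum over [a] rebuilds the derivation of [f] along [v s]. Even and odd parts
    are kept apart because both [sigma] and the supersymmetry of the form depend on the parity. *)
Lemma brF_ideal (K : set F2) (v : 'I_N -> dmx) f g : is_ideal K ->
  (forall s, v s \in dlie C m n) ->
  (forall b e s, K (nab b e (dpart e (v s)) (sigma e f))) ->
  K (brF (fun a s => dform (tnth hd a) (v s)) f g).
Proof.
move=> KI vd Kv.
have E b s : \sum_a dform (tnth hd a) (v s) *: Dh b a (sigma (par a) f) =
    \sum_e (-1) ^+ nat_of_bool e *: nab b e (dpart e (v s)) (sigma e f).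
  under [RHS]eq_bigr => e _ do
    rewrite (nab_expand _ _ (dlie_dpart e (vd s)) (@dhomog_dpart _ _ _ e (v s))) scaler_sumr.
  rewrite exchange_big /=; apply: eq_bigr => a _.
  have hda := @hd_hom _ _ _ hmn _ _ _ _ h_basis hd_dual a.
  rewrite (bigD1 (par a)) //= big1 ?addr0 => [|e ea]; last first.
    by rewrite (dform_hom0 (@dhomog_dpart _ _ _ e (v s)) hda) // scale0r scaler0.
  rewrite scalerA; congr (_ *: _).
  by rewrite -(dform_dpartr _ hda) (dform_sym _ hda).
rewrite /brF exchange_big /=; apply: (ideal_sum KI) => s _.
have -> : \sum_a dform (tnth hd a) (v s) *: (Dh true a (sigma (par a) f) * Dh true s g
    - Dh false a (sigma (par a) f) * Dh false s g) =
  (\sum_a dform (tnth hd a) (v s) *: Dh true a (sigma (par a) f)) * Dh true s g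
  - (\sum_a dform (tnth hd a) (v s) *: Dh false a (sigma (par a) f)) * Dh false s g.
  rewrite !mulr_suml -sumrB; apply: eq_bigr => a _.
  by rewrite -!scalerAl -scalerBr.
rewrite !E; apply: (idealB KI); apply: (idealMr KI); apply: (ideal_sum KI) => e _.
  by rewrite -mulr_algl; apply: (idealMl KI).
by rewrite -mulr_algl; apply: (idealMl KI).
Qed.

End Casimir.

(** * Descent to the quotient *)

Section Descent.
Variables (C : numClosedFieldType) (m n : nat).
Local Notation F2 := (F2 C m n).
Local Notation gpar2 := (@gpar2 m n).
Local Notation gm := (@gm C m n).
Local Notation gmi := (@gmi C m n).
Local Notation DU := (@DU C m n).
Local Notation SU := (@SU C m n).
Local Notation D2 := (sseries C (psum gpar2 gpar2)).
Local Notation Hrel := (@H_rel C m n).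
Local Notation Hrel2 := (tens_rel Hrel Hrel).
Local Notation Hsl := (@Hsl C m n).
Local Notation Hsl2 := (@Hsl2 C m n).
Local Notation pi := (\pi_Hsl).
Local Notation pi2 := (\pi_Hsl2).
Implicit Types (b c e : bool) (f g : F2) (x : dmx C m n).

(** * Stability of an ideal that contains the relations of [SL] *)

Section GeneratedIdeal.
Variable T : set F2.
(** By [ideal_gen_pi], the preimage in the power series of the ideal generated by [T] in the
    quotient. *)
Let KT := ideal_gen (Hrel `|` T).
Let KTI : is_ideal KT := ideal_gen_ideal _.

Lemma gen_sdet c : KT (sdet (gm c) - 1).
Proof. by apply: ideal_gen_in; left; apply/H_relP; exists c. Qed.

Lemma gen_T t : T t -> KT t.
Proof. by move=> Tt; apply: ideal_gen_in; right. Qed.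

Lemma gen_sub (K : set F2) : is_ideal K -> (forall c, K (sdet (gm c) - 1)) -> T `<=` K ->
  KT `<=` K.
Proof. by move=> KI Ks KT'; apply: ideal_gen_sub => // f [/H_relP[c ->]|/KT']. Qed.

Lemma gen_sdet_gmi c : KT (sdet (gmi c) - 1).
Proof.
have -> : sdet (gmi c) - 1 = - (sdet (gm c) - 1) * sdet (gmi c).
  by rewrite mulNr mulrBl sdet_gmi mul1r opprB.
by apply: (idealMr KTI); apply: (ideal_opp KTI); exact: gen_sdet.
Qed.

Lemma gen_const : (forall t, T t -> sconst t = 0) -> forall f, KT f -> sconst f = 0.
Proof.
move=> T0; apply: gen_sub => [|c|//].
  split=> [|f g|a f|a f]; rewrite ?rmorph0 ?rmorphB ?rmorphM //=.
  - by move=> -> ->; rewrite subr0.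
  - by move=> ->; rewrite mulr0.
  - by move=> ->; rewrite mul0r.
by rewrite rmorphB rmorph1 /= (sconst_sdet (gmx_gm _ _ _ c)) subrr.
Qed.

Hypothesis Thom : forall t, T t -> exists e, shom e t.

Lemma gen_spart e f : KT f -> KT (spart e f).
Proof.
(* All parities are treated at once, since [spartM] mixes them. *)
move=> Kf; suff : forall s, KT (spart s f) by apply.
move: f Kf; apply: gen_sub => [|c s|t Tt s].
- split=> [s|f g Kf Kg s|a f Kf s|a f Kf s].
  + rewrite (spart_shom s (@shom0 _ _ _ false)); case: ifP => _; exact: (ideal0 KTI).
  + by rewrite spartB; apply: (idealB KTI).
  + by rewrite spartM; apply: (ideal_sum KTI) => i _; apply: (idealMl KTI).
  + by rewrite spartM; apply: (ideal_sum KTI) => i _; apply: (idealMr KTI).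
- rewrite (spart_shom s (shomB (shom_sdet (gmx_gm _ _ _ c)) (@shom1 _ _ _))).
  by case: ifP => _; [exact: gen_sdet|exact: (ideal0 KTI)].
have [e' te] := Thom Tt; rewrite (spart_shom s te).
by case: ifP => _; [exact: gen_T|exact: (ideal0 KTI)].
Qed.

Lemma ideal_scale (K : set F2) a f : is_ideal K -> K f -> K (a *: f).
Proof. by move=> KI Kf; rewrite -mulr_algl; apply: (idealMl KI). Qed.

Lemma gen_sigma e f : KT f -> KT (sigma e f).
Proof.
move=> Kf; rewrite sigma_spart; apply: (ideal_sum KTI) => s _.
by apply: (ideal_scale _ KTI); exact: gen_spart.
Qed.

Lemma gen_SU : (forall t, T t -> KT (smorph SU t)) -> forall f, KT f -> KT (smorph SU f).
Proof.
move=> TS; apply: gen_sub => // [|c]; first exact: ideal_preim.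
by rewrite rmorphB rmorph1 /= SU_sdet; exact: gen_sdet_gmi.
Qed.

Lemma gen_star : (forall t, T t -> KT (sstar t)) -> forall f, KT f -> KT (sstar f).
Proof.
move=> TS; apply: gen_sub => // [|c]; first exact: ideal_preim.
by rewrite rmorphB rmorph1 /= sstar_sdet; exact: gen_sdet_gmi.
Qed.

Lemma gen_nab b e x : x \in dlie C m n -> dhomog e x ->
  (forall t, T t -> KT (nab b e x t)) -> forall f, KT f -> KT (nab b e x f).
Proof.
(* Membership of [f] is carried along because one term of the Leibniz rule leaves [f]
   undifferentiated. *)
move=> /dlieE xd xe Tx f Kf; suff : KT f /\ KT (nab b e x f) by case.
have D := nab_sderiv b xe.
move: f Kf; apply: gen_sub => [|c|t Tt]; last by split; [exact: gen_T|exact: Tx].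
  split=> [|f g [Kf Df] [Kg Dg]|a f [Kf Df]|a f [Kf Df]].
  - split; first exact: (ideal0 KTI).
    by rewrite -(scale0r 0) (sderivZ D) scale0r; exact: (ideal0 KTI).
  - split; first exact: (idealB KTI).
    rewrite (sderivD D) -scaleN1r (sderivZ D) scaleN1r; exact: (idealB KTI).
  - split; first exact: (idealMl KTI).
    by rewrite (sderivM D); apply: (ideal_add KTI); apply: (idealMl KTI).
  - split; first exact: (idealMr KTI).
    by rewrite (sderivM D); apply: (ideal_add KTI); apply: (idealMr KTI) => //; exact: gen_sigma.
split; first exact: gen_sdet.
rewrite (sderivD D) -scaleN1r (sderivZ D) (sderiv1 D) scaler0 addr0.
by case: b {D Tx}; rewrite /nab ?nabL_sdet ?nabR_sdet //; exact: (ideal0 KTI).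
Qed.

(* The ideal [K (x) H + H (x) K] on the level of power series. *)
Definition tens_gen : set D2 :=
  ideal_gen ([set stens k 1 | k in KT] `|` [set stens 1 k | k in KT]).

Lemma tens_genI : is_ideal tens_gen. Proof. exact: ideal_gen_ideal. Qed.

Lemma tens_genl k f : KT k -> tens_gen (stens k f).
Proof.
move=> Kk; rewrite stensE1; apply: (idealMr tens_genI); apply: ideal_gen_in; left.
by exists k.
Qed.

Lemma tens_genr k f : KT k -> tens_gen (stens f k).
Proof.
move=> Kk; rewrite stensE1; apply: (idealMl tens_genI); apply: ideal_gen_in; right.
by exists k.
Qed.

Lemma tens_gen_unit f : KT (f - 1) -> tens_gen (stens f f - 1).
Proof.
move=> Kf; rewrite -stens11.
have -> : stens f f - stens 1 1 = stens (f - 1) f + stens 1 (f - 1) :> D2.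
  by rewrite stensDl stensDr stensNl stensNr addrA subrK.
by apply: (ideal_add tens_genI); [exact: tens_genl|exact: tens_genr].
Qed.

Lemma gen_DU : (forall t, T t -> tens_gen (smorph DU t)) ->
  forall f, KT f -> tens_gen (smorph DU f).
Proof.
move=> TD; apply: gen_sub => // [|c]; first exact: (ideal_preim _ tens_genI).
by rewrite rmorphB rmorph1 /= DU_sdet; apply: tens_gen_unit; exact: gen_sdet.
Qed.

(** Brings contractions down to the quotient. Their Leibniz rule involves the counit slice, whose
    membership is therefore proved simultaneously. *)
Lemma tens_gen_slice b e x : x \in dlie C m n -> dhomog e x ->
  (forall k, KT k -> sconst k = 0) -> (forall k, KT k -> deltaF x k = 0) ->
  forall t, tens_gen t -> KT (if b then contrr (deltaF x) t else contrl (deltaF x) t).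
Proof.
move=> xd xe Kc K0 t Kt.
suff : KT (if b then etar t else etal t) /\
  KT (if b then contrr (deltaF x) t else contrl (deltaF x) t) by case.
move: t Kt; apply: ideal_gen_sub => [|t [] [k Kk <-]].
- split=> [|t u [Kt Ct] [Ku Cu]|a t [Kt Ct]|a t [Kt Ct]].
  + by split; case: b; rewrite raddf0; exact: (ideal0 KTI).
  + by split; case: b Kt Ct Ku Cu => *; rewrite raddfB; exact: (idealB KTI).
  + split; first by case: b Kt Ct => *; rewrite rmorphM; exact: (idealMl KTI).
    case: b Kt Ct => Kt Ct; rewrite ?(contrrM _ _ xe) ?(contrlM _ _ xe); apply: (ideal_add KTI).
    * by apply: (idealMl KTI); exact: gen_sigma.
    * exact: (idealMl KTI).
    * exact: (idealMl KTI).
    * exact: (idealMl KTI).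
  + split; first by case: b Kt Ct => *; rewrite rmorphM; exact: (idealMr KTI).
    case: b Kt Ct => Kt Ct; rewrite ?(contrrM _ _ xe) ?(contrlM _ _ xe); apply: (ideal_add KTI).
    * exact: (idealMr KTI).
    * exact: (idealMr KTI).
    * exact: (idealMr KTI).
    * by apply: (idealMr KTI); exact: gen_sigma.
- have d1 : deltaF x 1 = 0 by exact: (deltaF_nat x 1).
  case: b; rewrite ?etar_stens ?etal_stens ?contrr_stens ?contrl_stens ?d1 ?(K0 k Kk) ?(Kc k Kk) ?scale0r.
    by split; [exact: (ideal_scale _ KTI)|exact: (ideal0 KTI)].
  by split; exact: (ideal0 KTI).
have d1 : deltaF x 1 = 0 by exact: (deltaF_nat x 1).
case: b; rewrite ?etar_stens ?etal_stens ?contrr_stens ?contrl_stens ?d1 ?(K0 k Kk) ?(Kc k Kk) ?scale0r.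
  by split; exact: (ideal0 KTI).
by split; [exact: (ideal_scale _ KTI)|exact: (ideal0 KTI)].
Qed.

End GeneratedIdeal.

Let IH := ideal_gen Hrel.
Let IHI : is_ideal IH := ideal_gen_ideal _.


(** With no extra generator the ideal is the one defining [Hsl], so the stability lemmas also show
    that the structure maps are well defined there. *)
Lemma gen_set0 f : ideal_gen (Hrel `|` set0) f <-> IH f.
Proof.
by split; apply: ideal_gen_sub; rewrite ?setU0 // => g Hg; apply: ideal_gen_in.
Qed.

Lemma tens_gen_set0 t : tens_gen set0 t <-> ideal_gen Hrel2 t.
Proof.
have HI := ideal_gen_ideal Hrel2.
split; move: t; apply: ideal_gen_sub.
- exact: HI.
- move=> _ [] [k /gen_set0 Kk <-].
    apply: (ideal_gen_map (phi := @stensl _ _ _ gpar2 gpar2) HI _ Kk) => s Hs.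
    by apply: ideal_gen_in; left; exists s.
  apply: (ideal_gen_map (phi := @stensr _ _ _ gpar2 gpar2) HI _ Kk) => s Hs.
  by apply: ideal_gen_in; right; exists s.
- exact: tens_genI.
move=> _ [] [k Hk <-]; [apply: tens_genl|apply: tens_genr]; by apply: ideal_gen_in; left.
Qed.

(** The derivation sends [sdet - 1] to a supertrace, which is 0 on [dlie]. Constant terms are
    tracked too, as they are the coefficients in the rule for epsilon-derivations. *)
Lemma deltaF_sl x : x \in dlie C m n -> forall f, IH f -> sconst f = 0 /\ deltaF x f = 0.
Proof.
move=> /dlieE xd; have dM f g : deltaF x (f * g) = deltaF x f * sconst g + sconst f * deltaF x g.
  rewrite !deltaFE mulr_suml mulr_sumr -big_split; apply: eq_bigr => y _.
  rewrite scoefM_var [RHS]/=; ring.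
apply: ideal_gen_sub => [|f /H_relP[c ->]].
  have d0 : deltaF x 0 = 0 by exact: (deltaF_nat x 0).
  split=> [|f g [f0 df] [g0 dg]|a f [f0 df]|a f [f0 df]]; rewrite ?rmorph0 ?rmorphB ?rmorphM /=.
  - by [].
  - by rewrite f0 g0 deltaFB df dg !subr0.
  - by rewrite dM f0 df !mulr0 addr0.
  - by rewrite dM f0 df !mul0r addr0.
split; first by rewrite rmorphB rmorph1 /= (sconst_sdet (gmx_gm _ _ _ c)) subrr.
by rewrite deltaFB deltaF_sdet xd (deltaF_nat x 1) subrr.
Qed.

Let hom0 t : set0 t -> exists e, shom e (t : F2). Proof. by []. Qed.

Lemma hpart_pi e f : hpart e (pi f) = pi (spart e f).
Proof.
apply: (qlift_pi (@spartB _ _ _ e)) => g Hg.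
exact: (proj1 (gen_set0 _) (gen_spart hom0 e (proj2 (gen_set0 g) Hg))).
Qed.

Lemma counit_pi f : counit (pi f) = sconst f.
Proof.
have /gen_set0/(gen_const (T := set0)) E := @quo_reprP _ _ Hrel f.
have : sconst (repr (pi f) - f) = 0 by apply: E.
by rewrite rmorphB /= => /eqP; rewrite subr_eq0 => /eqP.
Qed.

Lemma Delta_pi f : Delta (pi f) = pi2 (smorph DU f).
Proof.
apply: (@qlift_pi _ _ _ Hrel Hrel2 (smorph DU)) => [u v|g Hg]; first exact: rmorphB.
by apply: (proj1 (tens_gen_set0 _)); apply: gen_DU => //; exact: (proj2 (gen_set0 _)).
Qed.

Lemma antipode_pi f : antipode (pi f) = pi (smorph SU f).
Proof.
apply: (@qlift_pi _ _ _ Hrel Hrel (smorph SU)) => [u v|g Hg]; first exact: rmorphB.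
by apply: (proj1 (gen_set0 _)); apply: gen_SU => //; exact: (proj2 (gen_set0 _)).
Qed.

Lemma star_pi f : star (pi f) = pi (sstar f).
Proof.
apply: (@qlift_pi _ _ _ Hrel Hrel (@sstar C m n)) => [u v|g Hg]; first exact: rmorphB.
by apply: (proj1 (gen_set0 _)); apply: gen_star => //; exact: (proj2 (gen_set0 _)).
Qed.

Lemma slice_pi b e x t : x \in dlie C m n -> dhomog e x ->
  qlift Hrel (if b then @contrr C _ _ gpar2 gpar2 (deltaF x) else @contrl C _ _ gpar2 gpar2 (deltaF x)) (pi2 t) =
  pi (if b then contrr (deltaF x) t else contrl (deltaF x) t).
Proof.
move=> xd xe; have K0 := deltaF_sl xd.
have -> : (if b then contrr (deltaF x) t else contrl (deltaF x) t) =
  (if b then contrr (deltaF x) else contrl (deltaF x)) t by case: b.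
apply: qlift_pi => [u v|g Hg]; first by case: b; exact: raddfB.
apply/gen_set0; have := @tens_gen_slice set0 hom0 b e x xd xe.
case: b => /(_ _ _ g) E; apply: E; do ?by move=> k /gen_set0/K0[].
all: exact/tens_gen_set0.
Qed.

Lemma nablaR_pi e x f : x \in dlie C m n -> dhomog e x -> nablaR x (pi f) = pi (nabR x f).
Proof. by move=> xd xe; rewrite /nablaR Delta_pi (slice_pi false _ xd xe). Qed.

Lemma nablaL_pi e x f : x \in dlie C m n -> dhomog e x -> nablaL e x (pi f) = pi (nabL e x f).
Proof.
move=> xd xe; rewrite /nablaL /nabL pi_sum; apply: eq_bigr => s _.
by rewrite hpart_pi Delta_pi (slice_pi true _ xd xe) piZ.
Qed.

Lemma tensH_pi f g : tensH (pi f) (pi g) = pi2 (stens f g).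
Proof.
have If := @quo_reprP _ _ Hrel f; have Ig := @quo_reprP _ _ Hrel g.
have HI := tens_genI set0; apply/pi_eqP/tens_gen_set0.
have -> : stens (repr (pi f)) (repr (pi g)) - stens f g =
   stens (repr (pi f) - f) (repr (pi g)) + stens f (repr (pi g) - g) :> D2.
  by rewrite stensDl stensDr stensNl stensNr addrA subrK.
by apply: (ideal_add HI); [apply: tens_genl|apply: tens_genr]; apply/gen_set0.
Qed.

Section Bracket.
Hypothesis hmn : m <> n.
Variables (N : nat) (h hd : N.-tuple (dmx C m n)) (par : 'I_N -> bool).
Hypotheses (h_basis : homog_basis h par) (hd_dual : dual_basis h hd).

(** The sum over the components of [f] with their signs is exactly [sigma (par a) f], which the
    derivation then acts on. *)
Lemma superbracket_pi f g : superbracket h hd par (pi f) (pi g) =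
  pi (2%:R^-1 *: brF h par (fun a s => dform (Rd (tnth hd a)) (tnth hd s)) f g).
Proof.
have hl a := h_dlie h_basis a; have hh a := @h_hom _ _ _ _ _ _ h_basis a.
rewrite /superbracket piZ; congr (_ *: _).
have E s a l : nablaL (par a) (tnth h a) (hpart s (pi f)) * nablaL (par l) (tnth h l) (pi g)
      - nablaR (tnth h a) (hpart s (pi f)) * nablaR (tnth h l) (pi g) =
    pi (nab true (par a) (tnth h a) (spart s f) * nab true (par l) (tnth h l) g -
        nab false (par a) (tnth h a) (spart s f) * nab false (par l) (tnth h l) g).
  rewrite hpart_pi !(nablaL_pi _ (hl _) (hh _)) (nablaR_pi _ (hl a) (hh a)).
  by rewrite (nablaR_pi _ (hl l) (hh l)) piB !piM.
under eq_bigr => s _ do under eq_bigr => a _ do under eq_bigr => l _ do rewrite E -piZ.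
under eq_bigr => s _ do under eq_bigr => a _ do rewrite -pi_sum.
under eq_bigr => s _ do rewrite -pi_sum.
rewrite -pi_sum; congr pi; rewrite exchange_big; apply: eq_bigr => a _ /=.
rewrite exchange_big; apply: eq_bigr => l _ /=.
have D b := nab_sderiv b (hh a).
have sE b : nab b (par a) (tnth h a) (sigma (par a) f) =
   \sum_(s : bool) (-1) ^+ (par a && s) *: nab b (par a) (tnth h a) (spart s f).
  by rewrite sigma_spart !big_bool (sderivD (D b)) !(sderivZ (D b)).
rewrite (sE true : nabL _ _ _ = _) (sE false : nabR _ _ = _) !mulr_suml -sumrB scaler_sumr; apply: eq_bigr => s _.
by rewrite -!scalerAl -scalerBr scalerA mulrC andbC.
Qed.

Variable (T : set F2) (K : set Hsl).
Let KT := ideal_gen (Hrel `|` T).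
Let KTI : is_ideal KT := ideal_gen_ideal _.

(* A Poisson ideal is recognized on generators, the bracket being equal, up to
   a multiple of the (vanishing) Casimir term, to one in which only derivations
   along the [v s] act on the first factor. *)
Lemma PL_sub_supergroupI (v : 'I_N -> dmx C m n) (a0 a1 : C) :
  is_ideal K -> (forall f, K (pi f) <-> KT f) ->
  (forall t, T t -> exists e, shom e t) ->
  (forall t, T t -> sconst t = 0) ->
  (forall t, T t -> tens_gen T (smorph DU t)) ->
  (forall t, T t -> KT (smorph SU t)) ->
  (forall t, T t -> KT (sstar t)) ->
  (forall s, v s \in dlie C m n) ->
  (forall b e s t, T t -> KT (nab b e (dpart e (v s)) t)) ->
  (forall a s, dform (Rd (tnth hd a)) (tnth hd s) =
    a0 * dform (tnth hd a) (tnth hd s) + a1 * dform (tnth hd a) (v s)) ->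
  is_PL_sub_supergroup (superbracket h hd par) K.
Proof.
move=> KI KE Thom T0 TD TS Tstar vd Tnab Rv; split; [split|..] => //.
- move=> e; elim/quoW=> f /KE Kf; rewrite hpart_pi; apply: (proj2 (KE _)).
  exact: (gen_spart Thom).
- by elim/quoW=> f /KE Kf; rewrite counit_pi; exact: (gen_const T0).
- elim/quoW=> f /KE Kf; rewrite Delta_pi.
  have TI : is_ideal (tens_ideal K) := ideal_gen_ideal _.
  have : tens_gen T (smorph DU f) by exact: gen_DU.
  move: (smorph DU f); apply: (ideal_gen_map (phi := @qpi _ _ Hrel2) TI).
  move=> _ [] [k /KE Kk <-]; apply: ideal_gen_in; [left|right].
    by exists (pi k), (pi 1); rewrite tensH_pi.
  by exists (pi 1), (pi k); rewrite tensH_pi.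
- elim/quoW=> f /KE Kf; rewrite antipode_pi; apply: (proj2 (KE _)).
  exact: gen_SU.
- elim/quoW=> f /KE Kf; rewrite star_pi; apply: (proj2 (KE _)).
  exact: gen_star.
elim/quoW=> f; elim/quoW=> g /KE Kf; rewrite superbracket_pi; apply/KE.
apply: (ideal_scale _ KTI).
have -> : brF h par (fun a s => dform (Rd (tnth hd a)) (tnth hd s)) f g =
   a0 *: brF h par (fun a s => dform (tnth hd a) (tnth hd s)) f g
   + a1 *: brF h par (fun a s => dform (tnth hd a) (v s)) f g.
  rewrite -brF_linear; apply: eq_bigr => a _; apply: eq_bigr => s _.
  by rewrite Rv.
rewrite (brF_dform hmn h_basis hd_dual) scaler0 add0r; apply: (ideal_scale _ KTI).
apply: (brF_ideal hmn h_basis hd_dual) => // b e s.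
apply: (gen_nab Thom) => //; last exact: (gen_sigma Thom).
- exact: dlie_dpart.
- exact: dhomog_dpart.
- by move=> t; apply: Tnab.
Qed.

End Bracket.

End Descent.

(** * The Manin triple *)

Section ManinTriple.
Variables (C : numClosedFieldType) (m n : nat).
Local Notation ip := (@ipar m n).
Local Notation dmx := (dmx C m n).
Local Notation dlie := (dlie C m n).
Local Notation glie := (glie C m n).
Local Notation blie := (blie C m n).
Implicit Types (c e : bool) (i j k : 'I_(m + n)) (x y : dmx).

(* The entry [(i, j)] of the component [c] vanishes on [blie]: the component
   [false] is lower triangular and the component [true] is upper triangular. *)
Definition rk c i : nat := if c then (m + n - i)%N else i.
Definition off c i j := (rk c i < rk c j)%N.

(** The two copies have transposed shapes. Hence the star, which exchanges the copies and
    transposes, preserves the triangular ideal. *)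
Lemma off_neg c i j : off (~~ c) i j = off c j i.
Proof. by case: c; rewrite /off /= ?ltn_sub2lE // ltnW. Qed.

(** In a matrix product, every term of an entry required to vanish has a factor required to
    vanish. *)
Lemma off_cotrans c i j k : off c i j -> off c i k || off c k j.
Proof. by rewrite /off; case: (ltnP (rk c i) (rk c k)) => //= ki ij; exact: leq_ltn_trans ki ij. Qed.

Lemma off_total c i j : i != j -> off c i j || off c j i.
Proof.
rewrite /off -neq_ltn; apply: contra => /eqP; case: c => /= [E|/val_inj->//].
by apply/eqP/val_inj; have := congr1 (subn (m + n)) E; rewrite !subKn // ltnW.
Qed.

Lemma off_neq c i j : off c i j -> i != j.
Proof. by rewrite /off; case: eqP => // ->; rewrite ltnn. Qed.

Lemma blieE x : x \in blie -> [/\ x \in dlie,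
  forall c i j, off c i j -> dcomp c x i j = 0 &
  forall i, dcomp false x i i + dcomp true x i i = 0].
Proof.
case/blieP => xd x1 x2 x0; split=> // -[] i j; rewrite -[off _ _ _]negbK.
  by rewrite negbK -[true]/(~~ false) off_neg; exact: x2.
by rewrite negbK; exact: x1.
Qed.

Lemma glieE x : x \in glie -> [/\ x \in dlie & dcomp false x = dcomp true x].
Proof. by case/glieP. Qed.

Lemma glie_isotropic x y : x \in glie -> y \in glie -> dform x y = 0.
Proof.
by move=> /glieE[_ x12] /glieE[_ y12]; rewrite dformE big_bool x12 y12 /= mulNr addrN.
Qed.

(** Only diagonal entries contribute to the supertrace of a product of triangular matrices. The
    diagonals of the two components are opposite, so both supertraces agree, while the form weights
    them with opposite signs. *)
Lemma blie_isotropic x y : x \in blie -> y \in blie -> dform x y = 0.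
Proof.
move=> /blieE[_ xo xd] /blieE[_ yo yd].
have StrD c : Str (dcomp c x *m dcomp c y) = \sum_i (-1) ^+ ip i * (dcomp c x i i * dcomp c y i i).
  rewrite Str_mulE; apply: eq_bigr => i _; rewrite (bigD1 i) //= big1 ?addr0 // => j ji.
  by case/orP: (off_total c ji) => [/yo|/xo] ->; rewrite ?mul0r !mulr0.
have E i : dcomp true x i i * dcomp true y i i = dcomp false x i i * dcomp false y i i.
  have /eqP := xd i; rewrite addr_eq0 => /eqP ->; have /eqP := yd i; rewrite addr_eq0 => /eqP ->.
  by rewrite mulrNN.
have E' : Str (dcomp true x *m dcomp true y) = Str (dcomp false x *m dcomp false y).
  by rewrite !StrD; apply: eq_bigr => i _; rewrite E.
by rewrite dformE big_bool E' /= mulNr addrN.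
Qed.

Lemma glie_blie_cap : (glie :&: blie = 0)%VS.
Proof.
apply/eqP; rewrite -subv0; apply/subvP => x; rewrite memv_cap => /andP[/glieE[_ x12] /blieE[_ xo xd]].
rewrite memv0; apply/eqP/dcompE => c; have xc : dcomp c x = dcomp false x by case: c.
apply/matrixP => i j; have -> : dcomp c (0 : dmx) i j = 0 by case: c {xc}; rewrite mxE.
rewrite xc; have [<-|/(off_total false)/orP[/xo //|]] := eqVneq i j.
  by have /eqP := xd i; rewrite -x12 -mulr2n mulrn_eq0 => /eqP.
by move=> ji; rewrite x12; apply: xo; rewrite -[true]/(~~ false) off_neg.
Qed.

Lemma dlie_sub : (dlie <= glie + blie)%VS.
Proof.
apply/subvP => x /dlieE xd.
(* The diagonal component is forced: off the diagonal it is the entry of [x] in the copy where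
   [blie] vanishes, and on the diagonal the mean of the two entries. *)
pose g : 'M[C]_(m + n) := \matrix_(i, j) if (i < j)%N then x.1 i j
  else if (j < i)%N then x.2 i j else (x.1 i j + x.2 i j) / 2%:R.
have gS : Str g = 0.
  have : 2%:R * Str g = Str x.1 + Str x.2.
    rewrite !StrE mulr_sumr -big_split; apply: eq_bigr => i _ /=.
    by rewrite mxE ltnn mulrCA [2%:R * _]mulrC divfK ?pnatr_eq0 // mulrDr.
  rewrite (xd false) (xd true) addr0 => /eqP; rewrite mulf_eq0 pnatr_eq0 /= => /eqP //.
have gd : (g, g) \in dlie by apply/dlieE => -[].
have -> : x = (g, g) + (x - (g, g)) by rewrite addrC subrK.
apply: memv_add; first exact/glieP.
have xg : x - (g, g) \in dlie by apply: memvB => //; exact/dlieE.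
apply/blieP; split=> // [i j ij|i j ji|i]; rewrite !mxE.
- by rewrite ij subrr.
- by rewrite ji ltnNge ltnW // subrr.
by rewrite ltnn addrACA -opprD -splitr subrr.
Qed.

Lemma daddv_pi_dec x : x \in dlie -> daddv_pi glie blie x + daddv_pi blie glie x = x.
Proof. by move=> /(subvP dlie_sub); exact: (daddv_pi_add glie_blie_cap). Qed.

(** By isotropy the form sees only [(xb, yg)] and [(xg, yb)]: their sum is [(x, y)], their
    difference is the left-hand side, and each of them is a pairing of [x] with one component of
    [y]. *)
Lemma dform_Manin x y xg xb yg yb : xg \in glie -> xb \in blie -> yg \in glie -> yb \in blie ->
  xg + xb = x -> yg + yb = y ->
  dform (xb - xg) y = -1 * dform x y + 2%:R * dform x yg
  /\ dform (xb - xg) y = 1 * dform x y + - 2%:R * dform x yb.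
Proof.
move=> gx bx gy by' <- <-; rewrite -scaleN1r !dformDl !dformDr !dformZl.
rewrite (glie_isotropic gx gy) (blie_isotropic bx by'); split; ring.
Qed.

Lemma dform_Rd_glie x y : x \in dlie -> y \in dlie ->
  dform (Rd x) y = -1 * dform x y + 2%:R * dform x (daddv_pi glie blie y).
Proof.
move=> xd yd; exact: (dform_Manin (memv_pi _ _ x) (memv_pi _ _ x) (memv_pi _ _ y)
  (memv_pi _ _ y) (daddv_pi_dec xd) (daddv_pi_dec yd)).1.
Qed.

Lemma dform_Rd_blie x y : x \in dlie -> y \in dlie ->
  dform (Rd x) y = 1 * dform x y + - 2%:R * dform x (daddv_pi blie glie y).
Proof.
move=> xd yd; exact: (dform_Manin (memv_pi _ _ x) (memv_pi _ _ x) (memv_pi _ _ y)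
  (memv_pi _ _ y) (daddv_pi_dec xd) (daddv_pi_dec yd)).2.
Qed.

End ManinTriple.

(** * The two subgroups *)

Lemma ideal_gen_eq (A : pzRingType) (S S' : set A) :
  S `<=` ideal_gen S' -> S' `<=` ideal_gen S -> forall x, ideal_gen S x <-> ideal_gen S' x.
Proof.
by move=> SS' S'S x; split; apply: ideal_gen_sub => //; exact: ideal_gen_ideal.
Qed.

Lemma mx_subE (V : zmodType) a b (M M' : 'M[V]_(a, b)) i j : (M - M') i j = M i j - M' i j.
Proof. by rewrite !mxE. Qed.

(** The resolvent identity: matrices congruent modulo an ideal have congruent inverses. *)
Lemma mx_inv_sub (A : pzRingType) a (M M' N N' : 'M[A]_a) :
  N *m M = 1%:M -> M' *m N' = 1%:M -> N - N' = N *m (M' - M) *m N'.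
Proof.
by move=> NM MN'; rewrite mulmxBr mulmxBl NM mul1mx -mulmxA MN' mulmx1.
Qed.

Section Subgroups.
Variables (C : numClosedFieldType) (m n : nat).
Local Notation F2 := (F2 C m n).
Local Notation gpar2 := (@gpar2 m n).
Local Notation ip := (@ipar m n).
Local Notation gm := (@gm C m n).
Local Notation gmi := (@gmi C m n).
Local Notation DU := (@DU C m n).
Local Notation SU := (@SU C m n).
Local Notation xvar := (@xvar C m n).
Local Notation Hrel := (@H_rel C m n).
Local Notation dlie := (dlie C m n).
Local Notation glie := (glie C m n).
Local Notation blie := (blie C m n).
Local Notation pi := (\pi_(Hsl C m n)).
Implicit Types (b c e : bool) (f g : F2) (i j k : 'I_(m + n)) (x : dmx C m n).

Lemma xvar_gm c i j : xvar c i j = gm c i j - (i == j)%:R.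
Proof. by rewrite gmE addrC addKr. Qed.

Lemma xvar_gm_neq c i j : i != j -> xvar c i j = gm c i j.
Proof. by rewrite xvar_gm => /negPf->; rewrite subr0. Qed.

Lemma sconst_gm c i j : sconst (gm c i j) = (i == j)%:R.
Proof. by rewrite gmE rmorphD rmorph_nat /= sconst_xvar addr0. Qed.

Lemma DU_gmE c i j : smorph DU (gm c i j) = \sum_k stens (gm c i k) (gm c k j).
Proof.
have /matrixP/(_ i j) := @DU_gm C m n c; rewrite mxE => ->; rewrite mxE.
by apply: eq_bigr => k _; rewrite mxE [X in _ * X]mxE [RHS]stensE1.
Qed.

Lemma SU_gmE c i j : smorph SU (gm c i j) = gmi c i j.
Proof. by have /matrixP/(_ i j) := @SU_gm C m n c; rewrite mxE. Qed.

Lemma sstar_gmE c i j :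
  sstar (gm c i j) = (-1) ^+ ((ip i (+) ip j) && ip j) *: gmi (~~ c) j i.
Proof.
have /matrixP/(_ i j) := @sstar_gm C m n c; rewrite mxE => ->; rewrite mxE.
by case: (_ && _); rewrite ?mul1r ?scale1r // expr1 mulN1r scaleN1r.
Qed.

Lemma nabB b e x f g : nab b e x (f - g) = nab b e x f - nab b e x g.
Proof. by case: b; [exact: nabLB|exact: nabRB]. Qed.

Lemma nab_gmE b e x c i j : nab b e x (gm c i j) =
  if b then (-1) ^+ (e && ~~ (ip i (+) ip j)) *: \sum_k dcomp c x k j *: gm c i k
  else \sum_k dcomp c x i k *: gm c k j.
Proof. by case: b; [exact: nabL_gm|exact: nabR_gm]. Qed.

Lemma nab_nat b e x (k : nat) : nab b e x k%:R = 0.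
Proof. by case: b; [exact: nabL_nat|exact: nabR_nat]. Qed.

(** ** The diagonal subgroup *)

Definition SU_gens : set F2 := [set t | exists i j, t = xvar false i j - xvar true i j].
Local Notation KG := (ideal_gen (Hrel `|` SU_gens)).

Lemma SU_idealE f : @SU_ideal C m n (pi f) <-> KG f.
Proof.
rewrite -ideal_gen_pi; apply: ideal_gen_eq => [_ [i [j ->]]|_ [_ [i [j ->]] <-]].
  apply: ideal_gen_in; exists (xvar false i j - xvar true i j); first by exists i, j.
  exact: piB.
by apply: ideal_gen_in; exists i, j; exact: piB.
Qed.

Let KGI : is_ideal KG := ideal_gen_ideal _.

Lemma KG_gm i j : KG (gm false i j - gm true i j).
Proof.
apply: gen_T; exists i, j; by rewrite !xvar_gm opprB addrA subrK.
Qed.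

Lemma SU_gmE0 i j : xvar false i j - xvar true i j = gm false i j - gm true i j.
Proof. by rewrite !xvar_gm opprB addrA subrK. Qed.

Lemma KG_gmi i j : KG (gmi false i j - gmi true i j).
Proof.
have [_ N0 _] := gmiP C m n false; have [M1 _ _] := gmiP C m n true.
rewrite -mx_subE (mx_inv_sub N0 M1).
rewrite mxE; apply: (ideal_sum KGI) => k _; apply: (idealMr KGI).
rewrite mxE; apply: (ideal_sum KGI) => l _; apply: (idealMl KGI).
by rewrite mx_subE -opprB; apply: (ideal_opp KGI); exact: KG_gm.
Qed.

Section WithBracket.
Hypothesis hmn : m <> n.
Variables (N : nat) (h hd : N.-tuple (dmx C m n)) (par : 'I_N -> bool).
Hypotheses (h_basis : homog_basis h par) (hd_dual : dual_basis h hd).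

Lemma SU_PL_sub_supergroup :
  is_PL_sub_supergroup (superbracket h hd par) (@SU_ideal C m n).
Proof.
have hdd s := hd_dlie hd_dual s.
have vg (s : 'I_N) : daddv_pi glie blie (tnth hd s) \in glie by exact: memv_pi.
apply: (PL_sub_supergroupI hmn h_basis hd_dual (T := SU_gens)
  (v := fun s => daddv_pi glie blie (tnth hd s)) (a0 := -1) (a1 := 2%:R)).
- exact: ideal_gen_ideal.
- exact: SU_idealE.
- move=> _ [i [j ->]]; exists (ip i (+) ip j).
  by apply: shomB; exact: shom_xvar.
- move=> _ [i [j ->]]; rewrite SU_gmE0 rmorphB.
  by rewrite /= !sconst_gm subrr.
- move=> _ [i [j ->]]; rewrite SU_gmE0 rmorphB /= !DU_gmE -sumrB.
  apply: (ideal_sum (tens_genI _)) => k _.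
  have -> : stens (gm false i k) (gm false k j) - stens (gm true i k) (gm true k j) =
    stens (gm false i k - gm true i k) (gm false k j)
    + stens (gm true i k) (gm false k j - gm true k j) :> sseries C (psum gpar2 gpar2).
    by rewrite stensDl stensDr stensNl stensNr addrA subrK.
  by apply: (ideal_add (tens_genI _)); [apply: tens_genl|apply: tens_genr]; exact: KG_gm.
- by move=> _ [i [j ->]]; rewrite SU_gmE0 rmorphB /= !SU_gmE; exact: KG_gmi.
- move=> _ [i [j ->]]; rewrite SU_gmE0 rmorphB /= !sstar_gmE -scalerBr /=.
  by apply: (ideal_scale _ KGI); rewrite -opprB; apply: (ideal_opp KGI); exact: KG_gmi.
- by move=> s; have [] := glieE (vg s).
(* An element of [glie] acts by the same matrix on both copies, so a difference of the copies is
   differentiated into a combination of such differences. *)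
- move=> b e s _ [i [j ->]]; rewrite SU_gmE0 nabB !nab_gmE.
  have xx k l : dcomp true (dpart e (daddv_pi glie blie (tnth hd s))) k l =
      dcomp false (dpart e (daddv_pi glie blie (tnth hd s))) k l.
    by rewrite !dcomp_dpart; have [_ ->] := glieE (vg s).
  case: b; rewrite -?scalerBr -sumrB; do 1?apply: (ideal_scale _ KGI);
  apply: (ideal_sum KGI) => k _; rewrite xx -scalerBr; apply: (ideal_scale _ KGI); exact: KG_gm.
- by move=> a s; apply: dform_Rd_glie.
Qed.

End WithBracket.

(** ** The triangular subgroup *)

(** The torus relation is written as a product equal to 1, symmetric in the two copies, rather than
    through the antipode; modulo the triangular relations the two forms are equivalent by
    [gmi_gm_diag]. *)
Definition AN_gens : set F2 := [set t | exists c i j, off c i j /\ t = xvar c i j]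
  `|` [set t | exists i, t = gm false i i * gm true i i - 1].
Local Notation KB := (ideal_gen (Hrel `|` AN_gens)).

Section Triangular.
Variables (K : set F2) (KI : is_ideal K).
Hypothesis Koff : forall c i j, off c i j -> K (gm c i j).

Lemma gm_diag_unit c i : exists y, y * gm c i i = 1.
Proof.
have [|y [_ yx]] := @ring_inv_exists _ _ _ (gm c i i); last by exists y.
by rewrite gmE eqxx rmorphD rmorph1 /= sconst_xvar addr0.
Qed.

(** In the entry [(i, j)] of [g g^-1 = 1] every term with [k] different from [i] lies in [K], by
    triangularity of [g] or by induction on the rank of the row; the diagonal entry left over is a
    unit. *)
Lemma gmi_off c i j : off c i j -> K (gmi c i j).
Proof.
have [d] := ubnP (rk c i); elim: d i => // d IH i id ij.
have [y yx] := gm_diag_unit c i.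
suff : K (gm c i i * gmi c i j).
  by move=> /(idealMl KI y); rewrite mulrA yx mul1r.
have [MN _ _] := gmiP C m n c; have /matrixP/(_ i j) := MN.
rewrite !mxE (negPf (off_neq ij)) (bigD1 i) //= => /eqP; rewrite addr_eq0 => /eqP->.
apply: (ideal_opp KI); apply: (ideal_sum KI) => k ki.
have [ik|ki'] := orP (off_total c ki).
  apply: (idealMl KI); apply: IH; first exact: leq_trans ik _.
  exact: ltn_trans ij.
by apply: (idealMr KI); exact: Koff.
Qed.

Lemma gm_gmi_diag c i : K (gm c i i * gmi c i i - 1).
Proof.
have [MN _ _] := gmiP C m n c.
have MNi : (gm c *m gmi c) i i = 1 by rewrite MN mxE eqxx.
rewrite -MNi mxE (bigD1 i) //= opprD addrA subrr add0r.
apply: (ideal_opp KI); apply: (ideal_sum KI) => k ki.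
have [ik|ki'] := orP (off_total c ki).
  by apply: (idealMl KI); exact: gmi_off.
by apply: (idealMr KI); exact: Koff.
Qed.

Lemma gmi_even c i : shom false (gmi c i i).
Proof. by have [_ _ [gi _]] := gmiP C m n c; have := gi i i; rewrite addbb. Qed.

Lemma gm_even c i : shom false (gm c i i).
Proof. by have := @shom_gm C m n c i i; rewrite addbb. Qed.

Lemma gmi_gm_diag i :
  K (gmi false i i - gm true i i) <-> K (gm false i i * gm true i i - 1).
Proof.
have G := gm_gmi_diag false i; set a := gm false i i; set a' := gmi false i i; set d := gm true i i.
have aC : a' * a = a * a' := smul_evenC _ (gm_even false i).
split=> E.
  have -> : a * d - 1 = - (a * (a' - d)) + (a * a' - 1).
    by rewrite mulrBr opprB addrA subrK.
  by apply: (ideal_add KI) => //; apply: (ideal_opp KI); exact: (idealMl KI).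
have -> : a' - d = - (a' * (a * d - 1)) + (a * a' - 1) * d.
  by rewrite mulrBr mulrBl mulr1 mul1r opprB mulrA aC addrA subrK.
apply: (ideal_add KI); first by apply: (ideal_opp KI); exact: (idealMl KI).
exact: (idealMr KI).
Qed.

Lemma gmi_diag i : K (gm false i i * gm true i i - 1) -> K (gmi false i i * gmi true i i - 1).
Proof.
set a := gm false i i; set d := gm true i i; set a' := gmi false i i; set d' := gmi true i i.
move=> E.
have -> : a' * d' - 1 = - (a * d - 1) * (a' * d') + ((a * a') * (d * d') - 1 * 1).
  have -> : a * a' * (d * d') = a * d * (a' * d').
    by rewrite -!mulrA; congr (_ * _); rewrite !mulrA (smul_evenC a' (gm_even true i)).
  by rewrite mulNr mulrBl mul1r opprB mulr1 addrA subrK.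
apply: (ideal_add KI); first by apply: (idealMr KI); exact: (ideal_opp KI).
by apply: (ideal_mulB KI); exact: gm_gmi_diag.
Qed.

End Triangular.

Lemma AN_idealE f : @AN_ideal C m n (pi f) <-> KB f.
Proof.
(* The generators of the Hopf ideal as originally given, with the antipode rewritten as an entry of
   the inverse matrix. *)
pose T' : set F2 := [set t | exists c i j, off c i j /\ t = xvar c i j]
  `|` [set t | exists i, t = gmi false i i - gm true i i].
have offE c i j : off c i j = (if c then (j < i)%N else (i < j)%N).
  by case: c => //; rewrite -[true]/(~~ false) off_neg.
have anti i : antipode (yvar C i i) - zvar C i i = pi (gmi false i i - gm true i i).
  rewrite /yvar antipode_pi smorph_svar -piB; congr (pi _).
  rewrite -[ssubfun _ _]/(@antipode_gen C m n false i i) antipode_genE -addrA -opprD.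
  by rewrite gmE.
have Koff (S : set F2) : T' `<=` S \/ AN_gens `<=` S ->
    forall c i j, off c i j -> ideal_gen (Hrel `|` S) (gm c i j).
  move=> TS c i j ij; rewrite -(xvar_gm_neq _ (off_neq ij)); apply: gen_T.
  by case: TS; apply; left; exists c, i, j.
have SI S := ideal_gen_ideal (Hrel `|` S).
rewrite (_ : KB f <-> ideal_gen (Hrel `|` T') f); last first.
  apply: ideal_gen_eq => t [Ht|[Ht|[i ->]]]; do ?by apply: ideal_gen_in; left.
  - by apply: gen_T; left.
  - apply/(gmi_gm_diag (SI T')); first by apply: Koff; left.
    by apply: gen_T; right; exists i.
  - by apply: gen_T; left.
  - apply/(gmi_gm_diag (SI AN_gens)); first by apply: Koff; right.
    by apply: gen_T; right; exists i.
rewrite -ideal_gen_pi; apply: ideal_gen_eq => [_ [[i [j [ji [->|->]]]]|[i ->]]|_ [_ [[c [i [j [ij ->]]]]|[i ->]] <-]].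
- apply: ideal_gen_in; exists (xvar false j i) => //; left; exists false, j, i; by rewrite offE.
- apply: ideal_gen_in; exists (xvar true i j) => //; left; exists true, i, j; by rewrite offE.
- by rewrite anti; apply: ideal_gen_in; exists (gmi false i i - gm true i i) => //; right; exists i.
- apply: ideal_gen_in; left; move: ij; rewrite offE; case: c => ij.
    by exists i, j; split=> //; right.
  by exists j, i; split=> //; left.
by apply: ideal_gen_in; right; exists i; rewrite anti.
Qed.

Let KBI : is_ideal KB := ideal_gen_ideal _.

Lemma KB_off c i j : off c i j -> KB (gm c i j).
Proof.
move=> ij; rewrite -(xvar_gm_neq _ (off_neq ij)); apply: gen_T; left.
by exists c, i, j.
Qed.

Lemma KB_diag i : KB (gm false i i * gm true i i - 1).
Proof. by apply: gen_T; right; exists i. Qed.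

Section WithBracket.
Hypothesis hmn : m <> n.
Variables (N : nat) (h hd : N.-tuple (dmx C m n)) (par : 'I_N -> bool).
Hypotheses (h_basis : homog_basis h par) (hd_dual : dual_basis h hd).

(** Diagonal entries are group-like modulo the ideal: each term with [k] different from [i] has an
    off-diagonal factor that vanishes there. *)
Lemma tens_gm_diag c i :
  tens_gen AN_gens (smorph DU (gm c i i) - stens (gm c i i) (gm c i i)).
Proof.
rewrite DU_gmE (bigD1 i) //= addrAC subrr add0r; apply: (ideal_sum (tens_genI _)) => k ki.
have [ik|ki'] := orP (off_total c ki).
  by apply: tens_genr; exact: KB_off.
by apply: tens_genl; exact: KB_off.
Qed.

(** Diagonal entries are eigenvectors of the field modulo the ideal. The sign is [(-1)^(|h|(|f|+1))]
    of the left field, taken at an even function. *)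
Lemma nab_gm_diag b e x c i : dhomog e x -> (forall c i j, off c i j -> dcomp c x i j = 0) ->
  KB (nab b e x (gm c i i) - (if b && e then -1 else 1) * dcomp c x i i *: gm c i i).
Proof.
move=> xe xo; rewrite nab_gmE addbb andbT.
have E (F : 'I_(m + n) -> F2) (a : C) : (forall k, k != i -> KB (F k)) -> F i = dcomp c x i i *: gm c i i ->
    KB (a *: \sum_k F k - a * dcomp c x i i *: gm c i i).
  move=> KF Fi; rewrite -scalerA -scalerBr; apply: (ideal_scale _ KBI).
  by rewrite (bigD1 i) //= Fi addrAC subrr add0r; exact: (ideal_sum KBI).
case: b.
  have -> : (if true && e then -1 else 1) = (-1) ^+ e :> C by case: (e); rewrite ?expr1.
  apply: E => // k ki; case/orP: (off_total c ki) => ki'.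
    by rewrite xo // scale0r; exact: (ideal0 KBI).
  by apply: (ideal_scale _ KBI); exact: KB_off.
rewrite -[X in X - _]scale1r; apply: E => // k ki; case/orP: (off_total c ki) => ki'.
  by apply: (ideal_scale _ KBI); exact: KB_off.
by rewrite xo // scale0r; exact: (ideal0 KBI).
Qed.

Lemma AN_PL_sub_supergroup :
  is_PL_sub_supergroup (superbracket h hd par) (@AN_ideal C m n).
Proof.
have hdd s := hd_dlie hd_dual s.
pose v (s : 'I_N) := daddv_pi blie glie (tnth hd s).
have vb s : v s \in blie by exact: memv_pi.
have vo e s c i j : off c i j -> dcomp c (dpart e (v s)) i j = 0.
  by have [_ vo _] := blieE (vb s); rewrite dcomp_dpart => /vo->; rewrite if_same.
have gmE0 c i j : off c i j -> xvar c i j = gm c i j by move/off_neq; exact: xvar_gm_neq.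
apply: (PL_sub_supergroupI hmn h_basis hd_dual (T := AN_gens) (v := v)
  (a0 := 1) (a1 := - 2%:R)).
- exact: ideal_gen_ideal.
- exact: AN_idealE.
- move=> _ [[c [i [j [_ ->]]]]|[i ->]]; first by exists (ip i (+) ip j); exact: shom_xvar.
  exists false; apply: shomB; last exact: shom1.
  by rewrite -[false]/(false (+) false); apply: shomM; exact: gm_even.
- move=> _ [[c [i [j [_ ->]]]]|[i ->]]; first exact: sconst_xvar.
  by rewrite rmorphB rmorphM rmorph1 /= !sconst_gm eqxx mulr1 subrr.
- move=> _ [[c [i [j [ij ->]]]]|[i ->]].
    rewrite gmE0 // DU_gmE; apply: (ideal_sum (tens_genI _)) => k _.
    case/orP: (off_cotrans k ij) => [ik|kj]; first by apply: tens_genl; exact: KB_off.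
    by apply: tens_genr; exact: KB_off.
  set P := gm false i i * gm true i i; rewrite rmorphB rmorphM rmorph1 /=.
  apply: (ideal_trans (tens_genI _) (y := stens P P - 1)).
    rewrite opprB addrA subrK -stensM_even; last exact: gm_even.
    by apply: (ideal_mulB (tens_genI _)); exact: tens_gm_diag.
  by apply: tens_gen_unit; exact: KB_diag.
- move=> _ [[c [i [j [ij ->]]]]|[i ->]].
    by rewrite gmE0 // SU_gmE; apply: (gmi_off KBI KB_off).
  rewrite rmorphB rmorphM rmorph1 /= !SU_gmE.
  by apply: (gmi_diag KBI KB_off); exact: KB_diag.
- move=> _ [[c [i [j [ij ->]]]]|[i ->]].
    rewrite gmE0 // sstar_gmE; apply: (ideal_scale _ KBI).
    by apply: (gmi_off KBI KB_off); rewrite off_neg.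
  rewrite rmorphB rmorphM rmorph1 /= !sstar_gmE addbb !scale1r /=.
  (* The star exchanges the two copies, hence the order of the factors; these are even and
     commute. *)
  by rewrite (smul_evenC _ (gmi_even false i)); apply: (gmi_diag KBI KB_off); exact: KB_diag.
- by move=> s; have [] := blieE (vb s).
- move=> b e s _ [[c [i [j [ij ->]]]]|[i ->]].
    rewrite gmE0 // nab_gmE; case: b; do 1?apply: (ideal_scale _ KBI); apply: (ideal_sum KBI) => k _.
      case/orP: (off_cotrans k ij) => [ik|/(vo e s)->].
        by apply: (ideal_scale _ KBI); exact: KB_off.
      by rewrite scale0r; exact: (ideal0 KBI).
    case/orP: (off_cotrans k ij) => [/(vo e s)->|kj].
      by rewrite scale0r; exact: (ideal0 KBI).
    by apply: (ideal_scale _ KBI); exact: KB_off.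
  set x := dpart e (v s); have xe : dhomog e x by exact: dhomog_dpart.
  have n1 : nab b e x 1 = 0 := nab_nat b e x 1.
  rewrite nabB n1 subr0 (sderivM (nab_sderiv b xe)).
  rewrite (sigma_shom _ (gm_even false i)) andbF scale1r.
  set a : C := if b && e then -1 else 1.
  have D c : KB (nab b e x (gm c i i) - a * dcomp c x i i *: gm c i i).
    by apply: nab_gm_diag => //; exact: vo.
  apply: (ideal_trans KBI (y := (a * dcomp false x i i *: gm false i i) * gm true i i
     + gm false i i * (a * dcomp true x i i *: gm true i i))).
    rewrite opprD addrACA -mulrBl -mulrBr; apply: (ideal_add KBI).
      by apply: (idealMr KBI).
    by apply: (idealMl KBI).
  (* The eigenvalues of the two factors are, up to the common [a], opposite diagonal entries of an
     element of [blie], so they cancel on the product. *)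
  rewrite -scalerAl -scalerAr -scalerDl -mulrDr.
  have -> : dcomp false x i i + dcomp true x i i = 0.
    have [_ _ v0] := blieE (vb s); rewrite !dcomp_dpart addbb.
    by case: ifP => _; rewrite ?v0 ?addr0.
  by rewrite mulr0 scale0r; exact: (ideal0 KBI).
- by move=> a s; apply: dform_Rd_blie.
Qed.

End WithBracket.

End Subgroups.

Theorem corollary3p1 (R : realType) (m n : nat) (hmn : m <> n)
    (N : nat) (h hd : N.-tuple (dmx R[i] m n)) (par : 'I_N -> bool)
    (h_basis : homog_basis h par) (hd_dual : dual_basis h hd) :
  is_PL_sub_supergroup (superbracket h hd par) (@SU_ideal R[i] m n)
  /\ is_PL_sub_supergroup (superbracket h hd par) (@AN_ideal R[i] m n).
Proof.
by split; [exact: SU_PL_sub_supergroup|exact: AN_PL_sub_supergroup].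
Qed.
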